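(* The slice hyperholomorphic Bergman space $\mathcal{A}_{Slice}(\mathbb{B}^+)$ of the quaternionic half ball is a right quaternionic reproducing kernel Hilbert space. Moreover, for all $(q,r)\in\mathbb{B}^+\times\mathbb{B}^+$, $$K_{\mathbb{B}^+}(q,r)=K_{\mathbb{B}}(q,r)+K_{\mathbb{H}^+}(q,r),$$ where $K_{\mathbb{B}^+}$, $K_{\mathbb{B}}$, $K_{\mathbb{H}^+}$ are the slice Bergman kernels of the quaternionic half ball, unit ball and half space respectively.
   Context: $\mathbb{H}$ denotes the quaternions, $\mathbb{S}=\{I\in\mathbb{H}:I^2=-1\}$, $\mathbb{C}_I=\mathbb{R}+\mathbb{R}I$. $\mathbb{B}=\{|q|<1\}$, $\mathbb{H}^+=\{\mathrm{Re}(q)>0\}$, $\mathbb{B}^+=\mathbb{B}\cap\mathbb{H}^+$. For $U$ one of these domains and $U_I=U\cap\mathbb{C}_I$: a real differentiable $f:U\to\mathbb{H}$ is slice hyperholomorphic ($f\in\mathcal{SR}(U)$) if $(\partial_x+I\partial_y)f(x+Iy)=0$ on $U_I$ for every $I\in\mathbb{S}$. Fix $I\in\mathbb S$; $\mathcal{A}_{Slice}(U)=\{f\in\mathcal{SR}(U):\frac1\pi\int_{U_I}|f(p)|^2d\sigma_I(p)<\infty\}$, where $d\sigma_I(p)=dx\,dy$ for $p=x+Iy$, with inner product $\langle f,g\rangle=\frac1\pi\int_{U_I}\overline{f(p)}g(p)\,d\sigma_I(p)$; the space does not depend on $I$. A right quaternionic reproducing kernel Hilbert space is a complete right quaternionic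 inner product space of functions with continuous point evaluations. For $r\in U\cap\mathbb{C}_J$, the slice Bergman kernel is $K_U(q,r)=\mathrm{ext}[K_{U_J}(\cdot,r)](q)$, where $K_{U_J}(z,r)$ is the complex Bergman kernel of $U_J\subset\mathbb{C}_J\cong\mathbb{C}$ for the measure $\frac1\pi dx\,dy$, and for holomorphic $g$ on $U_J$, with $q=x+I_qy$, $z=x+Jy$, $\mathrm{ext}[g](q)=\frac12\left(g(z)+g(\overline z)\right)+\frac{I_qJ}{2}\left(g(\overline z)-g(z)\right)$. Explicitly, $K_{\mathbb{B}_J}(z,r)=(1-z\overline r)^{-2}$ and $K_{\mathbb{C}_J^+}(z,r)=(z+\overline r)^{-2}$, where $\mathbb{C}_J^+=\mathbb{H}^+\cap\mathbb{C}_J$. *)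

(* Defs.v *)
From HB Require Import structures.
From mathcomp Require Import all_boot all_order all_algebra.
From mathcomp Require Import ring lra.
From mathcomp Require Import all_classical all_reals all_analysis.
From mathcomp Require Import complex.

Set Implicit Arguments.
Unset Strict Implicit.
Unset Printing Implicit Defensive.

Import Order.TTheory GRing.Theory Num.Theory.
Import numFieldNormedType.Exports.

Local Open Scope classical_set_scope.
Local Open Scope ring_scope.

Record quat (R : Type) := Quat { qre : R; qi : R; qj : R; qk : R }.

Section QuaternionAlgebra.
Variable R : realType.

Definition tuple_of_quat (q : quat R) : R * R * R * R :=
  (qre q, qi q, qj q, qk q).
Definition quat_of_tuple (t : R * R * R * R) : quat R :=
  let: (a, b, c, d) := t in Quat a b c d.

Lemma tuple_of_quatK : cancel tuple_of_quat quat_of_tuple.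
Proof. by case. Qed.

HB.instance Definition _ := Choice.copy (quat R) (can_type tuple_of_quatK).

Definition qadd (p q : quat R) :=
  Quat (qre p + qre q) (qi p + qi q) (qj p + qj q) (qk p + qk q).
Definition qopp (q : quat R) := Quat (- qre q) (- qi q) (- qj q) (- qk q).

Fact qaddA : associative qadd.
Proof. by move=> p q r; rewrite /qadd /= !addrA. Qed.
Fact qaddC : commutative qadd.
Proof. by move=> p q; rewrite /qadd; congr Quat; rewrite addrC. Qed.
Fact qadd0 : left_id (Quat 0 0 0 0) qadd.
Proof. by case=> *; rewrite /qadd /= !add0r. Qed.
Fact qaddN : left_inverse (Quat 0 0 0 0) qopp qadd.
Proof. by case=> *; rewrite /qadd /= !addNr. Qed.

HB.instance Definition _ :=
  GRing.isZmodule.Build (quat R) qaddA qaddC qadd0 qaddN.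

Definition qmul (p q : quat R) := Quat
  (qre p * qre q - qi p * qi q - qj p * qj q - qk p * qk q)
  (qre p * qi q + qi p * qre q + qj p * qk q - qk p * qj q)
  (qre p * qj q - qi p * qk q + qj p * qre q + qk p * qi q)
  (qre p * qk q + qi p * qj q - qj p * qi q + qk p * qre q).

Fact qmulA : associative qmul.
Proof. by move=> p q r; rewrite /qmul /=; congr Quat; ring. Qed.
Fact qmul1l : left_id (Quat 1 0 0 0) qmul.
Proof. by case=> *; rewrite /qmul /=; congr Quat; ring. Qed.
Fact qmul1r : right_id (Quat 1 0 0 0) qmul.
Proof. by case=> *; rewrite /qmul /=; congr Quat; ring. Qed.
Fact qmulDl : left_distributive qmul +%R.
Proof. by move=> p q r; congr Quat => /=; ring. Qed.
Fact qmulDr : right_distributive qmul +%R.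
Proof. by move=> p q r; congr Quat => /=; ring. Qed.
Fact quat1_neq0 : Quat 1 0 0 0 != 0 :> quat R.
Proof. by apply/eqP => -[/eqP]; rewrite oner_eq0. Qed.

HB.instance Definition _ := GRing.Zmodule_isNzRing.Build (quat R)
  qmulA qmul1l qmul1r qmulDl qmulDr quat1_neq0.

Definition qscale (a : R) (q : quat R) :=
  Quat (a * qre q) (a * qi q) (a * qj q) (a * qk q).

Fact qscaleA a b q : qscale a (qscale b q) = qscale (a * b) q.
Proof. by rewrite /qscale /= !mulrA. Qed.
Fact qscale1 : left_id 1 qscale.
Proof. by case=> *; rewrite /qscale /= !mul1r. Qed.
Fact qscaleDr : right_distributive qscale +%R.
Proof. by move=> a p q; congr Quat => /=; ring. Qed.
Fact qscaleDl q : {morph qscale^~ q : a b / a + b}.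
Proof. by move=> a b; congr Quat => /=; ring. Qed.

HB.instance Definition _ := GRing.Zmodule_isLmodule.Build R (quat R)
  qscaleA qscale1 qscaleDr qscaleDl.

Fact qscaleAl (a : R) (p q : quat R) : a *: (p * q) = a *: p * q.
Proof. by congr Quat => /=; ring. Qed.
HB.instance Definition _ := GRing.Lmodule_isLalgebra.Build R (quat R) qscaleAl.

Fact qscaleAr (a : R) (p q : quat R) : a *: (p * q) = p * (a *: q).
Proof. by congr Quat => /=; ring. Qed.
HB.instance Definition _ := GRing.Lalgebra_isAlgebra.Build R (quat R) qscaleAr.

Definition qnorm (q : quat R) : R :=
  Num.sqrt (qre q ^+ 2 + qi q ^+ 2 + qj q ^+ 2 + qk q ^+ 2).

Fact sumsq_ge0 (a b c d : R) : 0 <= a ^+ 2 + b ^+ 2 + c ^+ 2 + d ^+ 2.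
Proof. by rewrite !addr_ge0 ?sqr_ge0. Qed.

Fact ler_qnormD p q : qnorm (p + q) <= qnorm p + qnorm q.
Proof.
case: p q => [a b c d] [a' b' c' d']; rewrite /qnorm /=.
set P := a ^+ 2 + b ^+ 2 + c ^+ 2 + d ^+ 2.
set Q := a' ^+ 2 + b' ^+ 2 + c' ^+ 2 + d' ^+ 2.
have P0 : 0 <= P by exact: sumsq_ge0.
have Q0 : 0 <= Q by exact: sumsq_ge0.
rewrite -[leRHS]ger0_norm ?addr_ge0 ?sqrtr_ge0// -sqrtr_sqr.
rewrite ler_sqrt ?sqr_ge0// [leRHS]sqrrD !sqr_sqrtr// -sqrtrM//.
set s := a * a' + b * b' + c * c' + d * d'.
have sPQ : s <= Num.sqrt (P * Q).
  rewrite (le_trans (ler_norm _))// -sqrtr_sqr ler_sqrt ?mulr_ge0//.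
  rewrite -subr_ge0.
  have -> : P * Q - s ^+ 2 =
      (a * b' - b * a') ^+ 2 + (a * c' - c * a') ^+ 2 +
      (a * d' - d * a') ^+ 2 + (b * c' - c * b') ^+ 2 +
      (b * d' - d * b') ^+ 2 + (c * d' - d * c') ^+ 2.
    by rewrite /P /Q /s; ring.
  by rewrite !addr_ge0 ?sqr_ge0.
have -> : (a + a') ^+ 2 + (b + b') ^+ 2 + (c + c') ^+ 2 + (d + d') ^+ 2 =
    P + s *+ 2 + Q by rewrite /P /Q /s; ring.
by rewrite lerD2r lerD2l lerMn2r sPQ orbT.
Qed.

Fact qnormZ (a : R) q : qnorm (a *: q) = `|a| * qnorm q.
Proof.
rewrite /qnorm -sqrtr_sqr -sqrtrM ?sqr_ge0//; congr Num.sqrt => /=; ring.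
Qed.

Fact qnorm_eq0 q : qnorm q = 0 -> q = 0.
Proof.
case: q => [a b c d] /eqP; rewrite sqrtr_eq0 /= => h.
have sq0 (x y : R) : x ^+ 2 + y <= 0 -> 0 <= y -> x = 0.
  move=> xy y0; apply/eqP; rewrite -sqrf_eq0 eq_le sqr_ge0 andbT.
  by rewrite (le_trans _ xy)// lerDl.
congr Quat; [apply: (sq0 a (b ^+ 2 + c ^+ 2 + d ^+ 2))
  |apply: (sq0 b (a ^+ 2 + c ^+ 2 + d ^+ 2))
  |apply: (sq0 c (a ^+ 2 + b ^+ 2 + d ^+ 2))
  |apply: (sq0 d (a ^+ 2 + b ^+ 2 + c ^+ 2))];
  rewrite ?addr_ge0 ?sqr_ge0//; apply: le_trans h; lra.
Qed.

(* This provides the Euclidean norm and its topology, so that [`|q|] is the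
   quaternionic modulus and [differentiable] is real differentiability. *)
HB.instance Definition _ := Lmodule_isNormed.Build R (quat R)
  ler_qnormD qnormZ qnorm_eq0.

Definition qconj (q : quat R) := Quat (qre q) (- qi q) (- qj q) (- qk q).

Definition qim (q : quat R) := Quat 0 (qi q) (qj q) (qk q).

End QuaternionAlgebra.

Section SliceDomains.
Variable R : realType.

Definition imag_unit : set (quat R) := [set I | I ^+ 2 = -1].

Definition slice_pt (I : quat R) (z : R[i]) : quat R :=
  (complex.Re z)%:A + I * (complex.Im z)%:A.

Definition slice_plane (I : quat R) : set (quat R) := range (slice_pt I).

(* Coordinate of [r] in the plane [slice_plane J]; see [slice_coordK]. *)
Definition slice_coord (J r : quat R) : R[i] := Complex (qre r) (- qre (J * r)).

Definition slice (I : quat R) (U : set (quat R)) : set R[i] :=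
  slice_pt I @^-1` U.

Definition qball : set (quat R) := [set q | `|q| < 1].
Definition qhalf_space : set (quat R) := [set q | 0 < qre q].
Definition qhalf_ball : set (quat R) := qball `&` qhalf_space.

End SliceDomains.

Arguments imag_unit {R}.
Arguments qball {R}.
Arguments qhalf_space {R}.
Arguments qhalf_ball {R}.

Section PlanarIntegral.
Variable R : realType.

Notation mu2 := ((@lebesgue_measure R) \x (@lebesgue_measure R))%E.

Definition planar (Om : set R[i]) : set (R * R) :=
  [set p | Om (Complex p.1 p.2)].

Definition planar_integral (Om : set R[i]) (F : R[i] -> R) : \bar R :=
  (\int[mu2]_(p in planar Om) (F (Complex p.1 p.2))%:E)%E.

Definition planar_Rintegral (Om : set R[i]) (F : R[i] -> R) : R :=
  fine (planar_integral Om F).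

Definition planar_Cintegral (Om : set R[i]) (F : R[i] -> R[i]) : R[i] :=
  Complex (planar_Rintegral Om (fun z => complex.Re (F z)))
          (planar_Rintegral Om (fun z => complex.Im (F z))).

Definition planar_Hintegral (Om : set R[i]) (F : R[i] -> quat R) : quat R :=
  Quat (planar_Rintegral Om (fun z => qre (F z)))
       (planar_Rintegral Om (fun z => qi (F z)))
       (planar_Rintegral Om (fun z => qj (F z)))
       (planar_Rintegral Om (fun z => qk (F z))).

End PlanarIntegral.

Section ComplexBergman.
Variable R : realType.

Definition holomorphic_on (Om : set R[i]) (f : R[i] -> R[i]) :=
  forall z, Om z -> derivable (f : R[i]^o -> R[i]^o) z 1.

Definition bergman_space (Om : set R[i]) : set (R[i] -> R[i]) :=
  [set f | holomorphic_on Om f /\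
    ((pi^-1)%R%:E * planar_integral Om (fun z => complex.Re (`|f z| ^+ 2))%R < +oo)%E].

Definition bergman_ip (Om : set R[i]) (f g : R[i] -> R[i]) : R[i] :=
  (pi^-1)%:C%C * planar_Cintegral Om (fun z => (f z)^*%C * g z).

(* [k] is the reproducing kernel of [bergman_space Om] at [w]: the Riesz
   representative of the evaluation at [w], unique as a function on [Om]. *)
Definition is_bergman_kernel_at (Om : set R[i]) (w : R[i]) (k : R[i] -> R[i]) :=
  bergman_space Om k /\
  forall f, bergman_space Om f -> bergman_ip Om k f = f w.

(* Only the values at [z] in [Om] are meaningful. *)
Definition bergman_kernel (Om : set R[i]) (z w : R[i]) : R[i] :=
  xget (fun=> 0) (is_bergman_kernel_at Om w) z.

End ComplexBergman.

Section SliceHyperholomorphic.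
Variable R : realType.

Definition slice_hyperholomorphic (U : set (quat R)) (f : quat R -> quat R) :=
  (forall q, U q -> differentiable f q) /\
  (forall I x y, imag_unit I -> U (slice_pt I (Complex x y)) ->
    derive1 (fun t => f (slice_pt I (Complex t y))) x +
    I * derive1 (fun t => f (slice_pt I (Complex x t))) y = 0).

Definition slice_bergman (I : quat R) (U : set (quat R)) :
    set (quat R -> quat R) :=
  [set f | slice_hyperholomorphic U f /\
    ((pi^-1)%R%:E * planar_integral (slice I U)
       (fun z => `|f (slice_pt I z)| ^+ 2)%R < +oo)%E].

Definition slice_ip (I : quat R) (U : set (quat R)) (f g : quat R -> quat R) :
    quat R :=
  pi^-1 *: planar_Hintegral (slice I U)
    (fun z => qconj (f (slice_pt I z)) * g (slice_pt I z)).

(* If [q] is real then [y = 0] and the term containing [Iq] vanishes. The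
   choice between [(Iq, y)] and [(- Iq, - y)] is irrelevant: see [ext_slice]. *)
Definition ext (J : quat R) (g : R[i] -> quat R) (q : quat R) : quat R :=
  let y := `|qim q| in
  let Iq := y^-1 *: qim q in
  let z := Complex (qre q) y in
  2^-1 *: (g z + g z^*%C) + 2^-1 *: (Iq * J) * (g z^*%C - g z).

(* [K_U(q, r)] for [r] in the plane of [J], where [K_{U_J}(., r)] is carried by
   [slice_pt J] from the complex plane to that of [J]. *)
Definition slice_kernel (U : set (quat R)) (J q r : quat R) : quat R :=
  ext J (fun z => slice_pt J (bergman_kernel (slice J U) z (slice_coord J r))) q.

End SliceHyperholomorphic.

Section ReproducingKernelHilbert.
Variables (R : realType) (X : Type).
Implicit Types f g h : X -> quat R.

Definition ip_norm (ip : (X -> quat R) -> (X -> quat R) -> quat R) f : R :=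
  Num.sqrt (qre (ip f f)).

(* Functions on [U] are represented by total functions, considered up to
   equality on [U]. *)
Record right_quaternionic_RKHS (U : set X) (A : set (X -> quat R))
    (ip : (X -> quat R) -> (X -> quat R) -> quat R) : Prop := {
  rkhs_ext : forall f g, A f -> (forall x, U x -> f x = g x) -> A g;
  rkhs0 : A (fun=> 0);
  rkhsD : forall f g, A f -> A g -> A (f \+ g);
  rkhsZ : forall f (a : quat R), A f -> A (fun x => f x * a);
  rkhs_ipC : forall f g, A f -> A g -> ip g f = qconj (ip f g);
  rkhs_ipD : forall f g h, A f -> A g -> A h ->
    ip f (g \+ h) = ip f g + ip f h;
  rkhs_ipZ : forall f g (a : quat R), A f -> A g ->
    ip f (fun x => g x * a) = ip f g * a;
  rkhs_ip_ge0 : forall f, A f -> 0 <= qre (ip f f);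
  rkhs_ip_eq0 : forall f, A f -> ip f f = 0 <-> (forall x, U x -> f x = 0);
  rkhs_complete : forall u : nat -> X -> quat R, (forall n, A (u n)) ->
    (forall e : R, 0 < e -> exists N, forall m n, (N <= m)%N -> (N <= n)%N ->
      ip_norm ip (u m \- u n) < e) ->
    exists2 f, A f & ip_norm ip (u n \- f) @[n --> \oo] --> (0 : R);
  rkhs_eval_continuous : forall x, U x -> forall f, A f ->
    forall e : R, 0 < e -> exists2 d : R, 0 < d &
      forall g, A g -> ip_norm ip (g \- f) < d -> `|g x - f x| < e
}.

End ReproducingKernelHilbert.

Section SliceFacts.
Variable R : realType.
Implicit Types (I J : quat R) (z : R[i]).

Lemma imag_unitP I : imag_unit I -> qre I = 0 /\ `|I| = 1.
Proof.
case: I => a b c d; rewrite /imag_unit /= expr2 => -[].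
rewrite [RHS]/= => h1; rewrite oppr0 => h2 h3 h4.
have a0 : a = 0.
  apply/eqP/negPn/negP => a0.
  have e t : a * t + t * a = 0 -> t = 0.
    rewrite [t * a]mulrC -mulr2n => /eqP; rewrite mulrn_eq0 /= mulf_eq0.
    by rewrite (negPf a0) /= => /eqP.
  have b0 : b = 0 by apply: e; rewrite -h2; ring.
  have c0 : c = 0 by apply: e; rewrite -h3; ring.
  have d0 : d = 0 by apply: e; rewrite -h4; ring.
  have := sqr_ge0 a; rewrite expr2; move: h1; rewrite b0 c0 d0; lra.
split=> //=; change (qnorm (Quat a b c d) = 1); rewrite /qnorm /= -[RHS]sqrtr1.
by congr Num.sqrt; move: h1; rewrite a0 !expr2; lra.
Qed.

Lemma slice_coordK J : imag_unit J -> cancel (slice_pt J) (slice_coord J).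
Proof.
case: J => a b c d Ju [x y]; have [/= a0 _] := imag_unitP Ju; move: Ju.
rewrite /imag_unit /= expr2 => -[/= sq _ _ _].
rewrite /slice_coord; congr Complex; rewrite /= a0; first by ring.
have {}sq : b * b + c * c + d * d = 1 by move: sq; rewrite a0; lra.
by transitivity (y * (b * b + c * c + d * d)); [ring | rewrite sq mulr1].
Qed.

Lemma ext_slice J (g : R[i] -> quat R) I x y : imag_unit I ->
  let z := Complex x y in
  ext J g (slice_pt I z) =
  2^-1 *: (g z + g z^*%C) + 2^-1 *: (I * J) * (g z^*%C - g z).
Proof.
move=> Iu; have [I0 I1] := imag_unitP Iu.
have re : qre (slice_pt I (Complex x y)) = x by rewrite /= I0; ring.
have im : qim (slice_pt I (Complex x y)) = y *: I.
  by case: I I0 {Iu I1 re} => a b c d /= ->; congr Quat => /=; ring.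
rewrite /ext re im normrZ I1 mulr1 /=; have [y0|y0|->] := ltgtP y 0.
- rewrite ltr0_norm // opprK scalerA -[_^-1 * _]opprK -mulNr -invrN opprK.
  rewrite mulVf ?lt_eqF // scaleN1r mulNr !scalerN mulNr -mulrN opprB.
  by congr (_ *: _ + _); rewrite addrC.
- by rewrite gtr0_norm // scalerA mulVf ?gt_eqF // scale1r.
- by rewrite normr0 oppr0 subrr !mulr0.
Qed.

End SliceFacts.

(* Main.v *)
Require Import Defs.
From HB Require Import structures.
From mathcomp Require Import all_boot all_order all_algebra.
From mathcomp Require Import ring lra.
From mathcomp Require Import all_classical all_reals all_analysis.
From mathcomp Require Import measurable_realfun complex.

Set Implicit Arguments.
Unset Strict Implicit.
Unset Printing Implicit Defensive.

Import Order.TTheory GRing.Theory Num.Theory.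
Import numFieldNormedType.Exports.
Import Normc.

Local Open Scope classical_set_scope.
Local Open Scope ring_scope.

(* On each slice the kernel identity is a statement about the complex half disc. Let [phi] be
   the Riemann map of a plane domain with [phi w = 0], and multiply a holomorphic [f] by a
   weight depending on [|phi|^2] that vanishes near the boundary. Green's formula, applied with
   a Cauchy kernel that is smoothed near [w], gives in the limit that the integral of
   [conj (phi') f] is [pi s f(w)] for a constant [s], so the kernel at [w] is a multiple of
   [phi']. The Riemann map of the half disc is
   [(z - w) (1 + z w) / ((z + conj w) (1 - z (conj w)))], and its derivative is a multiple of the
   sum of the kernels of the disc and of the half plane.

   The same mean value argument bounds a holomorphic function and its increments by its L2 norm,
   which makes evaluations continuous and limits of Cauchy sequences holomorphic on one slice.
   These limits extend to the half ball by [ext]: the extension is differentiable, also at real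
   points, and satisfies the Cauchy-Riemann equations on every slice. Conversely a slice
   hyperholomorphic function is the extension of its restriction to one slice. This
   representation formula needs unique continuation from the real segment: if [h] is holomorphic
   on the half disc and vanishes on the real segment, Green's formula on the upper half for
   [h (B / B(w))^n / (z - w)], with [B = psi / (psi - i T)^2] and [psi = 1/z - z], localised to
   where [|B|] is large, yields [h(w) = 0] as [n] tends to infinity. *)

(** * Continuity and Wirtinger derivatives in the plane *)

(** Every analytic fact is reduced to one identity: the conj-derivative of a function vanishing near
    the boundary has integral zero. A singular kernel cannot enter it, so [1 / z] is smoothed; the
    weights in [|phi|^2] are conj-derivatives of the smoothed [1 / phi], which is where the factor
    conj (phi') comes from. The kernels add because, with v = conj w, (1 - z v)^2 + (z + v)^2 = (1 +
    z^2) (1 + v^2).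

    On the quaternionic side the obstacle is that the norm sees a single slice, while two slices
    share only the real segment. Statements off the chosen slice therefore pass through the
    representation formula, hence through unique continuation. There psi sends the upper half of the
    half disc to the fourth quadrant and the real segment to the positive axis. On the rest of the
    boundary psi = - i y, and |B| = y / (y + T)^2 is at most 1 / (4 T), whereas |B(w)| exceeds this
    bound when T = |psi(w)|. Powers of B / B(w) thus damp that part of the boundary, and the segment
    contributes nothing because [h] vanishes on it. *)

Section ComplexModulus.
Variable R : realType.
Implicit Types (z w : R[i]) (x y : R).

Lemma normc_ge0 z : 0 <= normc z.
Proof. by case: z => a b; exact: sqrtr_ge0. Qed.

Lemma normcB z w : normc (z - w) = normc (w - z).
Proof. by rewrite -(normcN (z - w)) opprB. Qed.

Lemma le_normcD3 z w u : normc (z - w) <= normc (z - u) + normc (u - w).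
Proof. by rewrite -[z - w](subrKA u) le_normcD. Qed.

Lemma le_normcB z w : normc (z - w) <= normc z + normc w.
Proof. by rewrite -(normcN w) le_normcD. Qed.

Lemma sqr_normcE z : normc z ^+ 2 = complex.Re z ^+ 2 + complex.Im z ^+ 2.
Proof. by case: z => a b; rewrite /= sqr_sqrtr// addr_ge0 ?sqr_ge0. Qed.

Lemma normRe_le z : `|complex.Re z| <= normc z.
Proof.
rewrite -(ler_pXn2r (n := 2)) ?nnegrE ?normc_ge0// sqr_normcE real_normK ?num_real//.
by rewrite lerDl sqr_ge0.
Qed.

Lemma normIm_le z : `|complex.Im z| <= normc z.
Proof.
rewrite -(ler_pXn2r (n := 2)) ?nnegrE ?normc_ge0// sqr_normcE real_normK ?num_real//.
by rewrite lerDr sqr_ge0.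
Qed.

Lemma normc_le_ReIm z : normc z <= `|complex.Re z| + `|complex.Im z|.
Proof.
rewrite -(ler_pXn2r (n := 2)) ?nnegrE ?normc_ge0 ?addr_ge0// sqr_normcE.
rewrite -[in leLHS](real_normK (num_real (complex.Re z))).
rewrite -[in leLHS](real_normK (num_real (complex.Im z))).
rewrite sqrrD; set a := `|_|; set b := `|_|.
have : 0 <= a * b by rewrite mulr_ge0 ?normr_ge0.
by lra.
Qed.

Lemma normc_real x : normc (x%:C)%C = `|x|.
Proof. by rewrite /= expr0n addr0 sqrtr_sqr. Qed.

Lemma normcJ' z : normc (z^*)%C = normc z.
Proof. by case: z => a b /=; rewrite sqrrN. Qed.

Lemma normc_gt0 z : (0 < normc z) = (z != 0).
Proof.
rewrite lt_neqAle normc_ge0 andbT eq_sym; congr negb.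
by apply/eqP/eqP => [/eq0_normc//|->]; exact: normc0.
Qed.

Lemma mulJc z : (z^*)%C * z = ((normc z ^+ 2)%:C)%C.
Proof.
by rewrite sqr_normcE; case: z => a b; apply/eqP; rewrite eq_complex /=;
  apply/andP; split; apply/eqP; ring.
Qed.

End ComplexModulus.

(** * Compactness of squares by bisection *)

Section Squares.
Variable R : realType.
Implicit Types (x y s : R).

(** Half-open, so that the four quarters partition a square and integrals add up; the closed
    [csquare] carries compactness and the boundary values. *)
Definition square x y s : set R[i] :=
  [set z | x < complex.Re z <= x + s /\ y < complex.Im z <= y + s].

Definition csquare x y s : set R[i] :=
  [set z | x <= complex.Re z <= x + s /\ y <= complex.Im z <= y + s].

(** Goursat's argument: if the conclusion failed, one quarter would fail at every stage, and the
    nested failing squares would shrink to a point [c] near which the last hypothesis forbids small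
    failing squares. *)
Lemma square_bisection (P : R -> R -> R -> Prop) X Y S : 0 < S ->
  (forall x y s, 0 < s -> X <= x -> x + s <= X + S -> Y <= y -> y + s <= Y + S ->
    P x y (s / 2) -> P (x + s / 2) y (s / 2) -> P x (y + s / 2) (s / 2) ->
    P (x + s / 2) (y + s / 2) (s / 2) -> P x y s) ->
  (forall c : R[i], csquare X Y S c -> exists2 d, 0 < d &
    forall x y s, 0 < s < d -> X <= x -> x + s <= X + S ->
      Y <= y -> y + s <= Y + S -> csquare x y s c -> P x y s) ->
  P X Y S.
Proof.
move=> S0 Pstep Ploc; apply: contrapT => nP.
pose sub (t : R * R) s := [/\ X <= t.1, t.1 + s <= X + S, Y <= t.2 & t.2 + s <= Y + S].
have ex (t : R * R) s : 0 < s -> sub t s -> ~ P t.1 t.2 s ->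
    exists t' : R * R, [/\ ~ P t'.1 t'.2 (s / 2), sub t' (s / 2) &
      [/\ t.1 <= t'.1, t'.1 + s / 2 <= t.1 + s, t.2 <= t'.2 & t'.2 + s / 2 <= t.2 + s]].
  case: t => x y s0 [/= h1 h2 h3 h4] np; apply: contrapT => no.
  apply: np; apply: Pstep => //; apply: contrapT => np; apply: no.
  - by exists (x, y); split => //=; try split; rewrite /=; lra.
  - by exists (x + s / 2, y); split => //=; try split; rewrite /=; lra.
  - by exists (x, y + s / 2); split => //=; try split; rewrite /=; lra.
  - by exists (x + s / 2, y + s / 2); split => //=; try split; rewrite /=; lra.
pose next (t : R * R) s : R * R := xget t [set t' : R * R |
  [/\ ~ P t'.1 t'.2 (s / 2), sub t' (s / 2) &
      [/\ t.1 <= t'.1, t'.1 + s / 2 <= t.1 + s, t.2 <= t'.2 & t'.2 + s / 2 <= t.2 + s]]].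
pose sd n : R := S / 2 ^+ n.
have sd0 n : 0 < sd n by rewrite divr_gt0// exprn_gt0.
have sdS n : sd n / 2 = sd n.+1 by rewrite /sd exprS invfM; ring.
pose t := fix t n := if n is m.+1 then next (t m) (sd m) else (X, Y).
have tP n : sub (t n) (sd n) /\ ~ P (t n).1 (t n).2 (sd n).
  elim: n => [|n [h1 h2]]; first by rewrite /= /sd expr0 divr1; split=> //; split=> /=; lra.
  have /(xgetPex (t n))[] := ex _ _ (sd0 n) h1 h2.
  by rewrite -/(next _ _) sdS.
have tS n : [/\ (t n).1 <= (t n.+1).1, (t n.+1).1 + sd n.+1 <= (t n).1 + sd n,
    (t n).2 <= (t n.+1).2 & (t n.+1).2 + sd n.+1 <= (t n).2 + sd n].
  have [h1 h2] := tP n.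
  have /(xgetPex (t n))[] := ex _ _ (sd0 n) h1 h2.
  by rewrite -/(next _ _) sdS.
have tD n k : [/\ (t n).1 <= (t (n + k)%N).1, (t (n + k)%N).1 + sd (n + k)%N <= (t n).1 + sd n,
    (t n).2 <= (t (n + k)%N).2 & (t (n + k)%N).2 + sd (n + k)%N <= (t n).2 + sd n].
  elim: k => [|k [h1 h2 h3 h4]]; first by rewrite addn0.
  by rewrite addnS; have [] := tS (n + k)%N; split; lra.
(* The left ends increase and stay below every right end, so their supremum lies in all the nested
   intervals. *)
have lim (f : nat -> R) : (forall n k, f n <= f (n + k)%N /\ f (n + k)%N + sd (n + k)%N <= f n + sd n) ->
    exists c, forall n, f n <= c <= f n + sd n.
  move=> fD; exists (sup (range f)) => n.
  have ub m : ubound (range f) (f m + sd m).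
    move=> _ [k _ <-]; case: (leqP m k) => mk.
      by have [_] := fD m (k - m)%N; rewrite subnKC//; have := sd0 k; lra.
    by have [+ _] := fD k (m - k)%N; rewrite subnKC ?(ltnW mk)//; have := sd0 m; lra.
  apply/andP; split.
    by apply: ub_le_sup; [exists (f 0%N + sd 0%N); exact: ub|exists n].
  by apply: ge_sup => //; exists (f 0%N); exists 0%N.
have [cx cxP] : exists c, forall n, (t n).1 <= c <= (t n).1 + sd n.
  by apply: lim => n k; have [] := tD n k.
have [cy cyP] : exists c, forall n, (t n).2 <= c <= (t n).2 + sd n.
  by apply: lim => n k; have [] := tD n k.
have cQ : csquare X Y S (Complex cx cy).
  by have := cxP 0%N; have := cyP 0%N; rewrite /= /sd expr0 divr1.
have [d d0 dP] := Ploc _ cQ.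
have [n nd] : exists n, sd n < d.
  exists (Num.truncn (S / d)).+1.
  rewrite /sd ltr_pdivrMr ?exprn_gt0// mulrC -ltr_pdivrMr//.
  rewrite (lt_le_trans (truncnS_gt _))// -natrX ler_nat.
  exact/ltnW/ltn_expl.
have [[h1 h2 h3 h4] h5] := tP n.
by apply: h5; apply: (dP _ _ _ _ h1 h2 h3 h4); [rewrite sd0 nd|split; rewrite ?cxP ?cyP].
Qed.

End Squares.

Section PlanarMeasurability.
Variable R : realType.
Implicit Types (D O : set R[i]) (F G : R[i] -> R[i]).

Definition copen O := forall c, O c ->
  exists2 d : R, 0 < d & forall z, normc (z - c) < d -> O z.

(** Measured by the real-valued [normc], since the norm of [R[i]] takes its values in [R[i]].
    Continuity is relative to [D], so the same rules serve open sets and closed squares. *)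
Definition ccont D F := forall c, D c -> forall e : R, 0 < e ->
  exists2 d : R, 0 < d & forall z, D z -> normc (z - c) < d -> normc (F z - F c) < e.

Lemma ccontS D D' F : D `<=` D' -> ccont D' F -> ccont D F.
Proof.
move=> DD' Fc c Dc e e0; have [d d0 dP] := Fc c (DD' _ Dc) e e0.
by exists d => // z Dz; apply: dP; exact: DD'.
Qed.

(** The sigma-algebra of the plane is the product one, generated by rectangles; an open set is a
    countable union of boxes with rational centre and radius. *)
Lemma copen_measurable O : copen O -> measurable (planar O).
Proof.
move=> oO.
pose box (q : rat * rat * rat) : set (R * R) :=
  `]ratr q.1.1 - ratr q.2, (ratr q.1.1 + ratr q.2 : R)[ `*`
  `]ratr q.1.2 - ratr q.2, (ratr q.1.2 + ratr q.2 : R)[.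
have -> : planar O = \bigcup_q (if pselect (box q `<=` planar O) then box q else set0).
  apply/seteqP; split=> [[x y] Op|p [q qT]]; last first.
    by case: pselect => // bO; exact: bO.
  have [d d0 dP] := oO _ Op.
  (* Two points of a box of radius [r] differ by less than [2 r] in each coordinate, hence by less
     than [4 r] in modulus. *)
  have [r] := @rat_in_itvoo R 0 (d / 4) ltac:(lra).
  rewrite in_itv/= => /andP[r0 rd].
  have [qx] := @rat_in_itvoo R (x - ratr r) (x + ratr r) ltac:(lra).
  rewrite in_itv/= => /andP[qx1 qx2].
  have [qy] := @rat_in_itvoo R (y - ratr r) (y + ratr r) ltac:(lra).
  rewrite in_itv/= => /andP[qy1 qy2].
  exists (qx, qy, r) => //; case: pselect => [?|[]] /=.
    by rewrite /box/=; split; rewrite /= in_itv/=; apply/andP; split; lra.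
  move=> [x' y']; rewrite /box/= !in_itv/= => -[/andP[? ?] /andP[? ?]].
  apply: dP; rewrite (le_lt_trans (normc_le_ReIm _))//=.
  have : `|x' - x| < 2 * ratr r by rewrite ltr_norml; apply/andP; split; lra.
  have : `|y' - y| < 2 * ratr r by rewrite ltr_norml; apply/andP; split; lra.
  by lra.
apply: countable_bigcupT_measurable => // q; case: pselect => ? /=; last exact: measurable0.
by apply: measurableX; exact: measurable_itv.
Qed.

Lemma ccont_measurable_Re D F : measurable (planar D) -> ccont D F ->
  measurable_fun (planar D) (fun p => complex.Re (F (Complex p.1 p.2))).
Proof.
move=> mD Fc; apply: (measurability _ (RGenOInfty.measurableE R)).
move=> _ [_ [a ->] <-].
pose O := [set z | exists c d, [/\ D c, a < complex.Re (F c),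
  normc (z - c) < d & forall w, D w -> normc (w - c) < d -> a < complex.Re (F w)]].
have -> : planar D `&` (fun p => complex.Re (F (Complex p.1 p.2))) @^-1` `]a, +oo[ =
    planar D `&` planar O.
  apply/seteqP; split=> [[x y]/= [Dp]|[x y]/= [Dp]].
    rewrite in_itv/= andbT => aF; split => //.
    have [d d0 dP] := Fc _ Dp (complex.Re (F (Complex x y)) - a) ltac:(lra).
    exists (Complex x y), d; split => //; first by rewrite subrr normc0.
    move=> w Dw /(dP _ Dw) h.
    have := le_lt_trans (normRe_le _) h; rewrite ltr_norml raddfB/= => /andP[? _].
    by lra.
  move=> [c [d [Dc ac pc dP]]]; split=> //=; rewrite in_itv/= andbT.
  exact: dP.
apply: measurableI => //; apply: copen_measurable => z [c [d [Dc ac zc dP]]].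
exists (d - normc (z - c)); first by rewrite subr_gt0.
move=> w wz; exists c, d; split => //.
by rewrite (le_lt_trans (le_normcD3 _ _ z))// -ltrBrDr.
Qed.

Lemma ccont_Re_Im D F : ccont D F -> ccont D (fun z => 'i%C * F z)%R.
Proof.
move=> Fc c Dc e e0; have [d d0 dP] := Fc c Dc e e0; exists d => // z Dz zc.
by rewrite -mulrBr normcM /= expr0n/= expr1n add0r sqrtr1 mul1r; exact: dP.
Qed.

Lemma ccont_measurable_Im D F : measurable (planar D) -> ccont D F ->
  measurable_fun (planar D) (fun p => complex.Im (F (Complex p.1 p.2))).
Proof.
move=> mD Fc.
have -> : (fun p : R * R => complex.Im (F (Complex p.1 p.2))) =
    \- (fun p => complex.Re ('i%C * F (Complex p.1 p.2))%R).
  by apply/funext => p /=; case: (F _) => a b /=; rewrite mul0r mul1r sub0r opprK.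
exact: (measurable_funN (ccont_measurable_Re mD (ccont_Re_Im Fc))).
Qed.

End PlanarMeasurability.

Section ContinuityRules.
Variable R : realType.
Implicit Types (D O : set R[i]) (F G : R[i] -> R[i]).

Lemma ccont_cst D (a : R[i]) : ccont D (fun=> a).
Proof. by move=> c Dc e e0; exists 1 => // z _ _; rewrite subrr normc0. Qed.

Lemma ccont_id D : ccont D id.
Proof. by move=> c Dc e e0; exists e. Qed.

Lemma ccontD D F G : ccont D F -> ccont D G -> ccont D (fun z => F z + G z).
Proof.
move=> Fc Gc c Dc e e0.
have [d d0 dP] := Fc c Dc (e / 2) ltac:(lra).
have [d' d'0 d'P] := Gc c Dc (e / 2) ltac:(lra).
exists (Num.min d d'); first by rewrite lt_min d0.
move=> z Dz; rewrite lt_min => /andP[zd zd'].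
have -> : F z + G z - (F c + G c) = (F z - F c) + (G z - G c) by ring.
by rewrite (le_lt_trans (le_normcD _ _))// (splitr e) ltrD ?dP ?d'P.
Qed.

Lemma ccontM D F G : ccont D F -> ccont D G -> ccont D (fun z => F z * G z).
Proof.
move=> Fc Gc c Dc e e0.
set K := normc (F c) + normc (G c) + 1.
have K0 : 0 < K by rewrite /K; have := normc_ge0 (F c); have := normc_ge0 (G c); lra.
pose t := Num.min 1 (e / (2 * K)).
have t0 : 0 < t by rewrite lt_min ltr01 divr_gt0// mulr_gt0.
have [d d0 dP] := Fc c Dc t t0.
have [d' d'0 d'P] := Gc c Dc t t0.
exists (Num.min d d'); first by rewrite lt_min d0.
move=> z Dz; rewrite lt_min => /andP[/(dP _ Dz) h /(d'P _ Dz) h'].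
have -> : F z * G z - F c * G c =
  (F z - F c) * (G z - G c) + (F c * (G z - G c) + (F z - F c) * G c) by ring.
rewrite (le_lt_trans (le_normcD _ _))// (le_lt_trans (lerD (lexx _) (le_normcD _ _)))//.
rewrite !normcM.
have tK : t * K <= e / 2.
  rewrite (@le_trans _ _ (e / (2 * K) * K))//.
    by rewrite ler_pM2r// ge_min lexx orbT.
  have -> : e / (2 * K) * K = e / 2 by field; rewrite gt_eqF.
  by [].
set a := normc (F z - F c) in h *; set b := normc (G z - G c) in h' *.
have a0 : 0 <= a by exact: normc_ge0.
have b0 : 0 <= b by exact: normc_ge0.
have h1 : a * b <= t * 1.
  by apply: ler_pM => //; [exact: ltW|rewrite (le_trans (ltW h'))// ge_min lexx].
have h2 : normc (F c) * b <= normc (F c) * t by rewrite ler_wpM2l ?normc_ge0// ltW.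
have h3 : a * normc (G c) <= t * normc (G c) by rewrite ler_wpM2r ?normc_ge0// ltW.
have : t * K = t * 1 + (normc (F c) * t + t * normc (G c)) by rewrite /K; ring.
by lra.
Qed.

Lemma ccontJ D F : ccont D F -> ccont D (fun z => (F z)^*%C).
Proof.
move=> Fc c Dc e e0; have [d d0 dP] := Fc c Dc e e0; exists d => // z Dz zc.
by rewrite -rmorphB normcJ'; exact: dP.
Qed.

Lemma ccont_comp D D' F G : ccont D F -> ccont D' G -> (forall z, D z -> D' (F z)) ->
  ccont D (G \o F).
Proof.
move=> Fc Gc DD' c Dc e e0; have [d d0 dP] := Gc _ (DD' _ Dc) e e0.
have [d' d'0 d'P] := Fc _ Dc d d0; exists d' => // z Dz zc /=.
by apply: dP; [exact: DD'|exact: d'P].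
Qed.

Lemma eq_ccont D F G : (forall z, D z -> F z = G z) -> ccont D F -> ccont D G.
Proof.
move=> FG Fc c Dc e e0; have [d d0 dP] := Fc c Dc e e0; exists d => // z Dz zc.
by rewrite -!FG//; exact: dP.
Qed.

Lemma ccontN D F : ccont D F -> ccont D (fun z => - F z).
Proof.
move=> Fc; apply: (@eq_ccont _ (fun z => (-1) * F z)) => [z _|]; first by rewrite mulN1r.
by apply: ccontM => //; exact: ccont_cst.
Qed.

Lemma ccontB D F G : ccont D F -> ccont D G -> ccont D (fun z => F z - G z).
Proof. by move=> Fc Gc; apply: ccontD => //; exact: ccontN. Qed.

Lemma ccont_real D F (u : R -> R) : ccont D F -> continuous u ->
  ccont D (fun z => ((u (complex.Re (F z)))%:C)%C).
Proof.
move=> Fc uc c Dc e e0.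
have [d d0 dP] : \forall t \near complex.Re (F c), `|u (complex.Re (F c)) - u t| < e.
  by have /cvgrPdist_lt/(_ e e0) := uc (complex.Re (F c)).
have [d' d'0 d'P] := Fc c Dc d d0; exists d' => // z Dz zc.
rewrite -rmorphB normc_real distrC; apply: dP => /=.
by rewrite -raddfB (le_lt_trans (normRe_le _))// normcB; exact: d'P.
Qed.

(** Boundedness passes from the four quarters to the whole and holds near each point by continuity,
    so bisection applies. *)
Lemma ccont_bounded_square X Y S F : 0 < S -> ccont (csquare X Y S) F ->
  exists K : R, forall z, csquare X Y S z -> normc (F z) <= K.
Proof.
move=> S0 Fc.
apply: (@square_bisection _ (fun x y s => exists K : R, forall z, csquare x y s z -> normc (F z) <= K) X Y S) => //.
  move=> x y s s0 _ _ _ _ [K1 h1] [K2 h2] [K3 h3] [K4 h4].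
  exists (`|K1| + `|K2| + `|K3| + `|K4|) => z [/andP[x1 x2] /andP[y1 y2]].
  have [[[n1 n2] n3] n4] := (normr_ge0 K1, normr_ge0 K2, normr_ge0 K3, normr_ge0 K4).
  have [[[m1 m2] m3] m4] := (ler_norm K1, ler_norm K2, ler_norm K3, ler_norm K4).
  have [hx|hx] := leP (complex.Re z) (x + s / 2); have [hy|hy] := leP (complex.Im z) (y + s / 2).
  - have := h1 z; move=> /(_ ltac:(split; lra)) ?; lra.
  - have := h3 z; move=> /(_ ltac:(split; lra)) ?; lra.
  - have := h2 z; move=> /(_ ltac:(split; lra)) ?; lra.
  - have := h4 z; move=> /(_ ltac:(split; lra)) ?; lra.
move=> c cQ; have [d d0 dP] := Fc c cQ 1 ltr01.
exists (d / 2); first by rewrite divr_gt0.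
move=> x y s /andP[s0 sd] h1 h2 h3 h4 [/andP[c1 c2] /andP[c3 c4]].
exists (normc (F c) + 1) => z [/andP[z1 z2] /andP[z3 z4]].
have : normc (F z - F c) < 1.
  apply: dP; first by split; lra.
  rewrite (le_lt_trans (normc_le_ReIm _))// !raddfB/=.
  have : `|complex.Re z - complex.Re c| <= s by rewrite ler_norml; lra.
  have : `|complex.Im z - complex.Im c| <= s by rewrite ler_norml; lra.
  by lra.
by have := le_normcD (F z - F c) (F c); rewrite subrK; lra.
Qed.

End ContinuityRules.

Section Wirtinger.
Variable R : realType.
Implicit Types (D : set R[i]) (F G : R[i] -> R[i]) (c a b : R[i]).

(** Real differentiability written in the Wirtinger basis: [a] is the derivative in z and [b] the
    one in conj z, so [b = 0] means complex differentiability. Working relative to [D] allows points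
    on the edge of a closed square. *)
Definition wirt D F c a b := forall e : R, 0 < e ->
  exists2 d : R, 0 < d & forall z, D z -> normc (z - c) < d ->
    normc (F z - F c - (a * (z - c) + b * (z - c)^*%C)) <= e * normc (z - c).

Lemma wirtS D D' F c a b : D `<=` D' -> wirt D' F c a b -> wirt D F c a b.
Proof.
by move=> DD' Fc e e0; have [d d0 dP] := Fc e e0; exists d => // z /DD'; exact: dP.
Qed.

Lemma wirt_lip D F c a b : wirt D F c a b ->
  exists2 d : R, 0 < d & forall z, D z -> normc (z - c) < d ->
    normc (F z - F c) <= (normc a + normc b + 1) * normc (z - c).
Proof.
move=> /(_ 1 ltr01) [d d0 dP]; exists d => // z Dz zc; have := dP z Dz zc.
set L := _ + _ * _; rewrite mul1r => h.
rewrite -(subrK L (F z - F c)) (le_trans (le_normcD _ _))//.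
rewrite mulrDl mul1r addrC lerD// /L (le_trans (le_normcD _ _))// !normcM normcJ'.
by rewrite mulrDl.
Qed.

Lemma wirt_ccont D F : (forall c, D c -> exists a b, wirt D F c a b) -> ccont D F.
Proof.
move=> h c Dc e e0; have [a [b /wirt_lip [d d0 dP]]] := h c Dc.
have K0 : 0 < normc a + normc b + 1.
  by have := normc_ge0 a; have := normc_ge0 b; lra.
exists (Num.min d (e / (normc a + normc b + 1))); first by rewrite lt_min d0 divr_gt0.
move=> z Dz; rewrite lt_min => /andP[/(dP _ Dz) h1]; rewrite ltr_pdivlMr// => h2.
by rewrite (le_lt_trans h1)// mulrC.
Qed.

Lemma eq_wirt D F G c a b : D c -> (forall z, D z -> F z = G z) ->
  wirt D F c a b -> wirt D G c a b.
Proof.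
move=> Dc FG Fc e e0; have [d d0 dP] := Fc e e0; exists d => // z Dz zc.
by rewrite -!FG//; exact: dP.
Qed.

Lemma near_wirt D F G c a b (r : R) : 0 < r -> D c ->
  (forall z, D z -> normc (z - c) < r -> F z = G z) ->
  wirt D F c a b -> wirt D G c a b.
Proof.
move=> r0 Dc FG Fc e e0; have [d d0 dP] := Fc e e0.
exists (Num.min d r); first by rewrite lt_min d0.
move=> z Dz; rewrite lt_min => /andP[zd zr].
by rewrite -!FG// ?subrr ?normc0//; exact: dP.
Qed.

Lemma wirt_cst D k c : wirt D (fun=> k) c 0 0.
Proof.
move=> e e0; exists 1 => // z _ _.
by rewrite !mul0r addr0 !subrr normc0 mulr_ge0 ?normc_ge0// ltW.
Qed.

Lemma wirt_id D c : wirt D id c 1 0.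
Proof.
move=> e e0; exists 1 => // z _ _.
by rewrite mul0r mul1r addr0 subrr normc0 mulr_ge0 ?normc_ge0// ltW.
Qed.

Lemma wirtD D F G c a b a' b' : wirt D F c a b -> wirt D G c a' b' ->
  wirt D (fun z => F z + G z) c (a + a') (b + b').
Proof.
move=> Fc Gc e e0; have [d d0 dP] := Fc (e / 2) ltac:(lra).
have [d' d'0 d'P] := Gc (e / 2) ltac:(lra).
exists (Num.min d d'); first by rewrite lt_min d0.
move=> z Dz; rewrite lt_min => /andP[/(dP _ Dz) h /(d'P _ Dz) h'].
set hc := (z - c)^*%C in h h' *.
have -> : F z + G z - (F c + G c) - ((a + a') * (z - c) + (b + b') * hc) =
  (F z - F c - (a * (z - c) + b * hc)) + (G z - G c - (a' * (z - c) + b' * hc)) by ring.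
by rewrite (le_trans (le_normcD _ _))// (splitr e) mulrDl lerD.
Qed.

Lemma wirtM D F G c a b a' b' : wirt D F c a b -> wirt D G c a' b' ->
  wirt D (fun z => F z * G z) c (a * G c + F c * a') (b * G c + F c * b').
Proof.
move=> Fc Gc e e0.
have [d1 d10 lF] := wirt_lip Fc; have [d2 d20 lG] := wirt_lip Gc.
set k1 := _ + _ + 1 in lF; set k2 := _ + _ + 1 in lG.
have k10 : 0 < k1 by rewrite /k1; have := normc_ge0 a; have := normc_ge0 b; lra.
have k20 : 0 < k2 by rewrite /k2; have := normc_ge0 a'; have := normc_ge0 b'; lra.
set K := normc (F c) + normc (G c) + 1.
have K0 : 0 < K by rewrite /K; have := normc_ge0 (F c); have := normc_ge0 (G c); lra.
have t0 : 0 < e / (2 * K) by rewrite divr_gt0// mulr_gt0.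
have [d d0 dP] := Fc _ t0; have [d' d'0 d'P] := Gc _ t0.
have r0 : 0 < e / (2 * (k1 * k2)) by rewrite divr_gt0// !mulr_gt0.
exists (Num.min (Num.min d d') (Num.min (Num.min d1 d2) (e / (2 * (k1 * k2))))).
  by rewrite !lt_min d0 d'0 d10 d20.
move=> z Dz; rewrite !lt_min => /andP[/andP[/(dP _ Dz) h /(d'P _ Dz) h']].
move=> /andP[/andP[/(lF _ Dz) h1 /(lG _ Dz) h2]]; rewrite ltr_pdivlMr ?mulr_gt0// => h3.
set hc := (z - c)^*%C in h h' *.
have -> : F z * G z - F c * G c -
    ((a * G c + F c * a') * (z - c) + (b * G c + F c * b') * hc) =
  (F z - F c - (a * (z - c) + b * hc)) * G c +
  (F c * (G z - G c - (a' * (z - c) + b' * hc)) + (F z - F c) * (G z - G c)) by ring.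
rewrite (le_trans (le_normcD _ _))// (le_trans (lerD (lexx _) (le_normcD _ _)))// !normcM.
set n := normc (z - c) in h h' h1 h2 h3 *; have n0 : 0 <= n by exact: normc_ge0.
have g1 : normc (F z - F c) * normc (G z - G c) <= e / 2 * n.
  apply: (@le_trans _ _ ((k1 * n) * (k2 * n))); first by rewrite ler_pM ?normc_ge0.
  rewrite (_ : k1 * n * (k2 * n) = (n * (k1 * k2)) * n); last by ring.
  by rewrite ler_wpM2r//; lra.
have g2 : e / (2 * K) * n * normc (G c) + normc (F c) * (e / (2 * K) * n) <= e / 2 * n.
  have -> : e / 2 * n = e / (2 * K) * n * K by field; rewrite gt_eqF.
  have : 0 <= e / (2 * K) * n by rewrite mulr_ge0// ltW.
  by rewrite /K !mulrDr; lra.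
have := ler_wpM2r (normc_ge0 (G c)) h; have := ler_wpM2l (normc_ge0 (F c)) h'.
have -> : e * n = e / 2 * n + e / 2 * n by field.
by lra.
Qed.

Lemma wirt_comp D D' F G c a b a' b' : (forall z, D z -> D' (F z)) ->
  wirt D F c a b -> wirt D' G (F c) a' b' ->
  wirt D (G \o F) c (a' * a + b' * b^*%C) (a' * b + b' * a^*%C).
Proof.
move=> DD' Fc Gc e e0.
have [d1 d10 lF] := wirt_lip Fc.
set k1 := _ + _ + 1 in lF.
have k10 : 0 < k1 by rewrite /k1; have := normc_ge0 a; have := normc_ge0 b; lra.
have [d2 d20 dG] := Gc (e / (2 * k1)) ltac:(by rewrite divr_gt0// mulr_gt0).
set k2 := normc a' + normc b' + 1.
have k20 : 0 < k2 by rewrite /k2; have := normc_ge0 a'; have := normc_ge0 b'; lra.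
have [d3 d30 dF] := Fc (e / (2 * k2)) ltac:(by rewrite divr_gt0// mulr_gt0).
exists (Num.min (Num.min d1 d3) (d2 / k1)); first by rewrite !lt_min d10 d30 divr_gt0.
move=> z Dz; rewrite !lt_min => /andP[/andP[/(lF _ Dz) h1 /(dF _ Dz) h3]].
rewrite ltr_pdivlMr// => h2 /=.
have := dG _ (DD' _ Dz) ltac:(by rewrite (le_lt_trans h1)// mulrC).
set n := normc (z - c) in h1 h2 h3 *; have n0 : 0 <= n by exact: normc_ge0.
set L := a * _ + b * _ in h3.
have LE : L = a * (z - c) + b * (z - c)^*%C by [].
have Lc : L^*%C = a^*%C * (z - c)^*%C + b^*%C * (z - c).
  by rewrite LE rmorphD/= !rmorphM/= conjcK.
clearbody L; set r := F z - F c - L in h3.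
have rE : F z - F c = r + L by rewrite /r subrK.
clearbody r; rewrite rE rmorphD/= Lc; set hc := (z - c)^*%C in LE Lc * => h4.
have -> : G (F z) - G (F c) - ((a' * a + b' * b^*%C) * (z - c) + (a' * b + b' * a^*%C) * hc) =
  (G (F z) - G (F c) - (a' * (r + L) + b' * (r^*%C + (a^*%C * hc + b^*%C * (z - c))))) +
  (a' * r + b' * r^*%C) by rewrite LE; ring.
rewrite (le_trans (le_normcD _ _))// (splitr e) mulrDl lerD//.
  rewrite (le_trans h4)// -rE.
  rewrite (@le_trans _ _ (e / (2 * k1) * (k1 * n)))//.
    by rewrite ler_wpM2l// ltW// divr_gt0// mulr_gt0.
  have -> // : e / (2 * k1) * (k1 * n) = e / 2 * n.
  by field; rewrite gt_eqF.
rewrite (le_trans (le_normcD _ _))// !normcM normcJ' -mulrDl.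
rewrite (@le_trans _ _ (k2 * (e / (2 * k2) * n)))//.
  by rewrite ler_pM ?addr_ge0 ?normc_ge0// /k2 lerDl.
have -> // : k2 * (e / (2 * k2) * n) = e / 2 * n.
by field; rewrite gt_eqF.
Qed.

Lemma wirt_inv D c : c != 0 -> wirt D (fun z => z^-1) c (- c ^- 2) 0.
Proof.
move=> c0 e e0.
have nc0 : 0 < normc c by rewrite normc_gt0.
(* The remainder is [(z - c)^2 / (z c^2)]. The first bound on [d] gives [|z| >= |c| / 2], and the
   second then makes the remainder at most [e |z - c|]. *)
have [d1 d10 d1P] : exists2 d : R, 0 < d & d <= normc c / 2 /\ d <= e * normc c ^+ 3 / 2.
  exists (Num.min (normc c / 2) (e * normc c ^+ 3 / 2)).
    by rewrite lt_min !divr_gt0// mulr_gt0// exprn_gt0.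
  by rewrite !ge_min !lexx orbT.
case: d1P => d1a d1b; exists d1 => // z _ zc.
have nz : normc c / 2 <= normc z.
  by have := le_normcD (c - z) z; rewrite subrK normcB; lra.
have z0 : z != 0 by rewrite -normc_gt0; lra.
rewrite mul0r addr0.
have -> : z^-1 - c^-1 - - c ^- 2 * (z - c) = (z - c) * (z - c) / (z * c ^+ 2).
  by field; rewrite c0 z0.
rewrite !normcM normcV !normcM.
set n := normc (z - c) in zc *; have n0 : 0 <= n by exact: normc_ge0.
rewrite -mulrA mulrC ler_wpM2r// ler_pdivrMr; last by rewrite !mulr_gt0//; lra.
have h : normc c / 2 * (normc c * normc c) <= normc z * (normc c * normc c).
  by rewrite ler_wpM2r// mulr_ge0 ?normc_ge0.
have : e * (normc c / 2 * (normc c * normc c)) <= e * (normc z * (normc c * normc c)).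
  by rewrite ler_wpM2l// ltW.
have -> : e * (normc c / 2 * (normc c * normc c)) = e * normc c ^+ 3 / 2 by field.
by lra.
Qed.

End Wirtinger.

(** * Green's formula *)

Section RintegralEstimates.
Context d (T : measurableType d) (R : realType) (mu : {measure set T -> \bar R}).

Lemma Rintegral_near_cst (A : set T) (f : T -> R) (k M : R) :
  measurable A -> (mu A < +oo)%E -> mu.-integrable A (EFin \o f) ->
  (forall x, A x -> `|f x - k| <= M) ->
  `|\int[mu]_(x in A) f x - k * fine (mu A)| <= M * fine (mu A).
Proof.
move=> mA fA intf fk.
have ik (c : R) : mu.-integrable A (EFin \o cst c).
  apply: measurable_bounded_integrable => //; exists `|c|; split; [exact: num_real|by move=> N cN x _ /=; exact: ltW].
have kE := Rintegral_cst mu mA k; have ME := Rintegral_cst mu mA M.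
have NE := Rintegral_cst mu mA (- M).
rewrite ler_norml; apply/andP; split.
  rewrite lerBrDr -mulNr -NE -kE -RintegralD//; [|exact: (ik (- M))|exact: (ik k)].
  apply: le_Rintegral => //; first exact: (ik (- M + k)).
  by move=> x /fk; rewrite ler_norml; lra.
rewrite lerBlDr -ME -kE -RintegralD//; [|exact: (ik M)|exact: (ik k)].
apply: le_Rintegral => //; first exact: (ik (M + k)).
by move=> x /fk; rewrite ler_norml; lra.
Qed.

Lemma bounded_integrable (A : set T) (f : T -> R) (K : R) :
  measurable A -> (mu A < +oo)%E -> measurable_fun A f ->
  (forall x, A x -> `|f x| <= K) -> mu.-integrable A (EFin \o f).
Proof.
move=> mA fA mf fK; apply: measurable_bounded_integrable => //.
exists K; split; first exact: num_real.
by move=> M KM x Ax /=; exact: le_trans (fK _ Ax) (ltW KM).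
Qed.

End RintegralEstimates.

Section GreenSquare.
Variable R : realType.
Notation mu1 := (@lebesgue_measure R).
Notation mu2 := ((@lebesgue_measure R) \x (@lebesgue_measure R))%E.
Implicit Types (F b : R[i] -> R[i]) (x y s : R).

Lemma planar_squareE x y s : planar (square x y s) = `]x, x + s] `*` `]y, y + s].
Proof. by apply/seteqP; split=> -[u v] /=; rewrite /planar/= /square/= !in_itv/=. Qed.

Lemma planar_csquareE x y s : planar (csquare x y s) = `[x, x + s] `*` `[y, y + s].
Proof. by apply/seteqP; split=> -[u v] /=; rewrite /planar/= /csquare/= !in_itv/=. Qed.

Lemma square_measurable x y s : measurable (planar (square x y s)).
Proof. by rewrite planar_squareE; apply: measurableX; exact: measurable_itv. Qed.

Lemma csquare_measurable x y s : measurable (planar (csquare x y s)).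
Proof. by rewrite planar_csquareE; apply: measurableX; exact: measurable_itv. Qed.

Lemma measure_oc x s : 0 < s -> mu1 `]x, x + s] = s%:E.
Proof.
by move=> s0; rewrite lebesgue_measure_itv/= lte_fin ltrDl s0 -EFinD addrAC subrr add0r.
Qed.

Lemma measure_square x y s : 0 < s -> mu2 (planar (square x y s)) = (s * s)%:E.
Proof.
move=> s0; rewrite planar_squareE product_measure1E//.
by rewrite EFinM; congr (_ * _)%E; exact: measure_oc.
Qed.

Lemma measure_oc_fin x s : 0 < s -> (mu1 `]x, (x + s)%R] < +oo)%E.
Proof. by move=> s0; rewrite measure_oc// ltry. Qed.

Lemma measure_square_fin x y s : 0 < s -> (mu2 (planar (square x y s)) < +oo)%E.
Proof. by move=> s0; rewrite measure_square// ltry. Qed.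

Lemma square_subc x y s : square x y s `<=` csquare x y s.
Proof. by move=> z [/andP[? ?] /andP[? ?]]; split; lra. Qed.

Variables (F : R[i] -> R[i]) (X Y S : R).
Hypothesis S0 : 0 < S.
Let Q := csquare X Y S.
Hypothesis Fc : ccont Q F.

(** For F = u + i v, twice the real part of the conj-derivative is u_x - v_y, so u is integrated
    along vertical edges and v along horizontal ones. The boundary term in Green's formula is then
    the imaginary part of the contour integral of F dz. *)
Definition vint F x y1 y2 := \int[mu1]_(y in `]y1, y2]) complex.Re (F (Complex x y)).
Definition hint F y x1 x2 := \int[mu1]_(x in `]x1, x2]) complex.Im (F (Complex x y)).
Definition sint F x y s :=
  \int[mu2]_(p in planar (square x y s)) complex.Re (F (Complex p.1 p.2)).

Let Fbd : exists K : R, forall z, Q z -> normc (F z) <= K := ccont_bounded_square S0 Fc.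

Lemma vint_integrable x y s : X <= x <= X + S -> Y <= y -> y + s <= Y + S -> 0 < s ->
  mu1.-integrable `]y, y + s] (EFin \o (fun y => complex.Re (F (Complex x y)))).
Proof.
move=> xX yY yS s0; have [K KP] := Fbd.
have inQ t : `]y, y + s]%classic t -> Q (Complex x t).
  by rewrite /= in_itv/= => ?; split => //=; lra.
apply: (@bounded_integrable _ _ _ _ _ _ K) => //.
- exact: measure_oc_fin.
- have := ccont_measurable_Re (csquare_measurable X Y S) Fc.
  move=> mF; have h : [set (pair x) t | t in `]y, (y + s)%R]] `<=` planar Q by move=> _ [t /inQ ? <-].
  exact: (measurable_comp (csquare_measurable X Y S) h mF (measurable_funTS (pair1_measurable x))).
by move=> t /inQ /KP; apply: le_trans; exact: normRe_le.
Qed.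

Lemma hint_integrable x y s : Y <= y <= Y + S -> X <= x -> x + s <= X + S -> 0 < s ->
  mu1.-integrable `]x, x + s] (EFin \o (fun x => complex.Im (F (Complex x y)))).
Proof.
move=> xX yY yS s0; have [K KP] := Fbd.
have inQ t : `]x, x + s]%classic t -> Q (Complex t y).
  by rewrite /= in_itv/= => ?; split => //=; lra.
apply: (@bounded_integrable _ _ _ _ _ _ K) => //.
- exact: measure_oc_fin.
- have := ccont_measurable_Im (csquare_measurable X Y S) Fc.
  move=> mF; have h : [set (pair^~ y) t | t in `]x, (x + s)%R]] `<=` planar Q by move=> _ [t /inQ ? <-].
  exact: (measurable_comp (csquare_measurable X Y S) h mF (measurable_funTS (pair2_measurable y))).
by move=> t /inQ /KP; apply: le_trans; exact: normIm_le.
Qed.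

Lemma sint_integrable (D : set (R * R)) : measurable D -> D `<=` planar (square X Y S) ->
  mu2.-integrable D (EFin \o (fun p => complex.Re (F (Complex p.1 p.2)))).
Proof.
move=> mD DS; have [K KP] := Fbd.
apply: (@integrableS _ _ _ mu2 _ _ (EFin \o (fun p => complex.Re (F (Complex p.1 p.2))))
  (square_measurable X Y S) mD DS).
apply: (@bounded_integrable _ _ _ mu2 _ (fun p => complex.Re (F (Complex p.1 p.2))) K) => //.
- exact: square_measurable.
- exact: measure_square_fin.
- apply: measurable_funS (csquare_measurable X Y S) _ _.
    by move=> z; exact: square_subc.
  exact: ccont_measurable_Re (csquare_measurable X Y S) Fc.
by move=> t /square_subc /KP; apply: le_trans; exact: normRe_le.
Qed.

Lemma itv_oc_split x y (h : R) : 0 <= h -> 0 <= y ->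
  `]x, x + h + y]%classic = `]x, x + h] `|` `]x + h, x + h + y] :> set R.
Proof.
move=> h0 y0; apply/seteqP; split=> t /=; rewrite !in_itv/=.
  by move=> /andP[? ?]; have [?|?] := leP t (x + h); [left|right]; apply/andP; split; lra.
by case=> /andP[? ?]; apply/andP; split; lra.
Qed.

Lemma itv_oc_disj (x y z : R) : [disjoint `]x, y]%classic & `]y, z]%classic].
Proof.
apply/disj_setPS => t [] /=; rewrite !in_itv/= => /andP[_ ?] /andP[? _]; exfalso; lra.
Qed.

Lemma vint_split x y s : X <= x <= X + S -> Y <= y -> y + s <= Y + S -> 0 < s ->
  vint F x y (y + s) = vint F x y (y + s / 2) + vint F x (y + s / 2) (y + s).
Proof.
move=> xX yY yS s0; have e : y + s = y + s / 2 + s / 2 by field.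
rewrite /vint e itv_oc_split ?divr_ge0 ?ltW// Rintegral_setU//.
  by rewrite -itv_oc_split ?divr_ge0 ?ltW// -e; exact: vint_integrable.
exact: itv_oc_disj.
Qed.

Lemma hint_split x y s : Y <= y <= Y + S -> X <= x -> x + s <= X + S -> 0 < s ->
  hint F y x (x + s) = hint F y x (x + s / 2) + hint F y (x + s / 2) (x + s).
Proof.
move=> xX yY yS s0; have e : x + s = x + s / 2 + s / 2 by field.
rewrite /hint e itv_oc_split ?divr_ge0 ?ltW// Rintegral_setU//.
  by rewrite -itv_oc_split ?divr_ge0 ?ltW// -e; exact: hint_integrable.
exact: itv_oc_disj.
Qed.

Lemma sint_split x y s : X <= x -> x + s <= X + S -> Y <= y -> y + s <= Y + S -> 0 < s ->
  sint F x y s = sint F x y (s / 2) + sint F (x + s / 2) y (s / 2) +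
    (sint F x (y + s / 2) (s / 2) + sint F (x + s / 2) (y + s / 2) (s / 2)).
Proof.
move=> Xx xS Yy yS s0.
pose f := fun p : R * R => complex.Re (F (Complex p.1 p.2)).
pose rect (x1 x2 y1 y2 : R) := (`]x1, x2] `*` `]y1, y2])%classic : set (R * R).
have mrect x1 x2 y1 y2 : measurable (rect x1 x2 y1 y2).
  by apply: measurableX; exact: measurable_itv.
have sub x1 x2 y1 y2 : x <= x1 -> x2 <= x + s -> y <= y1 -> y2 <= y + s ->
    rect x1 x2 y1 y2 `<=` planar (square X Y S).
  move=> ? ? ? ? [u v] [/=]; rewrite !in_itv/= => /andP[? ?] /andP[? ?].
  by split=> /=; apply/andP; split; lra.
have sintE x' y' s' : sint F x' y' s' = \int[mu2]_(p in rect x' (x' + s') y' (y' + s')) f p.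
  by rewrite /sint planar_squareE.
have e : s = s / 2 + s / 2 by field.
have splitx y1 y2 : y <= y1 -> y2 <= y + s -> \int[mu2]_(p in rect x (x + s) y1 y2) f p =
    \int[mu2]_(p in rect x (x + s / 2) y1 y2) f p +
    \int[mu2]_(p in rect (x + s / 2) (x + s) y1 y2) f p.
  move=> h1 h2.
  have E : rect x (x + s) y1 y2 = rect x (x + s / 2) y1 y2 `|` rect (x + s / 2) (x + s) y1 y2.
    rewrite /rect {1}e addrA itv_oc_split ?divr_ge0 ?ltW// -addrA -e.
    by apply/seteqP; split=> [t [[h|h] ?]|t [[]|[]]]; [left|right|split=> //; left|split=> //; right].
  rewrite E Rintegral_setU//; [exact: mrect|exact: mrect| |].
    by rewrite -E; apply: sint_integrable; [exact: mrect|apply: sub; lra].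
  apply/disj_setPS => -[u v] [[/= + _] [/= + _]]; rewrite !in_itv/= => /andP[_ ?] /andP[? _].
  by exfalso; lra.
have splity : \int[mu2]_(p in rect x (x + s) y (y + s)) f p =
    \int[mu2]_(p in rect x (x + s) y (y + s / 2)) f p +
    \int[mu2]_(p in rect x (x + s) (y + s / 2) (y + s)) f p.
  have E : rect x (x + s) y (y + s) =
      rect x (x + s) y (y + s / 2) `|` rect x (x + s) (y + s / 2) (y + s).
    rewrite /rect [in `]y, _]]e addrA itv_oc_split ?divr_ge0 ?ltW// -addrA -e.
    by apply/seteqP; split=> [t [? [h|h]]|t [[]|[]]]; [left|right|split=> //; left|split=> //; right].
  rewrite E Rintegral_setU//; [exact: mrect|exact: mrect| |].
    by rewrite -E; apply: sint_integrable; [exact: mrect|apply: sub; lra].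
  apply/disj_setPS => -[u v] [[/= _ +] [/= _ +]]; rewrite !in_itv/= => /andP[_ ?] /andP[? _].
  by exfalso; lra.
rewrite !sintE splity !splitx; try by lra.
by rewrite -!addrA -!e.
Qed.

End GreenSquare.

Section Green.
Variable R : realType.
Notation mu1 := (@lebesgue_measure R).
Notation mu2 := ((@lebesgue_measure R) \x (@lebesgue_measure R))%E.
Implicit Types (F b : R[i] -> R[i]) (x y s : R).

Variables (F b : R[i] -> R[i]) (X Y S : R).
Hypothesis S0 : 0 < S.
Let Q := csquare X Y S.
Hypothesis bc : ccont Q b.
Hypothesis Fb : forall c, Q c -> exists a, wirt Q F c a (b c).

Let Fc : ccont Q F.
Proof. by apply: wirt_ccont => c /Fb [a ?]; exists a, (b c). Qed.

Let bdry x y s := vint F (x + s) y (y + s) - vint F x y (y + s) -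
   hint F (y + s) x (x + s) + hint F y x (x + s).
Let defect x y s := 2 * sint b x y s - bdry x y s.

(** Each inner edge is shared by two quarters with opposite orientations, so its contributions
    cancel. *)
Let defect_split x y s : 0 < s -> X <= x -> x + s <= X + S -> Y <= y -> y + s <= Y + S ->
  defect x y s = defect x y (s / 2) + defect (x + s / 2) y (s / 2) +
    (defect x (y + s / 2) (s / 2) + defect (x + s / 2) (y + s / 2) (s / 2)).
Proof.
move=> s0 h1 h2 h3 h4; have e t : t + s / 2 + s / 2 = t + s by field.
rewrite /defect /bdry !e (sint_split S0 bc h1 h2 h3 h4 s0).
have V z : X <= z <= X + S -> vint F z y (y + s) = _ := fun hz => vint_split S0 Fc hz h3 h4 s0.
have H z : Y <= z <= Y + S -> hint F z x (x + s) = _ := fun hz => hint_split S0 Fc hz h1 h2 s0.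
rewrite (V (x + s) ltac:(lra)) (V x ltac:(lra)) (H (y + s) ltac:(lra)) (H y ltac:(lra)).
by ring.
Qed.

(** Green's formula is exact for the affine part of [F] at [c]. Points of the square are within
    [2 s] of [c], so a difference of two values of [F] has error at most [4 e s]; the two pairs of
    edges contribute [4 + 4] and twice the area integral contributes [2]. *)
Let defect_small (e : R) (c : R[i]) : 0 < e -> Q c -> exists2 d : R, 0 < d &
  forall x y s, 0 < s < d -> X <= x -> x + s <= X + S ->
      Y <= y -> y + s <= Y + S -> csquare x y s c -> `|defect x y s| <= 10 * e * (s * s).
Proof.
move=> e0 Qc; have [a /(_ e e0) [d1 d10 d1P]] := Fb Qc.
have [d2 d20 d2P] := bc Qc e0.
exists (Num.min d1 d2 / 2); first by rewrite divr_gt0// lt_min d10.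
move=> x y s /andP[s0 sd] h1 h2 h3 h4 [/andP[c1 c2] /andP[c3 c4]].
have near z : csquare x y s z -> [/\ Q z, normc (z - c) <= 2 * s, normc (z - c) < d1 & normc (z - c) < d2].
  move=> [/andP[z1 z2] /andP[z3 z4]].
  have k : normc (z - c) <= 2 * s.
    rewrite (le_trans (normc_le_ReIm _))// !raddfB/=.
    have : `|complex.Re z - complex.Re c| <= s by rewrite ler_norml; lra.
    have : `|complex.Im z - complex.Im c| <= s by rewrite ler_norml; lra.
    by lra.
  have : 2 * s < Num.min d1 d2 by lra.
  by rewrite lt_min => /andP[? ?]; split=> //; [split; lra|lra|lra].
have dF z w : csquare x y s z -> csquare x y s w ->
    normc (F z - F w - (a * (z - w) + b c * (z - w)^*%C)) <= 4 * e * s.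
  move=> sz sw; have [Qz z1 z2 z3] := near _ sz; have [Qw w1 w2 w3] := near _ sw.
  have hz := d1P z Qz z2; have hw := d1P w Qw w2.
  have E : forall p q : R[i], (p - q)^*%C = p^*%C - q^*%C by move=> p q; rewrite rmorphB.
  have -> : F z - F w - (a * (z - w) + b c * (z - w)^*%C) =
    (F z - F c - (a * (z - c) + b c * (z - c)^*%C)) -
    (F w - F c - (a * (w - c) + b c * (w - c)^*%C)) by rewrite !E; ring.
  rewrite (le_trans (le_normcB _ _))//.
  have := ler_wpM2l (ltW e0) z1; have := ler_wpM2l (ltW e0) w1; lra.
have muoc t : fine (mu1 `]t, t + s]) = s by rewrite measure_oc.
have hV : `|vint F (x + s) y (y + s) - vint F x y (y + s) - complex.Re (a + b c) * s * s| <= 4 * e * s * s.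
  rewrite /vint -RintegralB//; [|apply: (vint_integrable S0 Fc) => //; lra..].
  have := @Rintegral_near_cst _ _ _ mu1 `]y, (y + s)%R] (fun t => complex.Re (F (Complex (x + s) t)) - complex.Re (F (Complex x t))) (complex.Re (a + b c) * s) (4 * e * s).
  rewrite muoc; apply => //.
  - exact: measure_oc_fin.
  - have i1 := vint_integrable S0 Fc (x := x + s) (y := y) (s := s) ltac:(lra) h3 h4 s0.
    have i2 := vint_integrable S0 Fc (x := x) (y := y) (s := s) ltac:(lra) h3 h4 s0.
    exact: (integrableB _ i1 i2).
  move=> t; rewrite /= in_itv/= => /andP[t1 t2].
  have := dF (Complex (x + s) t) (Complex x t) ltac:(split=> /=; lra) ltac:(split=> /=; lra).
  have -> : (Complex (x + s) t - Complex x t) = (s%:C)%C.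
    by apply/eqP; rewrite eq_complex /= addrAC subrr add0r subrr !eqxx.
  rewrite conjc_real -mulrDl => h; apply: le_trans (le_trans (normRe_le _) h).
  rewrite !raddfB/=; case: (a + b c) => u v /=; rewrite mulr0 subr0; exact: lexx.
have hH : `|hint F (y + s) x (x + s) - hint F y x (x + s) - complex.Re (a - b c) * s * s| <= 4 * e * s * s.
  rewrite /hint -RintegralB//; [|apply: (hint_integrable S0 Fc) => //; lra..].
  have := @Rintegral_near_cst _ _ _ mu1 `]x, (x + s)%R] (fun t => complex.Im (F (Complex t (y + s))) - complex.Im (F (Complex t y))) (complex.Re (a - b c) * s) (4 * e * s).
  rewrite muoc; apply => //.
  - exact: measure_oc_fin.
  - have i1 := hint_integrable S0 Fc (y := y + s) (x := x) (s := s) ltac:(lra) h1 h2 s0.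
    have i2 := hint_integrable S0 Fc (y := y) (x := x) (s := s) ltac:(lra) h1 h2 s0.
    exact: (integrableB _ i1 i2).
  move=> t; rewrite /= in_itv/= => /andP[t1 t2].
  have := dF (Complex t (y + s)) (Complex t y) ltac:(split=> /=; lra) ltac:(split=> /=; lra).
  have -> : (Complex t (y + s) - Complex t y) = Complex 0 s.
    by apply/eqP; rewrite eq_complex /= subrr addrAC subrr add0r !eqxx.
  have -> : a * Complex 0 s + b c * (Complex 0 s)^*%C = (a - b c) * Complex 0 s.
    have -> : (Complex 0 s)^*%C = - Complex 0 s by rewrite /= -[RHS]/(Complex (- 0) (- s)) oppr0.
    by ring.
  move=> h; apply: le_trans (le_trans (normIm_le _) h).
  case: (a - b c) => u v; rewrite !raddfB/= mulr0 addr0; exact: lexx.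
have hS : `|sint b x y s - complex.Re (b c) * (s * s)| <= e * (s * s).
  have muE : fine (mu2 (planar (square x y s))) = s * s by rewrite measure_square.
  rewrite -muE; apply: Rintegral_near_cst => //.
  - exact: square_measurable.
  - exact: measure_square_fin.
  - apply: (sint_integrable S0 bc); first exact: square_measurable.
    by move=> [u v] [/= /andP[? ?] /andP[? ?]]; split=> /=; lra.
  move=> p /square_subc /near [Qp _ _ p3].
  by have := ltW (d2P _ Qp p3); apply: le_trans; rewrite -raddfB; exact: normRe_le.
rewrite /defect /bdry; move: hV hH hS; rewrite !raddfB !raddfD/= !ler_norml.
set A := complex.Re a; set B := complex.Re (b c).
set V1 := vint _ (x + s) _ _; set V2 := vint _ x _ _; set H1 := hint _ (y + s) _ _.
set H2 := hint _ y _ _; set I := sint _ _ _ _.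
move=> /andP[v1 v2] /andP[k1 k2] /andP[l1 l2].
have E1 : (A + B) * s * s = A * (s * s) + B * (s * s) by ring.
have E2 : (A - B) * s * s = A * (s * s) - B * (s * s) by ring.
have E3 : 4 * e * s * s = 4 * (e * (s * s)) by ring.
have E4 : 10 * e * (s * s) = 10 * (e * (s * s)) by ring.
rewrite {}E1 {}E2 {}E3 {}E4 in v1 v2 k1 k2 l1 l2 *.
by apply/andP; split; lra.
Qed.

(** The defect is additive under bisection and [o(s^2)] at each point, so it is at most any positive
    multiple of the area. As in Goursat's theorem, continuity is asked only of the conj-derivative
    [b]. *)
Theorem green_square : 2 * sint b X Y S =
  vint F (X + S) Y (Y + S) - vint F X Y (Y + S) - hint F (Y + S) X (X + S) + hint F Y X (X + S).
Proof.
apply/eqP; rewrite -subr_eq0 -/(defect X Y S) -normr_le0; apply/ler_addgt0Pr => t t0.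
rewrite add0r; pose e := t / (10 * (S * S)).
have e0 : 0 < e by rewrite divr_gt0// !mulr_gt0.
have -> : t = 10 * e * (S * S) by rewrite /e; field; rewrite gt_eqF.
apply: (@square_bisection _ (fun x y s => `|defect x y s| <= 10 * e * (s * s)) X Y S) => //.
  move=> x y s s0 h1 h2 h3 h4 g1 g2 g3 g4; rewrite defect_split//.
  have -> : 10 * e * (s * s) = 10 * e * (s / 2 * (s / 2)) + 10 * e * (s / 2 * (s / 2)) +
    (10 * e * (s / 2 * (s / 2)) + 10 * e * (s / 2 * (s / 2))) by field.
  rewrite (le_trans (ler_normD _ _))// lerD// (le_trans (ler_normD _ _))// lerD//.
by move=> c Qc; exact: defect_small.
Qed.

End Green.

Section CompactGreen.
Variable R : realType.
Notation mu1 := (@lebesgue_measure R).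
Notation mu2 := ((@lebesgue_measure R) \x (@lebesgue_measure R))%E.

Lemma green_square0 (F b : R[i] -> R[i]) (X Y S : R) : 0 < S ->
  ccont (csquare X Y S) b ->
  (forall c, csquare X Y S c -> exists a, wirt (csquare X Y S) F c a (b c)) ->
  (forall z, csquare X Y S z -> [|| complex.Re z == X, complex.Re z == X + S,
      complex.Im z == Y | complex.Im z == Y + S] -> F z = 0) ->
  sint b X Y S = 0.
Proof.
move=> S0 bc Fb F0; have := green_square S0 bc Fb.
have V x : [|| x == X | x == X + S] -> vint F x Y (Y + S) = 0.
  move=> hx; rewrite /vint (@eq_Rintegral _ _ _ mu1 _ (fun=> 0)) ?Rintegral_cst ?mul0r//.
  move=> y /set_mem /=; rewrite in_itv/= => /andP[y1 y2]; rewrite F0//.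
    have ? : X <= x <= X + S by move: hx => /orP[] /eqP ->; lra.
    by split=> /=; lra.
  by move: hx => /orP[] /eqP -> /=; rewrite eqxx ?orbT.
have H y : [|| y == Y | y == Y + S] -> hint F y X (X + S) = 0.
  move=> hy; rewrite /hint (@eq_Rintegral _ _ _ mu1 _ (fun=> 0)) ?Rintegral_cst ?mul0r//.
  move=> x /set_mem /=; rewrite in_itv/= => /andP[x1 x2]; rewrite F0//.
    have ? : Y <= y <= Y + S by move: hy => /orP[] /eqP ->; lra.
    by split=> /=; lra.
  by move: hy => /orP[] /eqP -> /=; rewrite eqxx ?orbT.
by rewrite !V ?H ?eqxx ?orbT//; lra.
Qed.

(** Plays the role of compact support in [Om]: the nonzero values occur in a bounded region, at a
    uniform distance [d] from the complement. *)
Definition well_inside (Om : set R[i]) (F : R[i] -> R[i]) := exists M d : R, [/\ 0 < M, 0 < d &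
  forall z, Om z -> F z != 0 -> normc z <= M /\ forall w, normc (w - z) < d -> Om w].

Definition ext0 (Om : set R[i]) (F : R[i] -> R[i]) z := if z \in Om then F z else 0.

Lemma ext0_in Om F z : Om z -> ext0 Om F z = F z.
Proof. by move=> Oz; rewrite /ext0 mem_set. Qed.

Lemma ext0_out Om F z : ~ Om z -> ext0 Om F z = 0.
Proof. by move=> Oz; rewrite /ext0 memNset. Qed.

Lemma well_inside_out Om F c : well_inside Om F -> ~ Om c ->
  exists2 d : R, 0 < d & forall z, normc (z - c) < d -> ext0 Om F z = 0.
Proof.
move=> [M [d [M0 d0 dP]]] nOc; exists d => // z zc.
have [Oz|nOz] := pselect (Om z); last by rewrite ext0_out.
rewrite ext0_in//; apply/eqP/negPn/negP => Fz; apply: nOc.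
by have [_] := dP z Oz Fz; apply; rewrite normcB.
Qed.

Lemma ccont_ext0 Om F : copen Om -> well_inside Om F -> ccont Om F -> ccont setT (ext0 Om F).
Proof.
move=> oO wF Fc c _ e e0; have [Oc|nOc] := pselect (Om c).
  have [d d0 dP] := Fc c Oc e e0; have [r r0 rP] := oO c Oc.
  exists (Num.min d r); first by rewrite lt_min d0.
  move=> z _; rewrite lt_min => /andP[zd /rP Oz].
  by rewrite !ext0_in//; exact: dP.
have [d d0 dP] := well_inside_out wF nOc; exists d => // z _ zc.
by rewrite !dP ?subrr ?normc0.
Qed.

Lemma wirt_ext0 Om F c a b : copen Om -> Om c -> wirt Om F c a b ->
  wirt setT (ext0 Om F) c a b.
Proof.
move=> oO Oc Fc e e0; have [d d0 dP] := Fc e e0; have [r r0 rP] := oO c Oc.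
exists (Num.min d r); first by rewrite lt_min d0.
move=> z _; rewrite lt_min => /andP[zd /rP Oz].
by rewrite !ext0_in//; exact: dP.
Qed.

Definition cre (F : R[i] -> R[i]) (p : R * R) : R := complex.Re (F (Complex p.1 p.2)).

Lemma patch_ext0 Om F : (cre F) \_ (planar Om) = cre (ext0 Om F).
Proof.
apply/funext => p; rewrite /cre patchE; case: ifPn => [/set_mem|/negP nO].
  by rewrite /planar/= => Op; rewrite ext0_in.
by rewrite ext0_out// => Op; apply: nO; rewrite inE.
Qed.

Lemma cre_square_support (F : R[i] -> R[i]) (X Y S : R) :
  (forall z, F z != 0 -> square X Y S z) -> cre F = (cre F) \_ (planar (square X Y S)).
Proof.
move=> FS; apply/funext => p; rewrite patchE; case: ifPn => // /negP np.
rewrite /cre; have [->//|/FS h] := eqVneq (F (Complex p.1 p.2)) 0.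
by exfalso; apply: np; rewrite inE.
Qed.

Lemma well_inside_square Om F : well_inside Om F -> exists2 M : R, 0 < M &
  forall z, ext0 Om F z != 0 -> square (- (M + 1)) (- (M + 1)) (2 * (M + 1)) z /\ normc z <= M.
Proof.
move=> [M [d [M0 d0 dP]]]; exists M => // z.
have [Oz|nOz] := pselect (Om z); last by rewrite ext0_out ?eqxx.
rewrite ext0_in// => /(dP _ Oz)[zM _]; split => //.
have := le_trans (normRe_le z) zM; have := le_trans (normIm_le z) zM.
by rewrite !ler_norml => /andP[? ?] /andP[? ?]; split; lra.
Qed.

Lemma well_inside_integrable Om F : copen Om -> well_inside Om F -> ccont Om F ->
  mu2.-integrable (planar Om) (EFin \o cre F).
Proof.
move=> oO wF Fc; have cF := ccont_ext0 oO wF Fc.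
have [M M0 FM] := well_inside_square wF.
have S0 : 0 < 2 * (M + 1) by lra.
have [_] := @integrable_mkcond _ _ _ mu2 (planar Om) (EFin \o cre F) (copen_measurable oO); apply.
rewrite restrict_EFin patch_ext0 (cre_square_support (fun z h => (FM z h).1)) -restrict_EFin.
have [+ _] := @integrable_mkcond _ _ _ mu2 _ (EFin \o cre (ext0 Om F))
  (square_measurable (- (M + 1)) (- (M + 1)) (2 * (M + 1))); apply.
apply: (@sint_integrable _ (ext0 Om F) (- (M + 1)) (- (M + 1)) (2 * (M + 1)) S0).
- exact: ccontS cF.
- exact: square_measurable.
- by [].
Qed.

(** Extended by zero, [F] vanishes on the edges of a large square. The uniform margin of
    [well_inside] makes the extension vanish near every point outside [Om], so it is differentiable
    there too. *)
Lemma green_planar Om F b : copen Om -> ccont Om b -> well_inside Om F -> well_inside Om b ->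
  (forall c, Om c -> exists a, wirt Om F c a (b c)) ->
  \int[mu2]_(p in planar Om) cre b p = 0.
Proof.
move=> oO bc wF wb Fb; have cb := ccont_ext0 oO wb bc.
have [M M0 FM] := well_inside_square wF; have [M' M'0 bM] := well_inside_square wb.
pose K := Num.max M M'.
have KM : M <= K by rewrite le_max lexx.
have KM' : M' <= K by rewrite le_max lexx orbT.
have K0 : 0 < 2 * (K + 1) by lra.
rewrite Rintegral_mkcond patch_ext0 (@cre_square_support _ (- (K + 1)) (- (K + 1)) (2 * (K + 1))).
  rewrite -Rintegral_mkcond; apply: (@green_square0 (ext0 Om F)) => //.
  - exact: ccontS cb.
  - move=> c Qc; have [Oc|nOc] := pselect (Om c).
      have [a /(wirt_ext0 oO Oc) h] := Fb c Oc; exists a; rewrite ext0_in//.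
      exact: wirtS h.
    exists 0; rewrite (ext0_out b nOc).
    have [d d0 dP] := well_inside_out wF nOc.
    apply: (near_wirt (F := fun=> 0) d0) => //; last exact: wirt_cst.
    by move=> z _ zc; rewrite dP.
  - move=> z [/andP[z1 z2] /andP[z3 z4]] hz; apply/eqP/negPn/negP => /FM[_ zM].
    have := le_trans (normRe_le z) zM; have := le_trans (normIm_le z) zM.
    rewrite !ler_norml => /andP[? ?] /andP[? ?].
    by move: hz => /or4P[] /eqP; lra.
move=> z /bM[[/andP[? ?] /andP[? ?]] _]; split; lra.
Qed.

End CompactGreen.

(** * The smoothed Cauchy kernel *)

Section CauchyKernelCutoff.
Variable R : realType.
Implicit Types (t s x y rho : R) (c z : R[i]).

(* [cutN rho z] is the Cauchy kernel [1 / z] for [|z|^2 >= rho], and the differentiable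
   function [z^* (2 / rho - |z|^2 / rho^2)] otherwise; [cutm rho] is its conj-derivative. *)
Definition bump rho t : R := Num.max 0 (1 - t / rho).
Definition cutm rho z : R[i] := ((2 / rho * bump rho (normc z ^+ 2))%:C)%C.
Definition cutN rho z : R[i] := ((1 - bump rho (normc z ^+ 2) ^+ 2)%:C)%C / z.

Lemma bump_ge0 rho t : 0 <= bump rho t.
Proof. by rewrite /bump le_max lexx. Qed.

Lemma bump_out rho t : 0 < rho -> rho <= t -> bump rho t = 0.
Proof.
by move=> r0 rt; apply/max_idPl; rewrite subr_le0 ler_pdivlMr// mul1r.
Qed.

Lemma bump_in rho t : 0 < rho -> t <= rho -> bump rho t = 1 - t / rho.
Proof.
by move=> r0 rt; apply/max_idPr; rewrite subr_ge0 ler_pdivrMr// mul1r.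
Qed.

Lemma bump_lip rho s t : 0 < rho -> `|bump rho s - bump rho t| <= `|s - t| / rho.
Proof.
move=> r0; have -> : `|s - t| / rho = `|(1 - s / rho) - (1 - t / rho)|.
  rewrite -[in LHS](gtr0_norm r0) -normrV ?unitfE ?gt_eqF// -normrM -normrN.
  by congr `|_|; rewrite mulrBl; ring.
rewrite /bump; set x := 1 - s / rho; set y := 1 - t / rho.
have := ler_norm (x - y); have := ler_norm (- (x - y)); rewrite normrN ler_norml.
have [hx|hx] := leP 0 x; have [hy|hy] := leP 0 y => ? ?; apply/andP; split; lra.
Qed.

(** The square of the positive part is continuously differentiable with a Lipschitz derivative. This
    is why [bump] enters [cutN] squared, while its conj-derivative contains [bump] to the first
    power. *)
Lemma max0_sqr_taylor x y : let p t := Num.max 0 t in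
  `|p y ^+ 2 - p x ^+ 2 - 2 * p x * (y - x)| <= (y - x) ^+ 2.
Proof.
rewrite /=; have y2 := sqr_ge0 y; have x2 := sqr_ge0 x; have d2 := sqr_ge0 (y - x).
rewrite !expr2 in y2 x2 d2 *.
have [hx|hx] := leP 0 x; have [hy|hy] := leP 0 y; rewrite ler_norml; apply/andP.
- by split; lra.
- have : x * y <= 0 by rewrite mulr_ge0_le0// ltW.
  by split; lra.
- have : x * y <= 0 by rewrite mulr_le0_ge0// ltW.
  by split; lra.
- by split; lra.
Qed.

Lemma wirt_quadratic (D : set R[i]) F c a b (K : R) :
  (forall z, D z -> normc (z - c) < 1 ->
    normc (F z - F c - (a * (z - c) + b * (z - c)^*%C)) <= K * normc (z - c) ^+ 2) ->
  wirt D F c a b.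
Proof.
move=> h e e0; have K0 : 0 < `|K| + 1 by rewrite ltr_wpDl.
exists (Num.min 1 (e / (`|K| + 1))); first by rewrite lt_min ltr01 divr_gt0.
move=> z Dz; rewrite lt_min => /andP[z1]; rewrite ltr_pdivlMr// => z2.
rewrite (le_trans (h z Dz z1))// expr2 mulrA ler_wpM2r ?normc_ge0//.
apply: (@le_trans _ _ ((`|K| + 1) * normc (z - c))); last by rewrite mulrC ltW.
by rewrite ler_wpM2r ?normc_ge0//; have := ler_norm K; lra.
Qed.

Lemma wirt_bump_sqr rho c : 0 < rho ->
  wirt setT (fun z => ((bump rho (normc z ^+ 2) ^+ 2)%:C)%C) c
    (- cutm rho c * c^*%C) (- cutm rho c * c).
Proof.
move=> r0.
set m := 2 / rho * bump rho (normc c ^+ 2).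
have m0 : 0 <= m by rewrite mulr_ge0 ?bump_ge0// divr_ge0// ltW.
(* With [h = z - c], the increment of [|z|^2] is at most [(1 + 2 |c|) |h|] for [|h| < 1]; its square
   over [rho^2] is the Taylor remainder, and [m |h|^2] comes from the quadratic part of that
   increment. *)
apply: (@wirt_quadratic _ _ _ _ _ ((1 + 2 * normc c) ^+ 2 / rho ^+ 2 + m)) => z _ zc.
set h := z - c in zc *; have zE : z = c + h by rewrite /h addrC subrK.
set s := normc z ^+ 2; set t := normc c ^+ 2.
have sE : (((s - t)%:C)%C : R[i]) = c^*%C * h + c * h^*%C + ((normc h ^+ 2)%:C)%C.
  by rewrite rmorphB/= -!mulJc zE rmorphD/=; ring.
have -> : ((bump rho s ^+ 2)%:C)%C - ((bump rho t ^+ 2)%:C)%C -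
    (- cutm rho c * c^*%C * h + - cutm rho c * c * h^*%C) =
  ((bump rho s ^+ 2 - bump rho t ^+ 2 + m * (s - t) - m * normc h ^+ 2)%:C)%C.
  rewrite /cutm -/t -/m; clearbody m.
  set A := bump rho s ^+ 2; set B := bump rho t ^+ 2; set n2 := normc h ^+ 2 in sE *.
  have -> : ((A - B + m * (s - t) - m * n2)%:C = A%:C - B%:C + m%:C * (s - t)%:C - m%:C * n2%:C :> R[i])%C.
    by apply/eqP; rewrite eq_complex /=; apply/andP; split; apply/eqP; ring.
  by rewrite sE; ring.
rewrite normc_real (le_trans (ler_normB _ _))//.
have k : 0 <= m * normc h ^+ 2 by apply: mulr_ge0 => //; exact: sqr_ge0.
rewrite (ger0_norm k) mulrDl lerD//.
have := max0_sqr_taylor (1 - t / rho) (1 - s / rho); rewrite /= -/(bump rho t) -/(bump rho s).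
have -> : 2 * bump rho t * (1 - s / rho - (1 - t / rho)) = - (m * (s - t)).
  by rewrite /m; field; rewrite gt_eqF.
rewrite opprK => /le_trans; apply.
have -> : (1 - s / rho - (1 - t / rho)) ^+ 2 = (s - t) ^+ 2 / rho ^+ 2.
  by field; rewrite gt_eqF.
rewrite [leRHS]mulrAC ler_pM2r ?invr_gt0 ?exprn_gt0// -exprMn -[leLHS]real_normK ?num_real//.
rewrite ler_pXn2r ?nnegrE ?mulr_ge0 ?addr_ge0 ?normc_ge0 ?mulr_ge0 ?normc_ge0//.
rewrite -normc_real sE (le_trans (le_normcD _ _))// normc_real (le_trans (lerD (le_normcD _ _) (lexx _)))//.
rewrite !normcM !normcJ' ger0_norm ?sqr_ge0// expr2.
have := normc_ge0 h => h0.
have := ler_wpM2r h0 (ltW zc).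
by lra.
Qed.

(** Since [1 - (1 - t / rho)^2] is divisible by [t = |z|^2], the quotient by [z] is a polynomial in
    z and conj z; this gives the derivative at the origin. *)
Lemma cutN_near0 rho z : 0 < rho -> normc z ^+ 2 <= rho ->
  cutN rho z = z^*%C * (((2 / rho)%:C)%C - z^*%C * z * ((rho ^- 2)%:C)%C).
Proof.
move=> r0 zr; rewrite /cutN bump_in//.
have [->|z0] := eqVneq z 0; first by rewrite invr0 conjc0 mulr0 mul0r.
apply: (mulIf z0); rewrite divfK// mulJc.
have -> : z^*%C * ((2 / rho)%:C%C - (normc z ^+ 2)%:C%C * (rho ^- 2)%:C%C) * z =
  (z^*%C * z) * ((2 / rho)%:C%C - (normc z ^+ 2)%:C%C * (rho ^- 2)%:C%C) by ring.
rewrite mulJc; set n := normc z ^+ 2.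
apply/eqP; rewrite eq_complex /=; apply/andP; split; apply/eqP; last by ring.
by field; rewrite gt_eqF.
Qed.

Lemma cutN_out rho z : 0 < rho -> rho <= normc z ^+ 2 -> cutN rho z = z^-1.
Proof. by move=> r0 zr; rewrite /cutN bump_out// expr0n subr0 mul1r. Qed.

Lemma cutm_out rho z : 0 < rho -> rho <= normc z ^+ 2 -> cutm rho z = 0.
Proof. by move=> r0 zr; rewrite /cutm bump_out// mulr0. Qed.

Lemma wirt_cutN rho c : 0 < rho -> exists a, wirt setT (cutN rho) c a (cutm rho c).
Proof.
move=> r0; have [->|c0] := eqVneq c 0; last first.
  have h1 := wirtD (wirt_cst setT 1 c) (wirtM (wirt_cst setT (-1) c) (wirt_bump_sqr c r0)).
  have h2 := wirtM h1 (wirt_inv setT c0).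
  have h3 z : setT z ->
      (1 + -1 * ((bump rho (normc z ^+ 2) ^+ 2)%:C)%C) * z^-1 = cutN rho z.
    by move=> _; rewrite /cutN rmorphB/= mulN1r.
  have := eq_wirt (c := c) Logic.I h3 h2.
  set a := (X in wirt _ _ _ X _); set b := (X in wirt _ _ _ _ X).
  have -> : b = cutm rho c by rewrite /b mulr0 addr0 mul0r !add0r mulN1r !mulNr opprK mulfK.
  by exists a.
exists 0.
have [d d0 dr] : exists2 d : R, 0 < d & d ^+ 2 <= rho.
  exists (Num.sqrt rho); first by rewrite sqrtr_gt0.
  by rewrite sqr_sqrtr// ltW.
apply: (near_wirt (F := fun z => z^*%C * (((2 / rho)%:C)%C - z^*%C * z * ((rho ^- 2)%:C)%C)) d0) => //.
  move=> z _; rewrite subr0 => zd; rewrite cutN_near0// (le_trans _ dr)//.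
  by rewrite ler_pXn2r ?nnegrE ?normc_ge0 ?ltW.
apply: (@wirt_quadratic _ _ _ _ _ (rho ^- 2)) => z _.
rewrite !subr0 => z1.
rewrite conjc0 /cutm normc0 expr0n/= bump_in ?mul0r ?subr0 ?mulr1//; last exact: ltW.
rewrite ?mul0r ?subr0 ?add0r ?mulr1.
have -> : z^*%C * ((2 / rho)%:C%C - z^*%C * z * (rho ^- 2)%:C%C) - (2 / rho)%:C%C * z^*%C =
  - (z^*%C * z^*%C * z * (rho ^- 2)%:C%C) by ring.
have p0 : 0 <= rho ^- 2 by rewrite invr_ge0 exprn_ge0// ltW.
rewrite normcN !normcM !normcJ' normc_real (ger0_norm p0) [leLHS]mulrC ler_wpM2l//.
by rewrite expr2 ler_piMr ?mulr_ge0 ?normc_ge0// ltW.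
Qed.

Lemma ccont_cutm rho (D : set R[i]) : 0 < rho -> ccont D (cutm rho).
Proof.
move=> r0.
have h : ccont D (fun z => z^*%C * z) by apply: ccontM; [apply: ccontJ|]; exact: ccont_id.
apply: (@eq_ccont _ _ (fun z => ((2 / rho * bump rho (complex.Re (z^*%C * z)))%:C)%C)).
  by move=> z _; rewrite mulJc.
apply: (@ccont_real _ _ _ (fun t => 2 / rho * bump rho t) h) => t.
apply: cvgM; first exact: cvg_cst.
apply/cvgrPdist_lt => e e0; exists (e * rho) => /=; first by rewrite mulr_gt0.
by move=> s /= ts; rewrite (le_lt_trans (bump_lip _ _ r0))// ltr_pdivrMr.
Qed.

End CauchyKernelCutoff.

Section CauchyKernelMass.
Variable R : realType.
Notation mu1 := (@lebesgue_measure R).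
Notation mu2 := ((@lebesgue_measure R) \x (@lebesgue_measure R))%E.
Implicit Types (v rho : R) (w : R[i]).

Lemma integral_atan v (k : R) :
  \int[mu1]_(t in `]v - 1, v + 1]) (k * (1 + (t - v) ^+ 2)^-1) = k * (pi / 2).
Proof.
pose f t := (1 + (t - v) ^+ 2)^-1 : R.
pose F t := atan (t - v) : R.
have dF (t : R) : is_derive t (1 : R) F (f t).
  have h := is_derive1_comp (is_derive1_atan (shift (- v) t)) (is_derive_shift t 1 (- v)).
  by rewrite mulr1 in h; exact: h.
have cF : continuous F.
  by move=> t; apply: differentiable_continuous; apply/derivable1_diffP; case: (dF t).
have cf : continuous f.
  move=> t; apply: cvgV; first by rewrite gt_eqF// ltr_pwDl// sqr_ge0.
  apply: cvgD; first exact: cvg_cst.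
  by apply: cvgM; (apply: cvgB; [exact: cvg_id|exact: cvg_cst]).
have cf' : {within `[v - 1, v + 1], continuous f} by exact: continuous_subspaceT.
have If : mu1.-integrable `[v - 1, v + 1] (EFin \o f).
  by apply: continuous_compact_integrable => //; exact: segment_compact.
have If' : mu1.-integrable `]v - 1, v + 1] (EFin \o f).
  by apply: integrableS If => //; apply: subset_itvr; rewrite bnd_simp.
rewrite RintegralZl//; congr (_ * _).
have := @Rintegral_itv_obnd_cbnd R (v - 1) (BRight (v + 1)) f.
move=> -> //.
rewrite /Rintegral (@continuous_FTC2 _ f F)//=; [|by lra| |].
- rewrite /F (_ : v + 1 - v = 1); last by ring.
  rewrite (_ : v - 1 - v = - 1); last by ring.
  by rewrite atanN atan1; field.
- split=> //.
  + by apply: cvg_at_right_filter; exact: cF.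
  + by apply: cvg_at_left_filter; exact: cF.
- by move=> t _; rewrite derive1E; have [_ ->] := dF t.
Qed.

Lemma wirt_shift (D : set R[i]) w c : wirt D (fun z => z - w) c 1 0.
Proof.
by have := wirtD (wirt_id D c) (wirt_cst D (- w) c); rewrite !addr0.
Qed.

Lemma wirt_cutN_comp (D : set R[i]) (F : R[i] -> R[i]) c a rho : 0 < rho ->
  wirt D F c a 0 -> exists a', wirt D (fun z => cutN rho (F z)) c a' (cutm rho (F c) * a^*%C).
Proof.
move=> r0 Fc; have [a1 h] := wirt_cutN (F c) r0.
have := @wirt_comp _ D setT F _ _ _ _ _ _ (fun _ _ => Logic.I) Fc h.
by rewrite mulr0 add0r; eexists; eassumption.
Qed.

Lemma ccont_cutm_comp (D : set R[i]) (F : R[i] -> R[i]) rho : 0 < rho ->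
  ccont D F -> ccont D (fun z => cutm rho (F z)).
Proof. by move=> r0 Fc; apply: (ccont_comp Fc (ccont_cutm (D := setT) r0)). Qed.

(** The mass is read off the boundary: [rho <= 1] makes the smoothed kernel equal to [1 / (z - w)]
    on the edges of the square of half side 1, where each edge gives an arctangent integral
    [pi / 2]. The four edges yield twice the mass. *)
Lemma sint_cutm w rho : 0 < rho <= 1 ->
  sint (fun z => cutm rho (z - w)) (complex.Re w - 1) (complex.Im w - 1) 2 = pi.
Proof.
move=> /andP[r0 r1]; set X := complex.Re w - 1; set Y := complex.Im w - 1.
have sc : ccont (csquare X Y 2) (fun z => z - w).
  by apply: ccontB; [exact: ccont_id|exact: ccont_cst].
have H c : csquare X Y 2 c ->
    exists a, wirt (csquare X Y 2) (fun z => cutN rho (z - w)) c a (cutm rho (c - w)).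
  move=> _; have [a h] := wirt_cutN_comp r0 (wirt_shift (csquare X Y 2) w c).
  by exists a; rewrite conjc1 mulr1 in h.
have := @green_square _ _ _ X Y 2 (ltr0n _ 2) (ccont_cutm_comp r0 sc) H.
have E1 : X + 2 = complex.Re w + 1 by rewrite /X; ring.
have E2 : Y + 2 = complex.Im w + 1 by rewrite /Y; ring.
have out (x y : R) : 1 <= x ^+ 2 + y ^+ 2 -> cutN rho (Complex x y) = (Complex x y)^-1.
  by move=> h; rewrite cutN_out// sqr_normcE/= (le_trans r1).
have sub (x y : R) : Complex x y - w = Complex (x - complex.Re w) (y - complex.Im w).
  by case: w {sc H X Y E1 E2}.
have V x (k : R) : x - complex.Re w = k -> k ^+ 2 = 1 ->
    vint (fun z => cutN rho (z - w)) x Y (Y + 2) = k * (pi / 2).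
  move=> xk k1; rewrite E2 -(integral_atan (complex.Im w)); apply: eq_Rintegral => y _.
  by rewrite sub xk out ?k1 ?lerDl ?sqr_ge0//= k1.
have V' y (k : R) : y - complex.Im w = k -> k ^+ 2 = 1 ->
    hint (fun z => cutN rho (z - w)) y X (X + 2) = - k * (pi / 2).
  move=> yk k1; rewrite E1 -(integral_atan (complex.Re w)); apply: eq_Rintegral => x _.
  by rewrite sub yk out ?k1 ?lerDr ?sqr_ge0//= k1 addrC mulNr.
rewrite (V (X + 2) 1) ?(V X (-1)) ?(V' (Y + 2) 1) ?(V' Y (-1)) ?sqrrN ?expr1n//; try by rewrite /X /Y; ring.
by move=> h; lra.
Qed.

End CauchyKernelMass.

(** * Holomorphic functions and their L2 bounds *)

Section Holomorphic.
Variable R : realType.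
Implicit Types (Om D : set R[i]) (f g : R[i] -> R[i]) (w c z : R[i]).

Definition hol Om f := forall c, Om c -> exists a, wirt Om f c a 0.

Lemma hol_ccont Om f : hol Om f -> ccont Om f.
Proof. by move=> h; apply: wirt_ccont => c /h[a ?]; exists a, 0. Qed.

Lemma hol_cst Om k : hol Om (fun=> k).
Proof. by move=> c _; exists 0; exact: wirt_cst. Qed.

Lemma hol_id Om : hol Om id.
Proof. by move=> c _; exists 1; exact: wirt_id. Qed.

Lemma holD Om f g : hol Om f -> hol Om g -> hol Om (fun z => f z + g z).
Proof.
move=> hf hg c Oc; have [a h] := hf c Oc; have [b k] := hg c Oc.
by exists (a + b); have := wirtD h k; rewrite addr0.
Qed.

Lemma holM Om f g : hol Om f -> hol Om g -> hol Om (fun z => f z * g z).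
Proof.
move=> hf hg c Oc; have [a h] := hf c Oc; have [b k] := hg c Oc.
by exists (a * g c + f c * b); have := wirtM h k; rewrite mul0r mulr0 addr0.
Qed.

Lemma holN Om f : hol Om f -> hol Om (fun z => - f z).
Proof.
move=> hf; have := holM (@hol_cst Om (-1)) hf => h c Oc.
have [a k] := h c Oc; exists a; apply: eq_wirt k => // z _; exact: mulN1r.
Qed.

Lemma holB Om f g : hol Om f -> hol Om g -> hol Om (fun z => f z - g z).
Proof. by move=> hf hg; apply: holD => //; exact: holN. Qed.

Lemma holV Om f : hol Om f -> (forall z, Om z -> f z != 0) -> hol Om (fun z => (f z)^-1).
Proof.
move=> hf f0 c Oc; have [a h] := hf c Oc.
have := @wirt_comp _ Om setT f _ _ _ _ _ _ (fun _ _ => Logic.I) h (wirt_inv setT (f0 c Oc)).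
by rewrite mulr0 !mul0r !addr0 => k; eexists; exact: k.
Qed.

Lemma holX Om f n : hol Om f -> hol Om (fun z => f z ^+ n).
Proof.
move=> hf; elim: n => [|n IH]; first by move=> c Oc; exists 0; exact: wirt_cst.
move=> c Oc; have [a h] := holM hf IH Oc; exists a.
by apply: eq_wirt h => // z _; rewrite exprS.
Qed.

Lemma eq_hol Om f g : (forall z, Om z -> f z = g z) -> hol Om f -> hol Om g.
Proof. by move=> fg hf c Oc; have [a h] := hf c Oc; exists a; exact: eq_wirt h. Qed.

End Holomorphic.

Section MeanValue.
Variable R : realType.
Notation mu2 := ((@lebesgue_measure R) \x (@lebesgue_measure R))%E.
Implicit Types (Om D : set R[i]) (f g : R[i] -> R[i]) (w c z : R[i]) (r : R).

Variables (Om : set R[i]) (w : R[i]) (r0 : R).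
Hypothesis oO : copen Om.
Hypothesis r00 : 0 < r0.
Hypothesis ball_sub : forall z, normc (z - w) < r0 -> Om z.

Lemma well_inside_ball F r : r < r0 -> (forall z, F z != 0 -> normc (z - w) <= r) ->
  well_inside Om F.
Proof.
move=> rr Fr; exists (normc w + r0), (r0 - r); split; [|lra|].
  by apply: ltr_wpDl => //; exact: normc_ge0.
move=> z _ /Fr zr; split.
  by have := le_normcD (z - w) w; rewrite subrK; lra.
move=> u uz; apply: ball_sub; have := le_normcD3 u w z => ?; lra.
Qed.

Lemma cutm_support r z : 0 < r -> cutm (r ^+ 2) (z - w) != 0 -> normc (z - w) <= r.
Proof.
move=> rp; have [//|rz] := leP; rewrite cutm_out ?eqxx ?exprn_gt0//.
by rewrite ler_pXn2r ?nnegrE ?normc_ge0// ltW.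
Qed.

Lemma ccont_cutm_shift r : 0 < r -> ccont Om (fun z => cutm (r ^+ 2) (z - w)).
Proof.
move=> rp; apply: ccont_cutm_comp; first exact: exprn_gt0.
by apply: ccontB; [exact: ccont_id|exact: ccont_cst].
Qed.

Lemma mean_integrable f r : 0 < r < r0 -> ccont Om f ->
  mu2.-integrable (planar Om) (EFin \o cre (fun z => f z * cutm (r ^+ 2) (z - w))).
Proof.
move=> /andP[rp rr] fc; apply: well_inside_integrable => //.
  apply: (well_inside_ball rr) => z; rewrite mulf_eq0 negb_or => /andP[_]; exact: cutm_support.
by apply: ccontM => //; exact: ccont_cutm_shift.
Qed.

(** The difference of two smoothed Cauchy kernels at [w] vanishes outside the larger disc, so its
    product with the holomorphic [f] is a test function for [green_planar]. *)
Let mean_value_const f r1 r2 : 0 < r1 < r0 -> 0 < r2 < r0 -> hol Om f ->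
  \int[mu2]_(p in planar Om) cre (fun z => f z * cutm (r1 ^+ 2) (z - w)) p =
  \int[mu2]_(p in planar Om) cre (fun z => f z * cutm (r2 ^+ 2) (z - w)) p.
Proof.
move=> r1r r2r hf; apply/eqP; rewrite -subr_eq0 -RintegralB; last 3 first.
- exact: copen_measurable.
- exact: mean_integrable (hol_ccont hf).
- exact: mean_integrable (hol_ccont hf).
case/andP: r1r => r1p r1r; case/andP: r2r => r2p r2r.
pose b z := f z * (cutm (r1 ^+ 2) (z - w) - cutm (r2 ^+ 2) (z - w)).
pose F z := f z * (cutN (r1 ^+ 2) (z - w) - cutN (r2 ^+ 2) (z - w)).
have mlt : Num.max r1 r2 < r0 by rewrite gt_max r1r r2r.
have big z : Num.max r1 r2 < normc (z - w) ->
    r1 ^+ 2 <= normc (z - w) ^+ 2 /\ r2 ^+ 2 <= normc (z - w) ^+ 2.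
  by rewrite gt_max => /andP[? ?]; rewrite !ler_pXn2r ?nnegrE ?normc_ge0// !ltW.
have -> : \int[mu2]_(p in planar Om) (cre (fun z => f z * cutm (r1 ^+ 2) (z - w)) p -
    cre (fun z => f z * cutm (r2 ^+ 2) (z - w)) p) = \int[mu2]_(p in planar Om) cre b p.
  by apply: eq_Rintegral => p _; rewrite /cre /b mulrBr raddfB.
apply/eqP; apply: (@green_planar _ Om F) => //.
- apply: ccontM; first exact: hol_ccont.
  by apply: ccontB; exact: ccont_cutm_shift.
- apply: (well_inside_ball mlt) => z; have [//|/big[b1 b2]] := leP.
  by rewrite /F !cutN_out ?exprn_gt0// subrr mulr0 eqxx.
- apply: (well_inside_ball mlt) => z; have [//|/big[b1 b2]] := leP.
  by rewrite /b !cutm_out ?exprn_gt0// subrr mulr0 eqxx.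
move=> c Oc; have [a hfc] := hf c Oc.
have [a1 h1] := wirt_cutN_comp (exprn_gt0 2 r1p) (wirt_shift Om w c).
have [a2 h2] := wirt_cutN_comp (exprn_gt0 2 r2p) (wirt_shift Om w c).
have := wirtM hfc (wirtD h1 (wirtM (wirt_cst Om (-1) c) h2)).
rewrite !mul0r !add0r conjc1 !mulr1 mulN1r => h.
have FG z : Om z ->
    f z * (cutN (r1 ^+ 2) (z - w) + -1 * cutN (r2 ^+ 2) (z - w)) = F z.
  by move=> _; rewrite /F mulN1r.
have -> : b c = f c * (cutm (r1 ^+ 2) (c - w) + -1 * cutm (r2 ^+ 2) (c - w)) by rewrite /b mulN1r.
by eexists; exact: eq_wirt Oc FG h.
Qed.

Let cutm_mass r : 0 < r < r0 -> r < 1 ->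
  \int[mu2]_(p in planar Om) cre (fun z => cutm (r ^+ 2) (z - w)) p = pi.
Proof.
move=> /andP[rp rr] r1.
rewrite -(@sint_cutm _ w (r ^+ 2)); last by rewrite exprn_gt0// expr_le1// ltW.
rewrite Rintegral_mkcond patch_ext0 /sint [RHS]Rintegral_mkcond; congr Rintegral.
have -> : ext0 Om (fun z => cutm (r ^+ 2) (z - w)) = (fun z => cutm (r ^+ 2) (z - w)).
  apply/funext => z; have [Oz|nOz] := pselect (Om z); first by rewrite ext0_in.
  rewrite ext0_out//; apply/esym/eqP/negPn/negP => /(cutm_support rp) h.
  by apply: nOz; apply: ball_sub; exact: le_lt_trans rr.
apply: cre_square_support => z /(cutm_support rp) zr.
have := le_trans (normRe_le _) zr; have := le_trans (normIm_le _) zr.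
by rewrite !raddfB/= !ler_norml => /andP[? ?] /andP[? ?]; split; lra.
Qed.

Lemma re_cutm f rho z :
  complex.Re (f z * cutm rho (z - w)) = complex.Re (f z) * complex.Re (cutm rho (z - w)).
Proof. by rewrite /cutm; case: (f z) => u v /=; rewrite mulr0 subr0. Qed.

Lemma re_cutm_ge0 rho z : 0 < rho -> 0 <= complex.Re (cutm rho z).
Proof. by move=> rp; rewrite /= mulr_ge0 ?bump_ge0// divr_ge0// ltW. Qed.

Let mean_le f r (e : R) : 0 < r < r0 -> r < 1 -> ccont Om f ->
  (forall z, normc (z - w) <= r -> complex.Re (f z) <= e) ->
  \int[mu2]_(p in planar Om) cre (fun z => f z * cutm (r ^+ 2) (z - w)) p <= e * pi.
Proof.
move=> rr r1 fc fe; have /andP[rp _] := rr.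
have mO := copen_measurable oO.
have ic : mu2.-integrable (planar Om) (EFin \o cre (fun z => cutm (r ^+ 2) (z - w))).
  have := mean_integrable rr (@ccont_cst _ Om 1).
  by congr (mu2.-integrable _ (_ \o cre _)); apply/funext => z; rewrite mul1r.
rewrite -(cutm_mass rr r1) -RintegralZl//.
apply: le_Rintegral => //.
- exact: mean_integrable.
- have := mean_integrable rr (@ccont_cst _ Om ((e%:C)%C)).
  congr (mu2.-integrable _ (_ \o _)); apply/funext => p.
  by rewrite /cre (re_cutm (fun=> (e%:C)%C)).
move=> p _; rewrite /cre re_cutm; have [->|m0] := eqVneq (cutm (r ^+ 2) (Complex p.1 p.2 - w)) 0.
  by rewrite !mulr0.
apply: ler_wpM2r; first by apply: re_cutm_ge0; exact: exprn_gt0.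
exact/fe/cutm_support.
Qed.

Lemma mean_value f r : 0 < r < r0 -> hol Om f ->
  \int[mu2]_(p in planar Om) cre (fun z => f z * cutm (r ^+ 2) (z - w)) p = pi * complex.Re (f w).
Proof.
move=> rr hf; have fc := hol_ccont hf.
have Ow : Om w by apply: ball_sub; rewrite subrr normc0.
(* Replacing [r] by a small [s] leaves the integral unchanged, and continuity at [w] then bounds it.
   An upper bound suffices, since it also applies to [- f]. *)
have upper g (e : R) : 0 < e -> hol Om g ->
    \int[mu2]_(p in planar Om) cre (fun z => g z * cutm (r ^+ 2) (z - w)) p <=
      (complex.Re (g w) + e) * pi.
  move=> e0 hg; have gc := hol_ccont hg.
  have [d d0 dP] := gc w Ow e e0.
  pose s := Num.min (Num.min (r0 / 2) (1 / 2)) (d / 2).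
  have s0 : 0 < s by rewrite !lt_min !divr_gt0.
  have sr : s <= r0 / 2 by rewrite !ge_min lexx.
  have s1 : s <= 1 / 2 by rewrite !ge_min lexx orbT.
  have sd : s <= d / 2 by rewrite !ge_min lexx !orbT.
  rewrite (@mean_value_const g r s) //; last by apply/andP; split; lra.
  apply: mean_le => //; [by apply/andP; split; lra|lra|].
  move=> z zs; have Oz : Om z by apply: ball_sub; lra.
  have := dP z Oz ltac:(lra) => /(le_lt_trans (normRe_le _)).
  by rewrite raddfB/= ltr_norml => /andP[? ?]; lra.
apply/eqP; rewrite eq_le; apply/andP; split.
  apply/ler_addgt0Pr => e e0; have := upper f (e / pi) (divr_gt0 e0 (pi_gt0 _)) hf.
  by rewrite mulrDl divfK ?gt_eqF ?pi_gt0// mulrC.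
apply/ler_addgt0Pr => e e0; have := upper (fun z => - f z) (e / pi) (divr_gt0 e0 (pi_gt0 _)) (holN hf).
rewrite mulrDl divfK ?gt_eqF ?pi_gt0// raddfN/=.
have -> : \int[mu2]_(p in planar Om) cre (fun z => - f z * cutm (r ^+ 2) (z - w)) p =
   - \int[mu2]_(p in planar Om) cre (fun z => f z * cutm (r ^+ 2) (z - w)) p.
  rewrite -[RHS]mulN1r -RintegralZl//; [|exact: copen_measurable|exact: mean_integrable].
  by apply: eq_Rintegral => p _; rewrite /cre mulNr raddfN mulN1r.
by move=> h; lra.
Qed.

End MeanValue.

Section L2Bounds.
Variable R : realType.
Notation mu2 := ((@lebesgue_measure R) \x (@lebesgue_measure R))%E.
Implicit Types (Om D : set R[i]) (f g : R[i] -> R[i]) (w c z : R[i]) (r : R).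

Lemma planar_integrableZl Om (u : R * R -> R) (k : R) : copen Om ->
  mu2.-integrable (planar Om) (EFin \o u) ->
  mu2.-integrable (planar Om) (EFin \o (fun p => k * u p)).
Proof. move=> oO iu; exact: (@integrableZl _ _ _ mu2 _ (copen_measurable oO) k _ iu). Qed.

Lemma planar_integrableD Om (u v : R * R -> R) : copen Om ->
  mu2.-integrable (planar Om) (EFin \o u) -> mu2.-integrable (planar Om) (EFin \o v) ->
  mu2.-integrable (planar Om) (EFin \o (fun p => u p + v p)).
Proof. move=> oO iu iv; exact: (@integrableD _ _ _ mu2 _ (copen_measurable oO) _ _ iu iv). Qed.

Lemma planar_integrableB Om (u v : R * R -> R) : copen Om ->
  mu2.-integrable (planar Om) (EFin \o u) -> mu2.-integrable (planar Om) (EFin \o v) ->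
  mu2.-integrable (planar Om) (EFin \o (fun p => u p - v p)).
Proof. move=> oO iu iv; exact: (@integrableB _ _ _ mu2 _ (copen_measurable oO) _ _ iu iv). Qed.

Definition sqint Om f := (\int[mu2]_(p in planar Om) (normc (f (Complex p.1 p.2)) ^+ 2)%:E)%E.

Lemma measurable_sqnormc Om f : copen Om -> ccont Om f ->
  measurable_fun (planar Om) (fun p => normc (f (Complex p.1 p.2)) ^+ 2).
Proof.
move=> oO fc; have := ccont_measurable_Re (copen_measurable oO) (ccontM (ccontJ fc) fc).
by congr measurable_fun; apply/funext => p; rewrite mulJc.
Qed.

Lemma sqint_integrable Om f : copen Om -> ccont Om f -> (sqint Om f < +oo)%E ->
  mu2.-integrable (planar Om) (EFin \o (fun p => normc (f (Complex p.1 p.2)) ^+ 2)).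
Proof.
move=> oO fc foo; apply/integrableP; split.
  by apply/measurable_EFinP; exact: measurable_sqnormc.
by under eq_integral do rewrite /= ger0_norm ?sqr_ge0//.
Qed.

Lemma sqint_fine Om f (d : R) : copen Om -> ccont Om f -> (sqint Om f <= d%:E)%E ->
  \int[mu2]_(p in planar Om) (normc (f (Complex p.1 p.2)) ^+ 2) <= d.
Proof.
move=> oO fc fd; rewrite -lee_fin fineK//; rewrite ge0_fin_numE; first exact: le_lt_trans fd (ltry _).
by apply: integral_ge0 => p _; rewrite lee_fin sqr_ge0.
Qed.

(** Instead of the Cauchy-Schwarz inequality, [|f| <= d / 2 + |f|^2 / (2 d)] is integrated over the
    support of [k]; the constant [d / 2] is dominated there by a multiple of a [cutm] weight, whose
    integral is [pi]. *)
Lemma weighted_bound (r0 : R) : 0 < r0 -> exists2 C : R, 0 < C &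
  forall Om w f k (K d : R), copen Om -> (forall z, normc (z - w) < r0 -> Om z) ->
    ccont Om f -> ccont Om k -> 0 < d -> (sqint Om f <= (d ^+ 2)%:E)%E ->
    0 <= K -> (forall z, normc (k z) <= K) -> (forall z, k z != 0 -> normc (z - w) <= r0 / 2) ->
    \int[mu2]_(p in planar Om) cre (fun z => f z * k z) p <= C * K * d.
Proof.
move=> r00; pose s := 3 / 4 * r0; have s0 : 0 < s by rewrite mulr_gt0.
(* For [|z - w| <= r0 / 2 = 2 s / 3] the weight is at least [2 / s^2 * (1 - 4 / 9) = 10 / (9 s^2)],
   so [A] times the weight is at least 1 on the support of [k]. *)
pose A := s ^+ 2 * 9 / 10; have A0 : 0 < A by rewrite !mulr_gt0// ?invr_gt0 ?exprn_gt0.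
exists ((A * pi + 1) / 2); first by rewrite divr_gt0// ltr_wpDl// mulr_ge0 ?ltW ?pi_gt0.
move=> Om w f k K d oO ballO fc kc d0 fd K0 kK ksupp.
have sr : 0 < s < r0 by apply/andP; split=> //; rewrite /s; lra.
have Im := mean_integrable oO r00 ballO sr (@ccont_cst _ Om 1).
have Em := mean_value oO r00 ballO sr (@hol_cst _ Om 1).
rewrite /= mulr1 in Em.
have If := sqint_integrable oO fc (le_lt_trans fd (ltry _)).
have Ef := sqint_fine oO fc fd.
pose h p := K / 2 * (d * A) * cre (fun z => 1 * cutm (s ^+ 2) (z - w)) p +
  K / (2 * d) * normc (f (Complex p.1 p.2)) ^+ 2.
have I1 : mu2.-integrable (planar Om) (EFin \o (fun p => K / 2 * (d * A) * cre (fun z => 1 * cutm (s ^+ 2) (z - w)) p)).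
  exact: planar_integrableZl.
have I2 : mu2.-integrable (planar Om) (EFin \o (fun p => K / (2 * d) * normc (f (Complex p.1 p.2)) ^+ 2)).
  exact: planar_integrableZl.
apply: (@le_trans _ _ (\int[mu2]_(p in planar Om) h p)).
  apply: le_Rintegral => //.
  - exact: copen_measurable.
  - apply: well_inside_integrable => //; last exact: ccontM.
    apply: (@well_inside_ball _ Om w r0 r00 ballO _ (r0 / 2)); first by lra.
    by move=> z; rewrite mulf_eq0 negb_or => /andP[_]; exact: ksupp.
  - exact: planar_integrableD.
  move=> p Op; rewrite /h /cre; set z := Complex p.1 p.2.
  have m0 : 0 <= complex.Re (1 * cutm (s ^+ 2) (z - w)).
    by rewrite mul1r; apply: re_cutm_ge0; exact: exprn_gt0.
  have [k0|k0] := eqVneq (k z) 0.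
    by rewrite k0 mulr0/= addr_ge0// !mulr_ge0 ?invr_ge0 ?normc_ge0 ?mulr_ge0// ltW.
  have zr := ksupp _ k0.
  have m1 : 1 <= A * complex.Re (1 * cutm (s ^+ 2) (z - w)).
    rewrite mul1r /= bump_in ?exprn_gt0//; last first.
      by rewrite ler_pXn2r ?nnegrE ?normc_ge0 ?ltW//; move: zr; rewrite /s; lra.
    have : normc (z - w) ^+ 2 <= (r0 / 2) ^+ 2.
      by rewrite ler_pXn2r ?nnegrE ?normc_ge0// divr_ge0// ltW.
    set n2 := normc (z - w) ^+ 2 => hn.
    have -> : A * (2 / s ^+ 2 * (1 - n2 / s ^+ 2)) = 9 / 5 * (1 - n2 / s ^+ 2).
      by rewrite /A; field; rewrite gt_eqF.
    have : n2 / s ^+ 2 <= 4 / 9.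
      rewrite ler_pdivrMr ?exprn_gt0// (le_trans hn)//.
      by rewrite /s !exprMn; have := sqr_ge0 r0; lra.
    by lra.
  apply: le_trans (le_trans (ler_norm _) (normRe_le _)) _; rewrite normcM.
  apply: (@le_trans _ _ (normc (f z) * K)); first by rewrite ler_wpM2l ?normc_ge0.
  set n := normc (f z); set M := complex.Re _ in m0 m1 *.
  have n0 : 0 <= n by exact: normc_ge0.
  have amgm : n <= d / 2 + n ^+ 2 / (2 * d).
    rewrite -subr_ge0 (_ : _ - n = (n - d) ^+ 2 / (2 * d)); last by field; rewrite gt_eqF.
    by rewrite divr_ge0 ?sqr_ge0// mulr_ge0// ltW.
  have : K * n <= K * (d / 2 + n ^+ 2 / (2 * d)) by rewrite ler_wpM2l.
  have : K * d * 1 <= K * d * (A * M) by rewrite ler_wpM2l// mulr_ge0// ltW.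
  have -> : K / 2 * (d * A) * M = K * d * (A * M) / 2 by field.
  have -> : K * (d / 2 + n ^+ 2 / (2 * d)) = K * d / 2 + K / (2 * d) * n ^+ 2.
    by field; rewrite gt_eqF.
  by lra.
have mO := copen_measurable oO.
rewrite /h RintegralD// RintegralZl// RintegralZl// Em.
have : K / (2 * d) * \int[mu2]_(x in planar Om) (normc (f (Complex x.1 x.2)) ^+ 2) <=
    K / (2 * d) * d ^+ 2.
  by rewrite ler_wpM2l// divr_ge0// mulr_ge0// ltW.
have -> : K / (2 * d) * d ^+ 2 = K * d / 2 by field; rewrite gt_eqF.
have -> : (A * pi + 1) / 2 * K * d = K / 2 * (d * A) * pi + K * d / 2 by field.
by lra.
Qed.

Lemma sqintZ Om f (a : R[i]) : normc a = 1 -> sqint Om (fun z => a * f z) = sqint Om f.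
Proof. by move=> a1; apply: eq_integral => p _; rewrite normcM a1 mul1r. Qed.

Lemma normc_i : normc ('i%C : R[i]) = 1.
Proof. by rewrite /= expr0n/= expr1n add0r sqrtr1. Qed.

(** The integral identities control real parts only; rotating by [1, -1, i, -i] bounds both
    coordinates. *)
Lemma normc_le_mul (z : R[i]) (B : R) :
  (forall a : R[i], normc a = 1 -> complex.Re (a * z) <= B) -> normc z <= 2 * B.
Proof.
move=> h; have n1 : normc (1 : R[i]) = 1 by exact: normc1.
have h1 := h 1 n1; have h2 := h (-1) (etrans (normcN 1) n1).
have h3 := h 'i%C normc_i; have h4 := h (- 'i%C) (etrans (normcN _) normc_i).
rewrite (le_trans (normc_le_ReIm z))//; case: z h1 h2 h3 h4 {h} => x y /=.
rewrite !mulNr !mul0r !mul1r oppr0 !sub0r !addr0 ?subr0 ?opprK => h1 h2 h3 h4.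
have : `|x| <= B by rewrite ler_norml; lra.
have : `|y| <= B by rewrite ler_norml; lra.
by lra.
Qed.

(** Both values of [f] are means against translates of one weight, so the increment of [f] is an
    integral against the difference of the translates, which is Lipschitz in [z - w]. No estimate of
    a derivative is used. *)
Lemma bergman_bound (r0 : R) : 0 < r0 -> exists2 C : R, 0 < C &
  forall Om w f (d : R), copen Om -> (forall z, normc (z - w) < r0 -> Om z) ->
    hol Om f -> 0 < d -> (sqint Om f <= (d ^+ 2)%:E)%E ->
    normc (f w) <= C * d /\
    forall z, normc (z - w) <= r0 / 8 -> normc (f z - f w) <= C * d * normc (z - w).
Proof.
move=> r00; have [C C0 CP] := weighted_bound r00.
pose r := r0 / 8; have rp : 0 < r by rewrite divr_gt0.
have rp2 : 0 < r ^+ 2 by exact: exprn_gt0.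
(* The first term bounds the weight. The second bounds the difference of translates per unit of
   [|z - w|]: the moduli [|u - z| <= 3 r] and [|u - w| <= 2 r] give [2 / r^2 * 5 r / r^2]. *)
pose K := 2 / r ^+ 2 + 10 / r ^+ 3.
have K0 : 0 < K by rewrite addr_gt0// divr_gt0// exprn_gt0.
have p0 := pi_gt0 R.
exists (2 * (C * K) / pi); first by rewrite divr_gt0// !mulr_gt0.
move=> Om w f d oO ballO hf d0 fd.
have ccut z : ccont Om (fun x => cutm (r ^+ 2) (x - z)) by exact: ccont_cutm_shift.
have hfa a : hol Om (fun z => a * f z) by apply: holM => //; exact: hol_cst.
have rr : 0 < r < r0 by apply/andP; split=> //; rewrite /r; lra.
have q0 : 0 <= 2 / r ^+ 2 by rewrite divr_ge0// ltW.
have mle z : normc (cutm (r ^+ 2) z) <= 2 / r ^+ 2.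
  rewrite /cutm normc_real (ger0_norm (mulr_ge0 q0 (bump_ge0 _ _))).
  rewrite ler_piMr// /bump ge_max ler01/= lerBlDr lerDl.
  by rewrite mulr_ge0 ?sqr_ge0 ?invr_ge0 ?(ltW rp2).
split.
  have := @normc_le_mul (f w) (C * K * d / pi).
  have -> : 2 * (C * K * d / pi) = 2 * (C * K) / pi * d by ring.
  apply => a a1; rewrite ler_pdivlMr// mulrC -(mean_value oO r00 ballO rr (hfa a)).
  apply: le_trans (CP Om w _ _ (2 / r ^+ 2) d oO ballO (hol_ccont (hfa a)) (ccut w) d0 _ _ _ _) _.
  - by rewrite sqintZ.
  - by rewrite divr_ge0// ltW.
  - by move=> z; exact: mle.
  - by move=> z /(cutm_support rp); rewrite /r; lra.
  by rewrite ler_wpM2r ?(ltW d0)// ler_wpM2l ?(ltW C0)// lerDl divr_ge0// exprn_ge0// ltW.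
move=> z zw; set n := normc (z - w).
have n0 : 0 <= n by exact: normc_ge0.
have := @normc_le_mul (f z - f w) (C * (K * n) * d / pi).
have -> : 2 * (C * (K * n) * d / pi) = 2 * (C * K) / pi * d * n by ring.
apply => a a1; rewrite ler_pdivlMr// mulrC mulrBr raddfB mulrBr/=.
have r20 : 0 < r0 / 2 by rewrite divr_gt0.
have ballz u : normc (u - z) < r0 / 2 -> Om u.
  by move=> uz; apply: ballO; have := le_normcD3 u w z; move: zw; lra.
have rr2 : 0 < r < r0 / 2 by apply/andP; split=> //; rewrite /r; lra.
rewrite -(mean_value oO r00 ballO rr (hfa a)) -(mean_value oO r20 ballz rr2 (hfa a)).
rewrite -RintegralB; last 3 first.
- exact: copen_measurable.
- exact: (mean_integrable oO r20 ballz rr2 (hol_ccont (hfa a))).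
- exact: (mean_integrable oO r00 ballO rr (hol_ccont (hfa a))).
pose k u := cutm (r ^+ 2) (u - z) - cutm (r ^+ 2) (u - w).
have -> : \int[mu2]_(p in planar Om) (cre (fun u => a * f u * cutm (r ^+ 2) (u - z)) p -
    cre (fun u => a * f u * cutm (r ^+ 2) (u - w)) p) =
    \int[mu2]_(p in planar Om) cre (fun u => a * f u * k u) p.
  by apply: eq_Rintegral => p _; rewrite /cre /k mulrBr raddfB.
have ksupp u : k u != 0 -> normc (u - w) <= 2 * r.
  have [//|rz] := leP; rewrite /k !cutm_out ?subrr ?eqxx//.
    by rewrite ler_pXn2r ?nnegrE ?normc_ge0 ?ltW//; lra.
  rewrite ler_pXn2r ?nnegrE ?normc_ge0 ?ltW//.
  by have := le_normcD3 u w z; move: zw rz; rewrite -/r; lra.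
apply: (CP Om w _ _ (K * n) d oO ballO (hol_ccont (hfa a)) _ d0).
- by apply: ccontB; exact: ccut.
- by rewrite sqintZ.
- by rewrite mulr_ge0// ltW.
- move=> u; have [->|k0] := eqVneq (k u) 0.
    by rewrite normc0 mulr_ge0// ltW.
  have u2 := ksupp u k0.
  rewrite /k /cutm -rmorphB normc_real -mulrBr normrM (ger0_norm q0).
  have uz : normc (u - z) <= 3 * r.
    by have := le_normcD3 u z w; move: zw; rewrite -/r (normcB w z); lra.
  apply: (@le_trans _ _ (2 / r ^+ 2 * (5 * r * n / r ^+ 2))).
    rewrite ler_wpM2l// (le_trans (bump_lip _ _ rp2))//.
    rewrite ler_pM2r ?invr_gt0//.
    rewrite subr_sqr normrM mulrC (ger0_norm (addr_ge0 (normc_ge0 _) (normc_ge0 _))).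
    rewrite ler_pM ?addr_ge0 ?normc_ge0//; first by move: uz u2; lra.
    have := le_normcD3 u z w; have := le_normcD3 u w z; rewrite -/n (normcB w z) -/n => h1 h2.
    by rewrite ler_norml; lra.
  have -> : 2 / r ^+ 2 * (5 * r * n / r ^+ 2) = 10 / r ^+ 3 * n by field; rewrite gt_eqF.
  by rewrite ler_wpM2r// lerDr divr_ge0// ltW.
by move=> u /ksupp; rewrite /r; lra.
Qed.

End L2Bounds.

Section HolomorphicLimits.
Variable R : realType.
Notation mu2 := ((@lebesgue_measure R) \x (@lebesgue_measure R))%E.
Implicit Types (Om D : set R[i]) (f g : R[i] -> R[i]) (w c z : R[i]) (r : R).

Definition ccvg (u : nat -> R[i]) (l : R[i]) := forall e : R, 0 < e ->
  exists N, forall n, (N <= n)%N -> normc (u n - l) <= e.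

Lemma ccauchy_ccvg (u : nat -> R[i]) :
  (forall e : R, 0 < e -> exists N, forall m n, (N <= m)%N -> (N <= n)%N ->
    normc (u m - u n) <= e) -> exists l, ccvg u l.
Proof.
move=> uc.
have rc (v : nat -> R) : (forall m n, `|v m - v n| <= normc (u m - u n)) ->
    exists l, forall e : R, 0 < e -> exists N, forall n, (N <= n)%N -> `|v n - l| <= e.
  move=> vu; have vc : cvgn v.
    apply/cauchy_cvgP/cauchy_ballP => e e0; have [N NP] := uc (e / 2) ltac:(lra).
    pose A : set R := v @` [set n | (N <= n)%N].
    exists (A, A); first by split; exists N => // n Nn; exists n.
    move=> [_ _] /= [[m Nm <-] [n Nn <-]]; rewrite /ball /=.
    by have := vu m n; have := NP m n Nm Nn; lra.
  exists (limn v) => e e0; have /cvgrPdist_le /(_ e e0) [N _ NP] := vc.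
  by exists N => n /NP; rewrite distrC.
have [a ha] := rc (fun n => complex.Re (u n)) (fun m n =>
  ltac:(by rewrite -raddfB; exact: normRe_le)).
have [b hb] := rc (fun n => complex.Im (u n)) (fun m n =>
  ltac:(by rewrite -raddfB; exact: normIm_le)).
exists (Complex a b) => e e0.
have [N NP] := ha (e / 2) ltac:(lra); have [M MP] := hb (e / 2) ltac:(lra).
exists (maxn N M) => n; rewrite geq_max => /andP[/NP h1 /MP h2].
by rewrite (le_trans (normc_le_ReIm _))//; case: (u n) h1 h2 => x y /= h1 h2; lra.
Qed.

Lemma ccvg_normB_le (u : nat -> R[i]) l x (K : R) N : ccvg u l ->
  (forall n, (N <= n)%N -> normc (u n - x) <= K) -> normc (l - x) <= K.
Proof.
move=> ul uK; apply/ler_addgt0Pr => e e0; have [M MP] := ul e e0.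
have := uK (maxn N M) (leq_maxl _ _); have := MP (maxn N M) (leq_maxr _ _).
by have := le_normcD3 l x (u (maxn N M)); rewrite (normcB l (u (maxn N M))); lra.
Qed.

Lemma ccvgD (u v : nat -> R[i]) l l' : ccvg u l -> ccvg v l' ->
  ccvg (fun n => u n + v n) (l + l').
Proof.
move=> ul vl e e0; have [N NP] := ul (e / 2) ltac:(lra).
have [M MP] := vl (e / 2) ltac:(lra).
exists (maxn N M) => n; rewrite geq_max => /andP[/NP h1 /MP h2].
rewrite (_ : _ - _ = (u n - l) + (v n - l')); last by ring.
by rewrite (le_trans (le_normcD _ _))//; lra.
Qed.

Lemma ccvgZ (u : nat -> R[i]) l k : ccvg u l -> ccvg (fun n => k * u n) (k * l).
Proof.
move=> ul e e0; have k0 : 0 < normc k + 1 by rewrite ltr_wpDl ?normc_ge0.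
have [N NP] := ul (e / (normc k + 1)) ltac:(by rewrite divr_gt0).
exists N => n /NP h; rewrite -mulrBr normcM.
rewrite (@le_trans _ _ ((normc k + 1) * normc (u n - l)))//.
  by rewrite ler_wpM2r ?normc_ge0// lerDl.
by rewrite mulrC -ler_pdivlMr.
Qed.

Lemma wirt_le Om f w a (K r : R) : copen Om -> Om w -> 0 < r -> wirt Om f w a 0 ->
  (forall z, normc (z - w) <= r -> normc (f z - f w) <= K * normc (z - w)) -> normc a <= K.
Proof.
move=> oO Ow r0 fa fK; apply/ler_addgt0Pr => e e0.
have [d d0 dP] := fa e e0; have [d' d'0 d'P] := oO w Ow.
pose t := Num.min (Num.min d d' / 2) r.
have t0 : 0 < t by rewrite lt_min r0 divr_gt0// lt_min d0.
have tr : t <= r by rewrite ge_min lexx orbT.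
have tdd : t < Num.min d d'.
  have : t <= Num.min d d' / 2 by rewrite ge_min lexx.
  have : 0 < Num.min d d' by rewrite lt_min d0.
  by lra.
move: tdd; rewrite lt_min => /andP[td td'].
pose z := w + (t%:C)%C.
have zw : z - w = (t%:C)%C by rewrite /z addrC addKr.
have nz : normc (z - w) = t by rewrite zw normc_real gtr0_norm.
have Oz : Om z by apply: d'P; rewrite nz.
have := dP z Oz; rewrite nz => /(_ td); rewrite mul0r addr0 => h1.
have := fK z; rewrite nz => /(_ tr) h2.
have : normc (a * (z - w)) <= (K + e) * t.
  have -> : a * (z - w) = (f z - f w) - (f z - f w - a * (z - w)) by ring.
  by rewrite (le_trans (le_normcB _ _))// mulrDl lerD.
by rewrite normcM nz ler_pM2r.
Qed.

(** Locally the increments of [u m - u n] are small relative to [|z - w|], so the derivatives of the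
    [u n] at [w] form a Cauchy sequence; their limit is the derivative of the pointwise limit. *)
Lemma hol_limit Om (u : nat -> R[i] -> R[i]) : copen Om -> (forall n, hol Om (u n)) ->
  (forall e : R, 0 < e -> exists N, forall m n, (N <= m)%N -> (N <= n)%N ->
    (sqint Om (fun z => u m z - u n z)%R <= (e ^+ 2)%:E)%E) ->
  exists2 f, hol Om f & forall z, Om z -> ccvg (fun n => u n z) (f z).
Proof.
move=> oO uh uc.
have loc w : Om w -> exists r C : R, [/\ 0 < r, 0 < C & forall e : R, 0 < e ->
    exists N, forall m n, (N <= m)%N -> (N <= n)%N ->
      normc (u m w - u n w) <= C * e /\
      forall z, normc (z - w) <= r -> Om z /\
        normc (u m z - u n z - (u m w - u n w)) <= C * e * normc (z - w)].
  move=> Ow; have [r r0 rP] := oO w Ow; have [C C0 CP] := bergman_bound r0.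
  exists (r / 8), C; split=> //; first by rewrite divr_gt0.
  move=> e e0; have [N NP] := uc e e0; exists N => m n Nm Nn.
  have [h1 h2] := CP Om w _ e oO rP (holB (uh m) (uh n)) e0 (NP m n Nm Nn).
  split=> // z zw; split; last exact: h2.
  by apply: rP; move: zw; lra.
have lim z : Om z -> exists l, ccvg (fun n => u n z) l.
  move=> Oz; apply: ccauchy_ccvg => e e0; have [r [C [r0 C0 h]]] := loc z Oz.
  have [N NP] := h (e / C) (divr_gt0 e0 C0); exists N => m n Nm Nn.
  have [+ _] := NP m n Nm Nn; rewrite mulrC divfK// gt_eqF//.
pose f z := xget 0 [set l | ccvg (fun n => u n z) l].
have fP z : Om z -> ccvg (fun n => u n z) (f z).
  by move=> /lim [l hl]; exact: (xgetPex 0 (ex_intro _ l hl)).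
exists f => // w Ow; have [r [C [r0 C0 h]]] := loc w Ow.
pose a n := xget 0 [set a | wirt Om (u n) w a 0].
have aP n : wirt Om (u n) w (a n) 0 by have /(xgetPex 0) := uh n w Ow.
have aC (e : R) N m n : (forall z, normc (z - w) <= r -> Om z /\
      normc (u m z - u n z - (u m w - u n w)) <= C * e * normc (z - w)) ->
    (N <= m)%N -> (N <= n)%N -> normc (a m - a n) <= C * e.
  move=> hz Nm Nn; apply: (@wirt_le Om (fun z => u m z - u n z) w _ _ r) => //.
    have := wirtD (aP m) (wirtM (wirt_cst Om (-1) w) (aP n)).
    rewrite !mul0r !add0r mulr0 mulN1r => k.
    by apply: eq_wirt k => // z _; rewrite mulN1r.
  by move=> z /hz[].
have [l al] : exists l, ccvg a l.
  apply: ccauchy_ccvg => e e0; have [N NP] := h (e / C) (divr_gt0 e0 C0).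
  exists N => m n Nm Nn; have [_ k] := NP m n Nm Nn.
  by have := aC _ N _ _ k Nm Nn; rewrite mulrC divfK// gt_eqF.
exists l => e e0.
have e'0 : 0 < e / (3 * C) by rewrite divr_gt0// mulr_gt0.
have [N NP] := h _ e'0.
have CE : C * (e / (3 * C)) = e / 3 by field; rewrite gt_eqF.
have [d d0 dP] := aP N (e / 3) ltac:(lra).
exists (Num.min d r); first by rewrite lt_min d0.
move=> z Oz; rewrite lt_min => /andP[zd /ltW zr].
rewrite mul0r addr0; have := dP z Oz zd; rewrite mul0r addr0 => h1.
set n := normc (z - w) in h1 *.
have h2 : normc (f z - f w - (u N z - u N w)) <= e / 3 * n.
  have c1 : ccvg (fun m => u m z + -1 * u m w) (f z + -1 * f w).
    by apply: ccvgD; [exact: fP|apply: ccvgZ; exact: fP].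
  have -> : f z - f w = f z + -1 * f w by rewrite mulN1r.
  apply: (ccvg_normB_le (N := N) c1) => m Nm.
  have [_ /(_ z zr)[_]] := NP m N Nm (leqnn _); rewrite CE; apply: le_trans.
  by rewrite le_eqVlt; apply/orP; left; apply/eqP; congr normc; ring.
have h3 : normc (l - a N) <= e / 3.
  apply: (ccvg_normB_le (N := N) al) => m Nm.
  have [_ k] := NP m N Nm (leqnn _).
  by have := aC _ N _ _ k Nm (leqnn _); rewrite CE.
have -> : f z - f w - l * (z - w) = (f z - f w - (u N z - u N w)) +
  ((u N z - u N w - a N * (z - w)) - (l - a N) * (z - w)) by ring.
rewrite (le_trans (le_normcD _ _))//.
have := le_normcB (u N z - u N w - a N * (z - w)) ((l - a N) * (z - w)).
rewrite normcM -/n.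
have := ler_wpM2r (normc_ge0 (z - w)) h3; rewrite -/n.
have -> : e * n = e / 3 * n + (e / 3 * n + e / 3 * n) by field.
lra.
Qed.

End HolomorphicLimits.

(** * Complex Bergman kernels *)

Section FatouBound.
Context d (T : measurableType d) (R : realType) (mu : {measure set T -> \bar R}).

Lemma fatou_bound (D : set T) (u : nat -> T -> R) (v : T -> R) (B : R) N :
  measurable D -> (forall n, measurable_fun D (u n)) ->
  (forall n x, D x -> 0 <= u n x) -> (forall x, D x -> u n x @[n --> \oo] --> v x) ->
  (forall n, (N <= n)%N -> (\int[mu]_(x in D) (u n x)%:E <= B%:E)%E) ->
  (\int[mu]_(x in D) (v x)%:E <= B%:E)%E.
Proof.
move=> mD mu_ u0 uv uB.
(* The shift discards the indices below [N], for which no bound is assumed. *)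
pose f n x := (u (n + N)%N x)%:E.
have mf n : measurable_fun D (f n) by apply/measurable_EFinP; exact: mu_.
have f0 n x : D x -> (0 <= f n x)%E by move=> Dx; rewrite lee_fin u0.
have -> : (\int[mu]_(x in D) (v x)%:E = \int[mu]_(x in D) limn_einf (f^~ x))%E.
  apply: eq_integral => x /set_mem Dx.
  have fv : f^~ x @ \oo --> (v x)%:E.
    apply: cvg_EFin; first by apply: nearW => n.
    by have := uv x Dx; rewrite -(cvg_shiftn N).
  by rewrite is_cvg_limn_einfE; [apply/esym/cvg_lim|apply/cvg_ex; exists (v x)%:E].
apply: le_trans (fatou mu mD mf f0) _; rewrite limn_einf_lim.
apply: lime_le; first exact: is_cvg_einfs.
apply: nearW => n; apply: (@le_trans _ _ (\int[mu]_(x in D) f n x)%E).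
  by apply: ereal_inf_lbound; exists n => /=.
by apply: uB; exact: leq_addl.
Qed.

End FatouBound.

Section Reproducing.
Variable R : realType.
Notation mu2 := ((@lebesgue_measure R) \x (@lebesgue_measure R))%E.
Implicit Types (f g : R[i] -> R[i]) (z c : R[i]) (rho : R).

Variables (Om : set R[i]) (w : R[i]) (phi dphi V : R[i] -> R[i]) (s : R[i]).
Hypothesis oO : copen Om.
Hypothesis Ow : Om w.
Hypothesis phi_wirt : forall z, Om z -> wirt Om phi z (dphi z) 0.
Hypothesis dphi_hol : hol Om dphi.
Hypothesis V_hol : hol Om V.
Hypothesis phi_pole : forall z, Om z -> z != w -> (phi z)^-1 = s / (z - w) + V z.
Hypothesis phi_lt1 : forall z, Om z -> normc (phi z) < 1.
Hypothesis phi_proper : forall rho, rho < 1 -> exists M d : R, [/\ 0 < M, 0 < d &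
  forall z, Om z -> normc (phi z) ^+ 2 <= rho ->
    normc z <= M /\ forall u, normc (u - z) < d -> Om u].

Let phi_hol : hol Om phi.
Proof. by move=> z /phi_wirt; exists (dphi z). Qed.

Let well_inside_phi rho F : 0 < rho < 1 ->
  (forall z, Om z -> F z != 0 -> normc (phi z) ^+ 2 <= rho) -> well_inside Om F.
Proof.
move=> /andP[r0 r1] hF; have [M [d [M0 d0 h]]] := phi_proper r1.
by exists M, d; split=> // z Oz Fz; apply: h => //; exact: hF.
Qed.

(** By the chain rule, the conj-derivative of [cutN rho] composed with [phi]. *)
Let weight rho z := cutm rho (phi z) * (dphi z)^*%C.

Let ccont_weight rho : 0 < rho -> ccont Om (weight rho).
Proof.
move=> r0; apply: ccontM; first by apply: ccont_cutm_comp => //; exact: hol_ccont.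
by apply: ccontJ; exact: hol_ccont.
Qed.

Let weight_integrable rho f : 0 < rho < 1 -> ccont Om f ->
  mu2.-integrable (planar Om) (EFin \o cre (fun z => f z * weight rho z)).
Proof.
move=> r01 fc; have /andP[r0 r1] := r01.
apply: well_inside_integrable => //; last by apply: ccontM => //; exact: ccont_weight.
apply: (well_inside_phi r01) => z Oz; have [//|/ltW h] := leP.
by rewrite /weight cutm_out// mul0r mulr0 eqxx.
Qed.

(** Off the two cutoff regions the smoothed kernels are [1 / phi] and [1 / (z - w)], and
    [1 / phi = s / (z - w) + V] makes [F] vanish. As [V] is holomorphic it adds nothing to the
    conj-derivative, so the weight may be replaced by [s] times a mean at [w]. *)
Lemma reproducing_cutoff rho f : 0 < rho < 1 -> hol Om f ->
  \int[mu2]_(p in planar Om) cre (fun z => f z * weight rho z) p = pi * complex.Re (s * f w).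
Proof.
move=> r01 hf; have /andP[rho0 rho1] := r01.
have [r0 r00 ballO] := oO Ow.
pose r := r0 / 2; have r_ : 0 < r < r0 by apply/andP; split; rewrite /r; lra.
have /andP[rp rr] := r_; have rp2 : 0 < r ^+ 2 by exact: exprn_gt0.
have hsf : hol Om (fun z => s * f z) by apply: holM => //; exact: hol_cst.
rewrite -(mean_value oO r00 ballO r_ hsf).
apply/eqP; rewrite -subr_eq0 -RintegralB; last 3 first.
- exact: copen_measurable.
- exact: weight_integrable (hol_ccont hf).
- exact: (mean_integrable oO r00 ballO r_ (hol_ccont hsf)).
pose b z := f z * (weight rho z - s * cutm (r ^+ 2) (z - w)).
pose F z := f z * (cutN rho (phi z) - s * cutN (r ^+ 2) (z - w) - V z).
have -> : \int[mu2]_(p in planar Om) (cre (fun z => f z * weight rho z) p -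
    cre (fun z => s * f z * cutm (r ^+ 2) (z - w)) p) = \int[mu2]_(p in planar Om) cre b p.
  apply: eq_Rintegral => p _; rewrite /cre /b mulrBr raddfB/=; congr (_ - complex.Re _).
  by rewrite mulrCA mulrA.
have [M [d [M0 d0 Md]]] := phi_proper rho1.
have inside G : (forall z, Om z -> rho <= normc (phi z) ^+ 2 -> r <= normc (z - w) -> G z = 0) ->
    well_inside Om G.
  (* The support lies in the union of a sublevel set of [|phi|] and a disc about [w], so the bounds
     are added and the smaller margin is kept. *)
  move=> hG; exists (M + (normc w + r0)), (Num.min d (r0 - r)); split.
  - by apply: addr_gt0 => //; apply: ltr_wpDl => //; exact: normc_ge0.
  - by rewrite lt_min d0 subr_gt0.
  move=> z Oz Gz; have [h|/ltW h] := leP (normc (phi z) ^+ 2) rho.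
    have [h1 h2] := Md z Oz h; split.
      apply: (le_trans h1); rewrite lerDl; apply: addr_ge0; [exact: normc_ge0|exact: ltW].
    by move=> u; rewrite lt_min => /andP[/h2].
  have [h'|/(hG z Oz h) G0] := ltP (normc (z - w)) r; last by rewrite G0 eqxx in Gz.
  split.
    by have := le_normcD (z - w) w; rewrite subrK; lra.
  move=> u; rewrite lt_min => /andP[_ uz]; apply: ballO.
  by have := le_normcD3 u w z; lra.
have r2le (z : R[i]) : r <= normc (z - w) -> r ^+ 2 <= normc (z - w) ^+ 2.
  by move=> h; rewrite ler_pXn2r ?nnegrE ?normc_ge0// ltW.
apply/eqP; apply: (@green_planar _ Om F) => //.
- apply: ccontM; first exact: hol_ccont.
  apply: ccontB; first exact: ccont_weight.
  by apply: ccontM; [exact: ccont_cst|exact: ccont_cutm_shift].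
- apply: inside => z Oz h1 h2; rewrite /F !cutN_out ?r2le// phi_pole//; last first.
    by apply: contraTneq h2 => ->; rewrite subrr normc0 -ltNge.
  by rewrite [X in _ * X](_ : _ = 0) ?mulr0//; ring.
- by apply: inside => z Oz h1 h2; rewrite /b /weight !cutm_out ?r2le// mul0r mulr0 subrr mulr0.
move=> c Oc; have [a hfc] := hf c Oc.
have [a1 h1] := wirt_cutN_comp rho0 (phi_wirt Oc).
have [a2 h2] := wirt_cutN_comp rp2 (wirt_shift Om w c).
have [a3 h3] := V_hol Oc.
have h4 := wirtD (wirtD h1 (wirtM (wirt_cst Om (- s) c) h2)) (wirtM (wirt_cst Om (-1) c) h3).
have h5 := wirtM hfc h4.
have FG z : Om z -> f z * (cutN rho (phi z) + - s * cutN (r ^+ 2) (z - w) + -1 * V z) = F z.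
  by move=> _; rewrite /F mulN1r mulNr.
have := eq_wirt Oc FG h5.
set A := (X in wirt _ _ _ X _); set B := (X in wirt _ _ _ _ X).
have -> : B = b c by rewrite /B /b /weight conjc1; ring.
by exists A.
Qed.

(** Starting at 3 keeps the cutoff level [1 - 2 / k] positive. *)
Let k (n : nat) : R := n.+3%:R.
Let k_gt0 n : 0 < k n. Proof. by rewrite ltr0n. Qed.
Let k_inv n : 0 < (k n)^-1 <= 3^-1.
Proof. by rewrite invr_gt0 k_gt0 lef_pV2 ?posrE// ler_nat. Qed.
Let r1 n : R := 1 - 1 / k n.
Let r2 n : R := 1 - 2 / k n.
Let r1P n : 0 < r1 n < 1.
Proof. by rewrite /r1; move: (k n)^-1 (k_inv n) => u /andP[? ?]; lra. Qed.
Let r2P n : 0 < r2 n < 1.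
Proof. by rewrite /r2; move: (k n)^-1 (k_inv n) => u /andP[? ?]; lra. Qed.

(* The weights [G n] vanish near the boundary and tend to 1. *)
Let G n t : R := k n * (Num.max 0 (r1 n - t) - Num.max 0 (r2 n - t)).

Let G01 n t : 0 <= G n t <= 1.
Proof.
have kr : r1 n - r2 n = 1 / k n by rewrite /r1 /r2; field; rewrite gt_eqF.
have k0 : 0 < 1 / k n by rewrite divr_gt0.
have H : 0 <= Num.max 0 (r1 n - t) - Num.max 0 (r2 n - t) <= 1 / k n.
  move: (r1 n) (r2 n) (1 / k n) kr k0 => a b u kr k0.
  by have [h1|h1] := leP 0 (a - t); have [h2|h2] := leP 0 (b - t); apply/andP; split; lra.
case/andP: H => h1 h2; rewrite /G mulr_ge0 ?(ltW (k_gt0 n))//=.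
by move: h2; rewrite ler_pdivlMr// mulrC.
Qed.

Let G_cvg t : t < 1 -> G n t @[n --> \oo] --> (1 : R).
Proof.
move=> t1; apply: cvg_near_cst; exists (Num.truncn (2 / (1 - t))).+1 => // n /= Nn.
have h : 2 / (1 - t) < k n.
  rewrite (lt_le_trans (truncnS_gt _))// /k ler_nat (leq_trans Nn)//.
  by rewrite -[leqLHS]addn0 -addn3 leq_add2l.
have {h} h : 2 / k n < 1 - t.
  by rewrite ltr_pdivrMr// mulrC -ltr_pdivrMr// subr_gt0.
have e1 : 1 / k n <= 2 / k n by rewrite ler_pM2r ?invr_gt0// ler1n.
have g1 : 0 <= r1 n - t by rewrite /r1; move: (1 / k n) (2 / k n) e1 h => u v e1 h; lra.
have g2 : 0 <= r2 n - t by rewrite /r2; move: (2 / k n) h => u h; lra.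
rewrite /G (max_idPr g1) (max_idPr g2).
by rewrite /r1 /r2; field; rewrite gt_eqF.
Qed.

(** The positive part of [rho - t] is [rho * bump rho t], hence [rho^2 / 2] times the factor in
    [cutm rho]. So [G] is a combination of two weights to which [reproducing_cutoff] applies. *)
Let GE n z : (((G n (normc (phi z) ^+ 2))%:C)%C : R[i]) =
  ((k n * r1 n ^+ 2 / 2)%:C)%C * cutm (r1 n) (phi z) -
  ((k n * r2 n ^+ 2 / 2)%:C)%C * cutm (r2 n) (phi z).
Proof.
have /andP[p1 _] := r1P n; have /andP[p2 _] := r2P n.
have mx rho t : 0 < rho -> Num.max 0 (rho - t) = rho * bump rho t.
  move=> rho0; rewrite /bump maxr_pMr ?mulr0 ?ltW//; congr Num.max.
  by field; rewrite gt_eqF.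
rewrite /G !mx// /cutm; set x := bump _ _; set y := bump _ _.
apply/eqP; rewrite eq_complex /=; apply/andP; split; apply/eqP; last by ring.
by field; rewrite !gt_eqF.
Qed.

Let GF n f z := f z * (((G n (normc (phi z) ^+ 2))%:C)%C * (dphi z)^*%C).

Let GF_E n f p : cre (GF n f) p =
  (k n * r1 n ^+ 2 / 2) * cre (fun z => f z * weight (r1 n) z) p -
  (k n * r2 n ^+ 2 / 2) * cre (fun z => f z * weight (r2 n) z) p.
Proof.
rewrite /cre /GF GE; set z := Complex _ _; set x := k n * _ / 2; set y := k n * _ / 2.
have reM (a : R) (u : R[i]) : a * complex.Re u = complex.Re ((a%:C)%C * u).
  by case: u => u v /=; rewrite mul0r subr0.
by rewrite !reM -raddfB; congr complex.Re; rewrite /weight; ring.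
Qed.

Let GF_integrable n f : hol Om f -> mu2.-integrable (planar Om) (EFin \o cre (GF n f)).
Proof.
move=> hf.
rewrite (_ : cre (GF n f) = fun p => (k n * r1 n ^+ 2 / 2) * cre (fun z => f z * weight (r1 n) z) p -
  (k n * r2 n ^+ 2 / 2) * cre (fun z => f z * weight (r2 n) z) p); last first.
  by apply/funext => p; rewrite GF_E.
by apply: planar_integrableB => //; apply: planar_integrableZl => //;
  apply: weight_integrable => //; exact: hol_ccont.
Qed.

Let GF_integral n f : hol Om f -> \int[mu2]_(p in planar Om) cre (GF n f) p =
  (1 - 3 / (2 * k n)) * (pi * complex.Re (s * f w)).
Proof.
move=> hf; have mO := copen_measurable oO.
have i1 := weight_integrable (r1P n) (hol_ccont hf).
have i2 := weight_integrable (r2P n) (hol_ccont hf).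
rewrite (@eq_Rintegral _ _ _ mu2 _ (fun p => (k n * r1 n ^+ 2 / 2) * cre (fun z => f z * weight (r1 n) z) p -
  (k n * r2 n ^+ 2 / 2) * cre (fun z => f z * weight (r2 n) z) p)); last first.
  by move=> p _; exact: GF_E.
rewrite RintegralB//; [|exact: planar_integrableZl|exact: planar_integrableZl].
rewrite RintegralZl// RintegralZl// !reproducing_cutoff//.
by rewrite -mulrBl; congr (_ * _); rewrite /r1 /r2; field; rewrite gt_eqF.
Qed.

Let GF_cvg f p : Om (Complex p.1 p.2) -> cre (GF n f) p @[n --> \oo] -->
  cre (fun z => f z * (dphi z)^*%C) p.
Proof.
move=> Op; set z := Complex p.1 p.2 in Op *.
have t1 : normc (phi z) ^+ 2 < 1 by rewrite expr_lt1// ?normc_ge0// phi_lt1.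
have -> : (fun n => cre (GF n f) p) =
    (fun n => G n (normc (phi z) ^+ 2) * cre (fun z => f z * (dphi z)^*%C) p).
  apply/funext => n; rewrite /cre /GF -/z mulrCA.
  by case: (f z * _) => x y /=; rewrite mul0r subr0.
rewrite -[X in _ --> X]mul1r; apply: cvgM; first exact: G_cvg.
exact: cvg_cst.
Qed.

Let GF_le n f z : `|complex.Re (GF n f z)| <= normc (f z) ^+ 2 + normc (dphi z) ^+ 2.
Proof.
apply: le_trans (normRe_le _) _; rewrite /GF !normcM normc_real normcJ'.
have /andP[g0 g1] := G01 n (normc (phi z) ^+ 2); rewrite ger0_norm//.
have := normc_ge0 (f z); have := normc_ge0 (dphi z).
set x := normc (f z); set y := normc (dphi z) => y0 x0.
have : G n (normc (phi z) ^+ 2) * (x * y) <= 1 * (x * y) by rewrite ler_wpM2r// mulr_ge0.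
have := sqr_ge0 (x - y); have : 0 <= x * y by exact: mulr_ge0.
have -> : x * (G n (normc (phi z) ^+ 2) * y) = G n (normc (phi z) ^+ 2) * (x * y) by ring.
by rewrite sqrrB; lra.
Qed.

(** With phi' itself as test function the integrands are nonnegative and their integrals are known
    and bounded, so Fatou's lemma replaces the change of variables that would compute an area. *)
Lemma dphi_sqint : (sqint Om dphi < +oo)%E.
Proof.
have mO := copen_measurable oO.
pose B := `|pi * complex.Re (s * dphi w)|.
suff : (sqint Om dphi <= B%:E)%E by move/le_lt_trans; apply; exact: ltry.
apply: (@fatou_bound _ _ _ mu2 _ (fun n => cre (GF n dphi)) _ B 0%N) => //.
- move=> n; have /integrableP[+ _] := GF_integrable n dphi_hol.
  by move/measurable_EFinP.
- move=> n p Op; rewrite /cre /GF mulrCA mulrC (mulrC (dphi _)) mulJc.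
  rewrite -[X in 0 <= complex.Re X]rmorphM/= mulr_ge0 ?sqr_ge0//.
  by have /andP[] := G01 n (normc (phi (Complex p.1 p.2)) ^+ 2).
- move=> p Op.
  have -> : normc (dphi (Complex p.1 p.2)) ^+ 2 = cre (fun z => dphi z * (dphi z)^*%C) p.
    by rewrite /cre mulrC mulJc.
  exact: GF_cvg.
move=> n _; have := GF_integral n dphi_hol.
rewrite /Rintegral => h; rewrite -[leLHS]fineK; last first.
  by apply: integrable_fin_num => //; exact: GF_integrable.
rewrite lee_fin h /B; apply: le_trans (ler_norm _) _; rewrite normrM ler_piMl//.
rewrite invfM; move: (k n)^-1 (k_inv n) => u /andP[h1 h2].
by rewrite ger0_norm; lra.
Qed.

(** The weights [G n] increase the cutoff level to 1; dominated convergence applies with majorant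
    [|f|^2 + |phi'|^2]. *)
Theorem reproducing f : hol Om f -> (sqint Om f < +oo)%E ->
  mu2.-integrable (planar Om) (EFin \o cre (fun z => f z * (dphi z)^*%C)) /\
  \int[mu2]_(p in planar Om) cre (fun z => f z * (dphi z)^*%C) p = pi * complex.Re (s * f w).
Proof.
move=> hf foo; have mO := copen_measurable oO.
have fc := hol_ccont hf; have dc := hol_ccont dphi_hol.
have ig := planar_integrableD oO (sqint_integrable oO fc foo) (sqint_integrable oO dc dphi_sqint).
have [] := @dominated_convergence _ _ _ mu2 (planar Om) mO (fun n => EFin \o cre (GF n f))
  (EFin \o cre (fun z => f z * (dphi z)^*%C)) _ _ _ _ ig _.
- by move=> n; have /integrableP[] := GF_integrable n hf.
- apply/measurable_EFinP; apply: ccont_measurable_Re => //.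
  by apply: ccontM => //; exact: ccontJ.
- apply: aeW => p Op; apply: cvg_EFin; first exact: nearW.
  exact: GF_cvg.
- by apply: aeW => p n Op; rewrite /= lee_fin; exact: GF_le.
move=> i1 _ cv; split => //.
have : fine (\int[mu2]_(p in planar Om) (EFin \o cre (GF n f)) p)%E @[n --> \oo] -->
    \int[mu2]_(p in planar Om) cre (fun z => f z * (dphi z)^*%C) p.
  apply: fine_cvg; rewrite fineK//; exact: integrable_fin_num.
have -> : (fun n => fine (\int[mu2]_(p in planar Om) (EFin \o cre (GF n f)) p)%E) =
    (fun n => (1 - 3 / (2 * k n)) * (pi * complex.Re (s * f w))).
  by apply/funext => n; exact: GF_integral.
move/cvg_lim => <- //; apply/cvg_lim => //.
rewrite -[X in _ --> X]mul1r; apply: cvgM; last exact: cvg_cst.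
rewrite -[X in _ --> X]subr0; apply: cvgB; first exact: cvg_cst.
have -> : (fun n => 3 / (2 * k n)) = (fun n => 3 / 2 * (k n)^-1).
  by apply/funext => n; rewrite invfM mulrA.
rewrite -[X in _ --> X](mulr0 (3 / 2)); apply: cvgM; first exact: cvg_cst.
have -> : (fun n => (k n)^-1) = (fun n => harmonic (n + 2)%N : R).
  by apply/funext => n; rewrite /harmonic /= addn2.
by have := @cvg_harmonic R; rewrite -(cvg_shiftn 2).
Qed.

End Reproducing.

Section BergmanKernels.
Variable R : realType.
Notation mu2 := ((@lebesgue_measure R) \x (@lebesgue_measure R))%E.
Implicit Types (Om : set R[i]) (f g k : R[i] -> R[i]) (z w c : R[i]).

Lemma gt0_complexE (e : R[i]) : 0 < e -> e = ((complex.Re e)%:C)%C /\ 0 < complex.Re e.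
Proof. by rewrite ltcE; case: e => x y /= /andP[/eqP -> ?]. Qed.

Lemma lt_normcC z (e : R) : (`|z| < (e%:C)%C) = (normc z < e).
Proof. by rewrite ltcE eqxx. Qed.

Lemma hol_holomorphic Om f : copen Om -> holomorphic_on Om f <-> hol Om f.
Proof.
move=> oO; split=> hf z Oz.
  have /cvg_ex[/= l /cvgrPdist_le fl] := hf z Oz.
  exists l => e e0.
  have e0' : 0 < (e%:C)%C :> R[i] by rewrite ltcR.
  have [d /= /gt0_complexE[-> d0] dP] := fl _ e0'.
  exists (complex.Re d) => // u Ou uz; have [->|uz0] := eqVneq u z.
    by rewrite !subrr conjc0 !mulr0 addr0 subrr normc0 mulr0.
  have h : `|l - (u - z)^-1 * (f ((u - z) * 1 + z) - f z)| <= (e%:C)%C.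
    apply: dP; last by rewrite subr_eq0.
    by rewrite /ball_ /= sub0r normrN lt_normcC.
  move: h; rewrite mulr1 subrK lecR /= => h.
  have uz1 : u - z != 0 by rewrite subr_eq0.
  rewrite mul0r addr0.
  have -> : f u - f z - l * (u - z) = - ((l - (u - z)^-1 * (f u - f z)) * (u - z)).
    by rewrite mulrBl mulrAC mulVf// mul1r opprB.
  by rewrite normcN normcM ler_wpM2r ?normc_ge0.
have [a fa] := hf z Oz; have [r r0 rP] := oO z Oz.
apply/cvg_ex; exists a; apply/cvgrPdist_le => /= e /gt0_complexE[-> e0].
have [d d0 dP] := fa _ e0.
exists (((Num.min d r)%:C)%C : R[i]); first by rewrite /= ltcR lt_min d0.
move=> h; rewrite /ball_ /= sub0r normrN lt_normcC lt_min => /andP[hd hr] h0.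
have zh : (h *: (1 : R[i]^o) + z : R[i]) = z + h by rewrite addrC; congr (_ + _); exact: mulr1.
rewrite zh.
have e1 : z + h - z = h by rewrite addrC addKr.
have Oh : Om (z + h) by apply: rP; rewrite e1.
have := dP (z + h) Oh; rewrite e1 => /(_ hd); rewrite mul0r addr0 => k.
rewrite lecR.
have -> : a - h^-1 *: (f (z + h) - f z : R[i]^o) = - (h^-1 * (f (z + h) - f z - a * h)).
  rewrite -[h^-1 *: _]/(h^-1 * (f (z + h) - f z)) [in RHS]mulrBr.
  by rewrite [h^-1 * (a * h)]mulrCA mulVf// mulr1 opprB.
rewrite -[leLHS]/(normc _) normcN normcM normcV ler_pdivrMl ?normc_gt0//.
by rewrite [leRHS]mulrC.
Qed.

Lemma Re_sqr_norm z : complex.Re (`|z| ^+ 2) = normc z ^+ 2.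
Proof. by rewrite sqr_normc mulrC mulJc. Qed.

Lemma pi_scale_lty (x : \bar R) : (0 <= x)%E -> (((pi^-1)%R%:E * x < +oo) <-> (x < +oo))%E.
Proof.
move=> x0; split=> [|xoo]; last first.
  by rewrite lte_mul_pinfty// lee_fin invr_ge0 ltW ?pi_gt0.
case: x x0 => // [r _ _|_]; first exact: ltry.
by rewrite gt0_muley ?ltxx// lte_fin invr_gt0 pi_gt0.
Qed.

Lemma bergman_spaceP Om f : copen Om ->
  bergman_space Om f <-> hol Om f /\ (sqint Om f < +oo)%E.
Proof.
move=> oO; rewrite /bergman_space /=.
have -> : planar_integral Om (fun z => complex.Re (`|f z| ^+ 2)) = sqint Om f.
  by apply: eq_integral => p _; rewrite Re_sqr_norm.
have := @pi_scale_lty (sqint Om f) => /(_ _)[].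
  by apply: integral_ge0 => p _; rewrite lee_fin sqr_ge0.
by move=> h1 h2; split=> -[/hol_holomorphic h3 h4]; split; auto.
Qed.

Lemma mul_conj_integrable Om f g : copen Om -> ccont Om f -> ccont Om g ->
  (sqint Om f < +oo)%E -> (sqint Om g < +oo)%E ->
  mu2.-integrable (planar Om) (EFin \o cre (fun z => f z * (g z)^*%C)).
Proof.
move=> oO fc gc foo goo; have mO := copen_measurable oO.
have ig := planar_integrableD oO (sqint_integrable oO fc foo) (sqint_integrable oO gc goo).
apply: (@le_integrable _ _ _ mu2 _ _ _ _ _ _ ig) => //.
  apply/measurable_EFinP; apply: ccont_measurable_Re => //.
  by apply: ccontM => //; exact: ccontJ.
move=> p _; rewrite /= lee_fin [leRHS]ger0_norm ?addr_ge0 ?sqr_ge0//.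
apply: le_trans (normRe_le _) _; rewrite normcM normcJ'.
set x := normc _; set y := normc _.
have x0 : 0 <= x by exact: normc_ge0.
have y0 : 0 <= y by exact: normc_ge0.
have := sqr_ge0 (x - y); have : 0 <= x * y by exact: mulr_ge0.
by rewrite sqrrB; lra.
Qed.

Definition cint Om f : R := \int[mu2]_(p in planar Om) cre f p.

(** The imaginary part is the real part after multiplication by [- i], so results on real parts
    apply to both components. *)
Lemma bergman_ipE Om f g : bergman_ip Om f g =
  ((pi^-1)%:C)%C * Complex (cint Om (fun z => (f z)^*%C * g z)) (cint Om (fun z => (f z)^*%C * (- 'i%C * g z))).
Proof.
congr (_ * Complex _ _); apply: eq_Rintegral => p _; rewrite /cre.
by case: (f _) => a b; case: (g _) => c d /=; ring.
Qed.

(** Writing phi' as [conj s] times [k] turns the reproducing identity, whose constant is [pi s],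
    into the one with constant [pi]. *)
Lemma is_bergman_kernel_of_map Om w (phi k V : R[i] -> R[i]) (s : R[i]) :
  copen Om -> Om w -> s != 0 ->
  (forall z, Om z -> wirt Om phi z (s^*%C * k z) 0) -> hol Om k -> hol Om V ->
  (forall z, Om z -> z != w -> (phi z)^-1 = s / (z - w) + V z) ->
  (forall z, Om z -> normc (phi z) < 1) ->
  (forall rho, rho < 1 -> exists M d : R, [/\ 0 < M, 0 < d &
    forall z, Om z -> normc (phi z) ^+ 2 <= rho ->
      normc z <= M /\ forall u, normc (u - z) < d -> Om u]) ->
  is_bergman_kernel_at Om w k.
Proof.
move=> oO Ow s0 hphi hk hV hpole hlt hproper.
have sc0 : s^*%C != 0 by rewrite conjc_eq0.
have hd : hol Om (fun z => s^*%C * k z) by apply: holM => //; exact: hol_cst.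
have dsq := dphi_sqint oO Ow hphi hd hV hpole hlt hproper.
have rep := reproducing oO Ow hphi hd hV hpole hlt hproper.
have sqZ f (a : R[i]) : hol Om f -> (sqint Om f < +oo)%E -> (sqint Om (fun z => a * f z)%R < +oo)%E.
  move=> hf foo; have := planar_integrableZl (normc a ^+ 2) oO (sqint_integrable oO (hol_ccont hf) foo).
  move=> /integrableP[_]; apply: le_lt_trans; rewrite le_eqVlt; apply/orP; left; apply/eqP.
  apply: eq_integral => p _; rewrite normcM exprMn /=.
  by rewrite (ger0_norm (mulr_ge0 (sqr_ge0 _) (sqr_ge0 _))).
have key f : hol Om f -> (sqint Om f < +oo)%E -> cint Om (fun z => (k z)^*%C * f z) = pi * complex.Re (f w).
  move=> hf foo; have hf' : hol Om (fun z => s^-1 * f z) by apply: holM => //; exact: hol_cst.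
  have [_] := rep _ hf' (sqZ _ _ hf foo); rewrite mulrA mulfV// mul1r => <-.
  apply: eq_Rintegral => p _; rewrite /cre; congr complex.Re.
  by rewrite rmorphM/= conjcK; field.
split.
  apply/(bergman_spaceP _ oO); split => //.
  have := sqZ _ (s^*%C)^-1 hd dsq; congr (_ < _)%E; apply: eq_integral => p _.
  by rewrite mulKf.
move=> f /(bergman_spaceP _ oO)[hf foo]; rewrite bergman_ipE key// (key (fun z => - 'i%C * f z)) ?sqZ//.
  case: (f w) => x y /=; apply/eqP; rewrite eq_complex /= !mul0r !subr0 !addr0.
  have p0 : pi != 0 :> R by rewrite gt_eqF ?pi_gt0.
  by apply/andP; split; apply/eqP; rewrite mulKf//; ring.
by apply: holM => //; exact: hol_cst.
Qed.

Lemma bergman_ipC Om f g : copen Om -> ccont Om f -> ccont Om g ->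
  (sqint Om f < +oo)%E -> (sqint Om g < +oo)%E -> (bergman_ip Om f g)^*%C = bergman_ip Om g f.
Proof.
move=> oO fc gc foo goo; rewrite !bergman_ipE.
have -> : cint Om (fun z => (g z)^*%C * f z) = cint Om (fun z => (f z)^*%C * g z).
  apply: eq_Rintegral => p _; rewrite /cre.
  by case: (f _) => a b; case: (g _) => c d /=; ring.
have -> : cint Om (fun z => (g z)^*%C * (- 'i%C * f z)) =
    - cint Om (fun z => (f z)^*%C * (- 'i%C * g z)).
  have igc : ccont Om (fun z => - 'i%C * g z) by apply: ccontM => //; exact: ccont_cst.
  have igoo : (sqint Om (fun z => - 'i%C * g z)%R < +oo)%E.
    by rewrite sqintZ// normcN normc_i.
  have I := mul_conj_integrable oO igc fc igoo foo.
  have -> : cint Om (fun z => (f z)^*%C * (- 'i%C * g z)) =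
      cint Om (fun z => (- 'i%C * g z) * (f z)^*%C).
    by apply: eq_Rintegral => p _; rewrite /cre mulrC.
  rewrite -[RHS]mulN1r /cint -RintegralZl//; last exact: copen_measurable.
  apply: eq_Rintegral => p _; rewrite /cre.
  by case: (f _) => a b; case: (g _) => c d /=; ring.
move: (cint _ _) (cint _ _) => x y; apply/eqP; rewrite eq_complex /=.
by apply/andP; split; apply/eqP; ring.
Qed.

(** Uniqueness through symmetry: if [k] is the kernel chosen by [xget] at [w], pairing [k] with
    [K z] in both orders gives [K z w] and [k z], which are therefore conjugate. *)
Lemma bergman_kernelE Om (K : R[i] -> R[i] -> R[i]) : copen Om ->
  (forall w, Om w -> is_bergman_kernel_at Om w (K w)) ->
  (forall z w, Om z -> Om w -> (K z w)^*%C = K w z) ->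
  forall z w, Om z -> Om w -> bergman_kernel Om z w = K w z.
Proof.
move=> oO HK Ksym z w Oz Ow; rewrite /bergman_kernel.
have /(xgetPex (fun=> 0)) := ex_intro _ _ (HK w Ow); set k := xget _ _ => -[kA kP].
have [KA KP] := HK z Oz.
have [hk koo] := (bergman_spaceP k oO).1 kA.
have [hK Koo] := (bergman_spaceP (K z) oO).1 KA.
rewrite -Ksym// -(kP _ KA) -(KP _ kA).
by rewrite (bergman_ipC oO)//; exact: hol_ccont.
Qed.

End BergmanKernels.

(** * The disc, the half plane and the half disc *)

Section Domains.
Variable R : realType.
Implicit Types (f g : R[i] -> R[i]) (z w c u : R[i]).

Definition disc : set R[i] := [set z | normc z < 1].
Definition half_plane : set R[i] := [set z | 0 < complex.Re z].
Definition half_disc : set R[i] := [set z | normc z < 1 /\ 0 < complex.Re z].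

Definition disc_kernel w z : R[i] := (1 - z * w^*%C) ^- 2.
Definition half_plane_kernel w z : R[i] := (z + w^*%C) ^- 2.
Definition half_disc_kernel w z : R[i] := disc_kernel w z + half_plane_kernel w z.

Lemma conjcD z w : (z + w)^*%C = z^*%C + w^*%C. Proof. exact: rmorphD. Qed.
Lemma conjcB z w : (z - w)^*%C = z^*%C - w^*%C. Proof. exact: rmorphB. Qed.
Lemma conjcM z w : (z * w)^*%C = z^*%C * w^*%C. Proof. exact: rmorphM. Qed.

Lemma disc_ball z u : normc z < 1 -> normc (u - z) < 1 - normc z -> normc u < 1.
Proof. by move=> z1 uz; have := le_normcD (u - z) z; rewrite subrK; lra. Qed.

Lemma half_plane_ball z u : normc (u - z) < complex.Re z -> 0 < complex.Re u.
Proof.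
by move=> uz; have := le_lt_trans (normRe_le _) uz; rewrite raddfB/= ltr_norml => /andP[]; lra.
Qed.

Lemma copen_disc : copen disc.
Proof.
move=> z z1; exists (1 - normc z); first by rewrite subr_gt0.
by move=> u; exact: disc_ball.
Qed.

Lemma copen_half_plane : copen half_plane.
Proof. by move=> z z0; exists (complex.Re z) => // u; exact: half_plane_ball. Qed.

Lemma copen_half_disc : copen half_disc.
Proof.
move=> z [z1 z0]; exists (Num.min (1 - normc z) (complex.Re z)).
  by rewrite lt_min subr_gt0 z1.
move=> u; rewrite lt_min => /andP[h1 h2]; split; [exact: disc_ball h1|exact: half_plane_ball h2].
Qed.

Lemma normc_sub1_ge (a : R[i]) : 1 - normc a <= normc (1 - a).
Proof. by have := le_normcD (1 - a) a; rewrite subrK normc1; lra. Qed.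

Lemma disc_mul_lt1 z w : disc z -> disc w -> normc (z * w) < 1.
Proof.
rewrite /disc/= normcM => z1 w1; rewrite -[1]mulr1 ltr_pM ?normc_ge0//.
Qed.

Lemma disc_neq0 z w : disc z -> disc w -> 1 - z * w^*%C != 0.
Proof.
move=> z1 w1; rewrite -normc_gt0 (lt_le_trans _ (normc_sub1_ge _))// subr_gt0.
by apply: disc_mul_lt1 => //; rewrite /disc/= normcJ'.
Qed.

Lemma disc_neq0' z w : disc z -> disc w -> 1 + z * w != 0.
Proof.
move=> z1 w1; rewrite -[_ * _]opprK -normc_gt0 (lt_le_trans _ (normc_sub1_ge _))// subr_gt0.
by rewrite normcN; exact: disc_mul_lt1.
Qed.

Lemma half_plane_neq0 z w : half_plane z -> half_plane w -> z + w^*%C != 0.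
Proof.
rewrite /half_plane/= => z0 w0; apply/eqP => /(congr1 (@complex.Re R)).
by case: z z0 => a b /=; case: w w0 => c d /= ? ?; lra.
Qed.

Lemma wirt_div (D : set R[i]) f g c a b : g c != 0 ->
  wirt D f c a 0 -> wirt D g c b 0 ->
  wirt D (fun z => f z / g z) c ((a * g c - f c * b) / g c ^+ 2) 0.
Proof.
move=> g0 hf hg.
have hV := @wirt_comp _ D setT g _ _ _ _ _ _ (fun _ _ => Logic.I) hg (wirt_inv setT g0).
have := wirtM hf hV.
set A := (X in wirt _ _ _ X _); set B := (X in wirt _ _ _ _ X).
have -> : B = 0 by rewrite /B; ring.
by have -> // : A = (a * g c - f c * b) / g c ^+ 2; rewrite /A /=; field.
Qed.

Lemma holX' (D : set R[i]) f : hol D f -> (forall z, D z -> f z != 0) -> hol D (fun z => f z ^- 2).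
Proof.
move=> hf f0; apply: (@holV _ D (fun z => f z ^+ 2)); first exact: holX.
by move=> z Dz; rewrite expf_neq0// f0.
Qed.

Lemma hol_disc_kernel (D : set R[i]) w : disc w -> D `<=` disc -> hol D (disc_kernel w).
Proof.
move=> w1 Dd; apply: holX' => [|z /Dd z1]; last exact: disc_neq0.
by apply: holB; [exact: hol_cst|apply: holM; [exact: hol_id|exact: hol_cst]].
Qed.

Lemma hol_half_plane_kernel (D : set R[i]) w : half_plane w -> D `<=` half_plane ->
  hol D (half_plane_kernel w).
Proof.
move=> w1 Dd; apply: holX' => [|z /Dd z1]; last exact: half_plane_neq0.
by apply: holD; [exact: hol_id|exact: hol_cst].
Qed.

Lemma sqr_normc_lt (a b : R[i]) : b != 0 -> normc a ^+ 2 < normc b ^+ 2 -> normc (a / b) < 1.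
Proof.
rewrite -normc_gt0 => b0 ab; rewrite normcM normcV ltr_pdivrMr// mul1r.
by rewrite -(ltr_pXn2r (n := 2)) ?nnegrE ?normc_ge0.
Qed.

Lemma sqr_normc_le (a b : R[i]) (rho : R) : b != 0 -> normc (a / b) ^+ 2 <= rho ->
  (1 - rho) * normc b ^+ 2 <= normc b ^+ 2 - normc a ^+ 2.
Proof.
rewrite -normc_gt0 => b0; rewrite normcM normcV exprMn exprVn ler_pdivrMr ?exprn_gt0//.
by lra.
Qed.

(** This and the next two identities compute [1 - |phi|^2] up to the square of the denominator of
    [phi]. Positivity gives [|phi| < 1]; a lower bound on the left side keeps [z] away from the
    boundary. *)
Lemma disc_identity z w : normc (1 - z * w^*%C) ^+ 2 - normc (z - w) ^+ 2 =
  (1 - normc z ^+ 2) * (1 - normc w ^+ 2).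
Proof. by rewrite !sqr_normcE; case: z => a b; case: w => c d /=; ring. Qed.

Lemma half_plane_identity z w : normc (z + w^*%C) ^+ 2 - normc (z - w) ^+ 2 =
  4 * complex.Re z * complex.Re w.
Proof. by rewrite !sqr_normcE; case: z => a b; case: w => c d /=; ring. Qed.

Lemma half_disc_identity z w :
  normc ((z + w^*%C) * (1 - z * w^*%C)) ^+ 2 - normc ((z - w) * (1 + z * w)) ^+ 2 =
  4 * (complex.Re z * (1 - normc z ^+ 2)) * (complex.Re w * (1 - normc w ^+ 2)).
Proof. by rewrite !sqr_normcE; case: z => a b; case: w => c d /=; ring. Qed.

Lemma sqr_normc_lt1 z : disc z -> 0 < 1 - normc z ^+ 2.
Proof. by move=> z1; rewrite subr_gt0 expr_lt1// normc_ge0. Qed.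

Theorem disc_kernelP w : disc w -> is_bergman_kernel_at disc w (disc_kernel w).
Proof.
move=> w1; have z1 (z : R[i]) : disc z -> disc z by [].
(* The residue at [w] of [1 / phi = (1 - z conj w) / (z - w)]; the remaining part is the constant
   [- conj w]. *)
pose s : R[i] := 1 - w * w^*%C.
have sc : s^*%C = s.
  rewrite /s; case: (w) => a b; apply/eqP; rewrite eq_complex /=.
  by apply/andP; split; apply/eqP; ring.
apply: (@is_bergman_kernel_of_map _ disc w (fun z => (z - w) / (1 - z * w^*%C)) _ (fun=> - w^*%C) s) => //.
- exact: copen_disc.
- exact: disc_neq0.
- move=> z Dz; rewrite sc; have d0 := disc_neq0 Dz w1.
  have h1 := wirt_shift disc w z.
  have h2 : wirt disc (fun z => 1 - z * w^*%C) z (- w^*%C) 0.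
    have := wirtD (wirt_cst disc 1 z) (wirtM (wirt_id disc z) (wirt_cst disc (- w^*%C) z)).
    rewrite mul0r !mulr0 !addr0 mul1r add0r => h.
    by apply: eq_wirt h => // u _; rewrite mulrN.
  have := @wirt_div disc (fun z => z - w) (fun z => 1 - z * w^*%C) z _ _ d0 h1 h2.
  by congr wirt; rewrite /s /disc_kernel; field.
- by apply: hol_disc_kernel.
- exact: hol_cst.
- move=> z Dz zw; have d0 := disc_neq0 Dz w1; have zw0 : z - w != 0 by rewrite subr_eq0.
  by rewrite /s; field; rewrite d0 zw0.
- move=> z Dz; apply: sqr_normc_lt; first exact: disc_neq0.
  by rewrite -subr_gt0 disc_identity mulr_gt0// sqr_normc_lt1.
move=> rho rho1.
pose e := (1 - rho) * (1 - normc w) ^+ 2; have e0 : 0 < e.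
  by rewrite mulr_gt0 ?exprn_gt0// subr_gt0.
exists 1, (e / 2); split=> //; first by rewrite divr_gt0.
move=> z Dz /(sqr_normc_le (disc_neq0 Dz w1)); rewrite disc_identity => h.
split; first exact: ltW.
have h1 : 1 - normc w <= normc (1 - z * w^*%C).
  rewrite (le_trans _ (normc_sub1_ge _))// lerB// normcM normcJ' ler_piMl ?normc_ge0//.
  exact: ltW.
have h2 : (1 - normc w) ^+ 2 <= normc (1 - z * w^*%C) ^+ 2.
  by rewrite ler_pXn2r ?nnegrE ?normc_ge0// subr_ge0 ltW.
have h3 : e <= 1 - normc z ^+ 2.
  apply: (@le_trans _ _ ((1 - normc z ^+ 2) * (1 - normc w ^+ 2))).
    by apply: le_trans h; rewrite ler_wpM2l// subr_ge0 ltW.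
  by rewrite ler_piMr ?(ltW (sqr_normc_lt1 Dz))// gerBl sqr_ge0.
move=> u uz; apply: (disc_ball Dz); apply: (lt_le_trans uz).
by have := sqr_ge0 (1 - normc z); rewrite sqrrB expr1n mul1r; lra.
Qed.

Theorem half_plane_kernelP w : half_plane w ->
  is_bergman_kernel_at half_plane w (half_plane_kernel w).
Proof.
move=> w0; pose s : R[i] := w + w^*%C.
have sc : s^*%C = s by rewrite /s rmorphD/= conjcK addrC.
apply: (@is_bergman_kernel_of_map _ half_plane w (fun z => (z - w) / (z + w^*%C)) _ (fun=> 1) s) => //.
- exact: copen_half_plane.
- exact: half_plane_neq0.
- move=> z Dz; rewrite sc; have d0 := half_plane_neq0 Dz w0.
  have h1 := wirt_shift half_plane w z.
  have h2 : wirt half_plane (fun z => z + w^*%C) z 1 0.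
    by have := wirtD (wirt_id half_plane z) (wirt_cst half_plane (w^*%C) z); rewrite !addr0.
  have := @wirt_div half_plane (fun z => z - w) (fun z => z + w^*%C) z _ _ d0 h1 h2.
  by congr wirt; rewrite /s /half_plane_kernel; field.
- exact: hol_half_plane_kernel.
- exact: hol_cst.
- move=> z Dz zw; have d0 := half_plane_neq0 Dz w0.
  have zw0 : z - w != 0 by rewrite subr_eq0.
  by rewrite /s; field; rewrite d0 zw0.
- move=> z Dz; apply: sqr_normc_lt; first exact: half_plane_neq0.
  by rewrite -subr_gt0 half_plane_identity !mulr_gt0.
move=> rho rho1; pose v := complex.Re w; have v0 : 0 < v by [].
have r0 : 0 < 1 - rho by rewrite subr_gt0.
(* From [(1 - rho) n^2 <= 4 v Re z]: the bound [Re z <= n] limits [n], hence [|z|], and [n >= v]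
   bounds [Re z] below. *)
exists (4 * v / (1 - rho) + normc w), ((1 - rho) * v / 4); split.
- by apply: ltr_pwDl; [rewrite divr_gt0// mulr_gt0|exact: normc_ge0].
- by rewrite divr_gt0// mulr_gt0.
move=> z Dz /(sqr_normc_le (half_plane_neq0 Dz w0)); rewrite half_plane_identity -/v => h.
pose n := normc (z + w^*%C); rewrite -/n in h.
have Dz0 : 0 < complex.Re z by [].
have nge : complex.Re z + v <= n.
  apply: le_trans (le_trans (ler_norm _) (normRe_le _)).
  by rewrite /v; case: (z) => a b; case: (w) => c d.
have n0 : 0 < n by lra.
split.
  have h1 : n <= 4 * v / (1 - rho).
    rewrite ler_pdivlMr// -(ler_pM2r n0).
    have : complex.Re z * (4 * v) <= n * (4 * v) by rewrite ler_wpM2r ?mulr_ge0 ?ltW//; lra.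
    by rewrite expr2 in h; lra.
  have := le_normcD (z + w^*%C) (- w^*%C); rewrite addrK normcN normcJ' -/n; lra.
have h2 : (1 - rho) * v / 4 <= complex.Re z.
  rewrite -(ler_pM2r (x := 4 * v)) ?mulr_gt0//.
  have : v ^+ 2 <= n ^+ 2 by rewrite ler_pXn2r ?nnegrE ?ltW//; lra.
  move/(ler_wpM2l (ltW r0)); rewrite [v ^+ 2]expr2.
  have -> : (1 - rho) * v / 4 * (4 * v) = (1 - rho) * (v * v) by field.
  by lra.
by move=> u uz; apply: (@half_plane_ball z); exact: lt_le_trans h2.
Qed.

(** The cross terms [-2 z v] and [2 z v], with v = conj w, cancel when the two kernels are put over
    a common denominator, so the numerator factors. *)
Lemma half_disc_kernelE z w : disc z -> disc w -> half_plane z -> half_plane w ->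
  half_disc_kernel w z =
  (1 + z ^+ 2) * (1 + w^*%C ^+ 2) / ((z + w^*%C) ^+ 2 * (1 - z * w^*%C) ^+ 2).
Proof.
move=> z1 w1 z0 w0; rewrite /half_disc_kernel /disc_kernel /half_plane_kernel.
by field; rewrite half_plane_neq0//= disc_neq0.
Qed.

Theorem half_disc_kernelP w : half_disc w ->
  is_bergman_kernel_at half_disc w (half_disc_kernel w).
Proof.
move=> Dw; have [w1 w0] := Dw.
pose v := w^*%C.
have ww0 : 1 + w * w != 0 by exact: disc_neq0'.
have vv0 : 1 + v * v != 0 by apply: disc_neq0'; rewrite /disc/= /v normcJ'.
(* The residue of [1 / phi] at [w]. Unlike for the disc and the half plane it need not be real, so
   its conjugate has to be tracked. *)
pose s : R[i] := (w + v) * (1 - w * v) / (1 + w * w).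
have sc : s^*%C = (w + v) * (1 - w * v) / (1 + v * v).
  have vc : v^*%C = w by exact: conjcK.
  rewrite /s conjcM conjcM conjcD conjcB conjcM conjc_inv conjcD conjcM conjc1 vc -/v.
  by congr (_ * _ / _); ring.
(* Found by comparing coefficients of [z] in [(z + v) (1 - z v) = s (1 + z w) + (z - w) (beta - v
   z)]. *)
pose beta := 1 - v * v - s * w - w * v.
have w0' : w + v != 0 by exact: half_plane_neq0.
have w1' : 1 - w * v != 0 by exact: disc_neq0.
apply: (@is_bergman_kernel_of_map _ half_disc w
  (fun z => ((z - w) * (1 + z * w)) / ((z + v) * (1 - z * v))) _
  (fun z => (- v * z + beta) / (1 + z * w)) s) => //.
- exact: copen_half_disc.
- by rewrite /s mulf_neq0// ?invr_eq0// mulf_neq0.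
- move=> z Dz; have [z1 z0] := Dz; rewrite sc.
  have d0 : z + v != 0 by exact: half_plane_neq0.
  have d1 : 1 - z * v != 0 by exact: disc_neq0.
  have mono (a b : R[i]) : wirt half_disc (fun z => a + z * b) z b 0.
    have := wirtD (wirt_cst half_disc a z) (wirtM (wirt_id half_disc z) (wirt_cst half_disc b z)).
    by rewrite mul0r !mulr0 !addr0 mul1r add0r.
  have h1 := wirtM (wirt_shift half_disc w z) (mono 1 w).
  have h2 := wirtM (mono v 1) (mono 1 (- v)).
  have h1' : wirt half_disc (fun z => (z - w) * (1 + z * w)) z (1 * (1 + z * w) + (z - w) * w) 0.
    by move: h1; rewrite !mul0r !mulr0 addr0.
  have h2' : wirt half_disc (fun z => (z + v) * (1 - z * v)) z ((1 - z * v) + (z + v) * - v) 0.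
    move: h2; rewrite !mul0r !mulr0 addr0 mul1r mulr1 mulrN [v + z]addrC => h.
    by apply: eq_wirt h => // u _; rewrite mulr1 mulrN [v + u]addrC.
  have g0 : (z + v) * (1 - z * v) != 0 by rewrite mulf_neq0.
  have := @wirt_div half_disc (fun z => (z - w) * (1 + z * w)) (fun z => (z + v) * (1 - z * v))
    z _ _ g0 h1' h2'.
  congr wirt; rewrite half_disc_kernelE// -/v.
  by field; rewrite d0 d1 vv0.
- apply: holD; [apply: hol_disc_kernel => // z []|apply: hol_half_plane_kernel => // z []] => //.
- have hz (a b : R[i]) : hol half_disc (fun z => a * z + b).
    by apply: holD; [apply: holM; [exact: hol_cst|exact: hol_id]|exact: hol_cst].
  apply: holM; first exact: hz.
  apply: holV; last by move=> z [z1 _]; exact: disc_neq0'.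
  by apply: eq_hol (hz w 1) => z _; ring.
- move=> z Dz zw; have [z1 z0] := Dz.
  have d0 : z + v != 0 by exact: half_plane_neq0.
  have d1 : 1 - z * v != 0 by exact: disc_neq0.
  have zw0 : z - w != 0 by rewrite subr_eq0.
  have zw1 : 1 + z * w != 0 by exact: disc_neq0'.
  rewrite invf_div /beta /s; field.
  by rewrite zw0 zw1 ww0.
- move=> z [z1 z0]; apply: sqr_normc_lt.
    by rewrite mulf_neq0//; [exact: half_plane_neq0|exact: disc_neq0].
  by rewrite -subr_gt0 half_disc_identity !mulr_gt0// sqr_normc_lt1.
move=> rho rho1; have r0 : 0 < 1 - rho by rewrite subr_gt0.
pose a := complex.Re w; have a0 : 0 < a by [].
have nw1 : 0 < 1 - normc w by rewrite subr_gt0.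
have aw : a < 1 by apply: le_lt_trans w1; exact: le_trans (ler_norm _) (normRe_le _).
(* A lower bound for [Re z (1 - |z|^2)]: the denominator of [phi] is at least [a (1 - |w|)] in
   modulus, and the factor depending on [w] in [half_disc_identity] is at most 4. *)
pose e := (1 - rho) * (a * (1 - normc w)) ^+ 2 / 4.
have e0 : 0 < e by rewrite divr_gt0// mulr_gt0// exprn_gt0// mulr_gt0.
exists 1, (e / 2); split=> //; first by rewrite divr_gt0.
move=> z [z1 z0].
have d01 : (z + v) * (1 - z * v) != 0.
  by rewrite mulf_neq0//; [exact: half_plane_neq0|exact: disc_neq0].
move=> /(sqr_normc_le d01); rewrite half_disc_identity -/a => h.
split; first exact: ltW.
have h1 : 1 - normc w <= normc (1 - z * v).
  rewrite (le_trans _ (normc_sub1_ge _))// lerB// normcM normcJ' ler_piMl ?normc_ge0//.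
  exact: ltW.
have h2 : a <= normc (z + v).
  apply: le_trans (le_trans (ler_norm _) (normRe_le _)); rewrite /v raddfD/= /a.
  by case: (w) => c d /=; rewrite lerDr ltW.
have h3 : (a * (1 - normc w)) ^+ 2 <= normc ((z + v) * (1 - z * v)) ^+ 2.
  rewrite ler_pXn2r ?nnegrE ?normc_ge0 ?mulr_ge0 ?(ltW a0) ?(ltW nw1)// normcM.
  by rewrite ler_pM ?(ltW a0) ?(ltW nw1).
pose x := complex.Re z; have x0 : 0 < x by [].
have x1 : x < 1 by apply: le_lt_trans z1; exact: le_trans (ler_norm _) (normRe_le _).
pose y := 1 - normc z ^+ 2; have y0 : 0 < y by exact: sqr_normc_lt1.
have y1 : y <= 1 by rewrite /y gerBl sqr_ge0.
have h4 : e <= x * y.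
  have h5 : (1 - rho) * (a * (1 - normc w)) ^+ 2 <= 4 * (x * y) * (a * (1 - normc w ^+ 2)).
    by apply: le_trans h; rewrite ler_wpM2l// ltW.
  have h6 : 4 * (x * y) * (a * (1 - normc w ^+ 2)) <= 4 * (x * y) * 1.
    rewrite ler_wpM2l ?mulr_ge0 ?(ltW x0) ?(ltW y0)// mulr_ile1 ?(ltW a0) ?(ltW aw)//.
      by rewrite ltW// sqr_normc_lt1.
    by rewrite gerBl sqr_ge0.
  by rewrite /e; lra.
have ex : e <= x by apply: le_trans h4 _; rewrite ler_piMr// ltW.
have ey : e <= y by apply: le_trans h4 _; rewrite ler_piMl// ltW.
move=> u uz; split; last by apply: (@half_plane_ball z); rewrite -/x; lra.
apply: (disc_ball z1); apply: (lt_le_trans uz).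
by have := sqr_ge0 (1 - normc z); rewrite sqrrB expr1n mul1r; move: ey; rewrite /y; lra.
Qed.

Lemma disc_kernelC z w : (disc_kernel z w)^*%C = disc_kernel w z.
Proof. by rewrite /disc_kernel conjc_inv rmorphXn/= conjcB conjcM conjcK conjc1 mulrC. Qed.

Lemma half_plane_kernelC z w : (half_plane_kernel z w)^*%C = half_plane_kernel w z.
Proof. by rewrite /half_plane_kernel conjc_inv rmorphXn/= conjcD conjcK addrC. Qed.

Lemma half_disc_kernelC z w : (half_disc_kernel z w)^*%C = half_disc_kernel w z.
Proof. by rewrite /half_disc_kernel conjcD disc_kernelC half_plane_kernelC. Qed.

Theorem half_disc_bergman_kernel z w : half_disc z -> half_disc w ->
  bergman_kernel half_disc z w = bergman_kernel disc z w + bergman_kernel half_plane z w.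
Proof.
move=> Dz Dw; have [z1 z0] := Dz; have [w1 w0] := Dw.
rewrite (bergman_kernelE copen_half_disc half_disc_kernelP)//; last first.
  by move=> *; exact: half_disc_kernelC.
rewrite (bergman_kernelE copen_disc disc_kernelP)//; last first.
  by move=> *; exact: disc_kernelC.
rewrite (bergman_kernelE copen_half_plane half_plane_kernelP)//.
by move=> *; exact: half_plane_kernelC.
Qed.

End Domains.

Arguments disc {R}.
Arguments half_plane {R}.
Arguments half_disc {R}.

(** * Unique continuation from the real segment *)

Section SmoothStep.
Variable R : realType.
Implicit Types (z c : R[i]) (rho : R).

Lemma wirt_bump_Re rho c : 0 < rho ->
  wirt setT (fun z => ((bump rho (complex.Re z) ^+ 2)%:C)%C) c
    (((- bump rho (complex.Re c) / rho)%:C)%C) (((- bump rho (complex.Re c) / rho)%:C)%C).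
Proof.
move=> r0; apply: (wirt_quadratic (K := rho ^- 2)) => z _ _.
set k := - bump rho _ / rho; set s := complex.Re z; set t := complex.Re c.
have -> : (bump rho s ^+ 2)%:C%C - (bump rho t ^+ 2)%:C%C -
    (k%:C%C * (z - c) + k%:C%C * (z - c)^*%C) =
    ((bump rho s ^+ 2 - bump rho t ^+ 2 - 2 * k * (s - t))%:C)%C.
  rewrite /s /t; move: (bump _ _ ^+ 2) (bump _ _ ^+ 2) => A B.
  case: (z) => a b; case: (c) => a' b' /=; apply/eqP; rewrite eq_complex /=.
  by apply/andP; split; apply/eqP; ring.
rewrite normc_real.
have := max0_sqr_taylor (1 - t / rho) (1 - s / rho); rewrite /= -/(bump rho t) -/(bump rho s).
have -> : 2 * bump rho t * (1 - s / rho - (1 - t / rho)) = 2 * k * (s - t).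
  by rewrite /k -/t; field; rewrite gt_eqF.
move=> /le_trans; apply.
have -> : (1 - s / rho - (1 - t / rho)) ^+ 2 = (s - t) ^+ 2 * rho ^- 2.
  by field; rewrite gt_eqF.
rewrite mulrC ler_wpM2l ?invr_ge0 ?exprn_ge0 ?(ltW r0)//.
rewrite -[leLHS]real_normK ?num_real// ler_pXn2r ?nnegrE ?normc_ge0//.
by rewrite /s /t -raddfB; exact: normRe_le.
Qed.

Variables (k1 k2 : R).
Hypothesis k10 : 0 < k1.
Hypothesis k12 : k1 < k2.
Let k20 : 0 < k2 := lt_trans k10 k12.
(** The value of [U] on the circle [|z|^2 = k1]: inside it [U >= m1], so a second bump at level [m1]
    vanishes there, while [U = 0] outside the circle [|z|^2 = k2]. *)
Let m1 := (1 - k1 / k2) ^+ 2.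
Let m10 : 0 < m1.
Proof. by rewrite exprn_gt0// subr_gt0 ltr_pdivrMr// mul1r. Qed.
Let U z : R[i] := ((bump k2 (normc z ^+ 2) ^+ 2)%:C)%C.

(* A step function of |z|^2: it is 0 for |z|^2 <= k1 and 1 for |z|^2 >= k2. *)
Definition step z : R[i] := ((bump m1 (complex.Re (U z)) ^+ 2)%:C)%C.
Definition step_dbar z : R[i] := ((- bump m1 (complex.Re (U z)) / m1)%:C)%C * (- cutm k2 z * z) +
  ((- bump m1 (complex.Re (U z)) / m1)%:C)%C * (- cutm k2 z * z^*%C)^*%C.

Lemma step_wirt c : exists a, wirt setT step c a (step_dbar c).
Proof.
have h := wirt_comp (D' := setT) (fun _ _ => Logic.I) (wirt_bump_sqr c k20) (wirt_bump_Re (U c) m10).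
eexists; exact: h.
Qed.

Lemma step_dbar_ccont D : ccont D step_dbar.
Proof.
have Uc : ccont D U.
  apply: wirt_ccont => c _; exists (- cutm k2 c * c^*%C), (- cutm k2 c * c).
  by apply: (wirtS (D' := setT)) => //; exact: wirt_bump_sqr.
have bc : ccont D (fun z => ((- bump m1 (complex.Re (U z)) / m1)%:C)%C).
  apply: (@ccont_real _ _ _ (fun t => - bump m1 t / m1) Uc) => t.
  apply: cvgM; last exact: cvg_cst.
  apply: cvgN; apply/cvgrPdist_lt => e e0; exists (e * m1) => /=; first by rewrite mulr_gt0.
  by move=> s /= ts; rewrite (le_lt_trans (bump_lip _ _ m10))// ltr_pdivrMr.
have cc := ccontN (ccont_cutm (D := D) k20).
apply: ccontD; apply: ccontM => //; first by apply: ccontM => //; exact: ccont_id.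
by apply: ccontJ; apply: ccontM => //; apply: ccontJ; exact: ccont_id.
Qed.

Lemma step_hi z : k2 <= normc z ^+ 2 -> step z = 1.
Proof.
move=> h; rewrite /step /U /= (bump_out k20 h) expr0n /= bump_in ?mul0r ?subr0 ?expr1n//.
exact: ltW.
Qed.

Lemma step_dbar_hi z : k2 <= normc z ^+ 2 -> step_dbar z = 0.
Proof.
by move=> h; rewrite /step_dbar cutm_out// oppr0 !mul0r conjc0 !mulr0 addr0.
Qed.

Let U_lo z : normc z ^+ 2 <= k1 -> m1 <= complex.Re (U z).
Proof.
move=> h; rewrite /U /= bump_in//; last by rewrite (le_trans h)// ltW.
rewrite ler_pXn2r ?nnegrE ?subr_ge0 ?ler_pdivrMr ?mul1r//.
- by rewrite lerB// ler_pM2r ?invr_gt0.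
- exact: ltW.
- by rewrite (le_trans h)// ltW.
Qed.

Lemma step_lo z : normc z ^+ 2 <= k1 -> step z = 0.
Proof. by move=> h; rewrite /step bump_out ?U_lo// expr0n. Qed.

Lemma step_dbar_lo z : normc z ^+ 2 <= k1 -> step_dbar z = 0.
Proof. by move=> h; rewrite /step_dbar bump_out ?U_lo// oppr0 mul0r !mul0r addr0. Qed.

End SmoothStep.

(** * The damping weight on the half disc *)

Section HalfDiscWeight.
Variable R : realType.
Implicit Types (z c u : R[i]) (T : R).

(** Both factors of [Re z (1 - |z|^2)] are at most 1, so a lower bound on the product bounds each
    factor. *)
Lemma half_disc_ball z u (e : R) : half_disc z -> 0 < e ->
  e <= complex.Re z * (1 - normc z ^+ 2) -> normc (u - z) < e / 2 -> half_disc u.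
Proof.
move=> [z1 z0] e0 h uz.
have x1 : complex.Re z < 1 by apply: le_lt_trans z1; exact: le_trans (ler_norm _) (normRe_le _).
pose y := 1 - normc z ^+ 2; have y0 : 0 < y by exact: sqr_normc_lt1.
have y1 : y <= 1 by rewrite /y gerBl sqr_ge0.
have ex : e <= complex.Re z by apply: le_trans h _; rewrite ler_piMr// ltW.
have ey : e <= y by apply: le_trans h _; rewrite ler_piMl// ltW.
split; last by apply: (@half_plane_ball _ z); lra.
apply: (disc_ball z1); apply: (lt_le_trans uz).
by have := sqr_ge0 (1 - normc z); rewrite sqrrB expr1n mul1r; move: ey; rewrite /y; lra.
Qed.

Definition joukowski z : R[i] := z^-1 - z.

Lemma half_disc_neq0 z : half_disc z -> z != 0.
Proof. by move=> [_ z0]; apply: contraTneq z0 => ->; rewrite ltxx. Qed.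

Lemma Re_joukowski z : half_disc z ->
  complex.Re (joukowski z) * normc z ^+ 2 = complex.Re z * (1 - normc z ^+ 2).
Proof.
move=> Dz; have z0 := half_disc_neq0 Dz; have n0 : normc z ^+ 2 != 0.
  by rewrite expf_neq0// gt_eqF// normc_gt0.
rewrite /joukowski raddfB/= -[z^-1]/(invc z).
move: n0; rewrite sqr_normcE; case: (z) => a b /= n0; field; exact: n0.
Qed.

Lemma Im_joukowski z : half_disc z ->
  complex.Im (joukowski z) * normc z ^+ 2 = - complex.Im z * (1 + normc z ^+ 2).
Proof.
move=> Dz; have z0 := half_disc_neq0 Dz; have n0 : normc z ^+ 2 != 0.
  by rewrite expf_neq0// gt_eqF// normc_gt0.
rewrite /joukowski raddfB/= -[z^-1]/(invc z).
move: n0; rewrite sqr_normcE; case: (z) => a b /= n0; field; exact: n0.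
Qed.

Lemma Re_joukowski_gt0 z : half_disc z -> 0 < complex.Re (joukowski z).
Proof.
move=> Dz; have n0 : 0 < normc z ^+ 2 by rewrite exprn_gt0// normc_gt0 half_disc_neq0.
rewrite -(pmulr_lgt0 _ n0) Re_joukowski//; have [z1 z0] := Dz.
by rewrite mulr_gt0// sqr_normc_lt1.
Qed.

Lemma Im_joukowski_le0 z : half_disc z -> 0 <= complex.Im z -> complex.Im (joukowski z) <= 0.
Proof.
move=> Dz y0; have n0 : 0 < normc z ^+ 2 by rewrite exprn_gt0// normc_gt0 half_disc_neq0.
by rewrite -(pmulr_lle0 _ n0) Im_joukowski// mulNr oppr_le0 mulr_ge0// addr_ge0// ltW.
Qed.

Definition jweight T z : R[i] := joukowski z / (joukowski z - Complex 0 T) ^+ 2.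

Lemma joukowski_shift_neq0 T z : half_disc z -> joukowski z - Complex 0 T != 0.
Proof.
move=> /Re_joukowski_gt0; case: (joukowski z) => a b /= a0.
by rewrite eq_complex /= negb_and subr0 gt_eqF.
Qed.

Lemma jweight_hol T : exists2 dB, hol half_disc dB &
  forall z, half_disc z -> wirt half_disc (jweight T) z (dB z) 0.
Proof.
have hinv : hol half_disc (fun z : R[i] => z^-1).
  by apply: holV; [exact: hol_id|move=> z; exact: half_disc_neq0].
have hj : hol half_disc joukowski by apply: holB => //; exact: hol_id.
have wj z : half_disc z -> wirt half_disc joukowski z (- z ^- 2 - 1) 0.
  move=> Dz; have := wirtD (wirt_inv half_disc (half_disc_neq0 Dz))
    (wirtM (wirt_cst half_disc (-1) z) (wirt_id half_disc z)).
  rewrite !mul0r !mulr0 !addr0 mulr1 add0r => h.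
  by apply: eq_wirt h => // u _; rewrite mulN1r.
have hq : hol half_disc (fun z => joukowski z - Complex 0 T) by apply: holB => //; exact: hol_cst.
have wq z : half_disc z -> wirt half_disc (fun z => joukowski z - Complex 0 T) z (- z ^- 2 - 1) 0.
  by move=> Dz; have := wirtD (wj z Dz) (wirt_cst half_disc (- Complex 0 T) z); rewrite !addr0.
pose q z := joukowski z - Complex 0 T.
exists (fun z => ((- z ^- 2 - 1) * q z ^+ 2 -
    joukowski z * ((- z ^- 2 - 1) * q z + q z * (- z ^- 2 - 1))) / (q z ^+ 2) ^+ 2).
  have hz2 : hol half_disc (fun z : R[i] => - z ^- 2 - 1).
    apply: holB; last exact: hol_cst.
    by apply: holN; apply: holX'; [exact: hol_id|exact: half_disc_neq0].
  have hq2 := holX 2 hq.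
  apply: holM.
    apply: holB; first exact: holM.
    by apply: holM => //; apply: holD; exact: holM.
  apply: holX' => // z Dz; rewrite expf_neq0//; exact: joukowski_shift_neq0.
move=> z Dz; have q0 : q z ^+ 2 != 0 by rewrite expf_neq0// joukowski_shift_neq0.
apply: (@wirt_div _ half_disc joukowski (fun z => q z ^+ 2) z) => //; first exact: wj.
by have := wirtM (wq z Dz) (wq z Dz); rewrite mul0r mulr0 addr0.
Qed.

Lemma normc_jweight T z : normc (jweight T z) =
  normc (joukowski z) / normc (joukowski z - Complex 0 T) ^+ 2.
Proof. by rewrite /jweight normcM normcV expr2 normcM -expr2. Qed.

Lemma sqr_joukowski_shift T z : normc (joukowski z - Complex 0 T) ^+ 2 =
  normc (joukowski z) ^+ 2 + T ^+ 2 - 2 * T * complex.Im (joukowski z).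
Proof. by rewrite !sqr_normcE; case: (joukowski z) => a b /=; ring. Qed.

(** With [t = Im (joukowski w)], the denominator is [2 T (T - t)], so the modulus is
    [1 / (2 (T - t))]. It exceeds [1 / (4 T)] because [- t < T], a consequence of
    [Re (joukowski w) > 0]. *)
Lemma jweight_gt w : half_disc w -> 0 < complex.Im w ->
  let T := normc (joukowski w) in 0 < T /\ (4 * T)^-1 < normc (jweight T w).
Proof.
move=> Dw y0 T; have p0 := Re_joukowski_gt0 Dw.
have T0 : 0 < T by rewrite /T normc_gt0; apply: contraTneq p0 => ->; rewrite ltxx.
split => //; rewrite normc_jweight sqr_joukowski_shift -/T.
have tT : - complex.Im (joukowski w) < T.
  apply: le_lt_trans (ler_norm _) _; rewrite normrN.
  rewrite -(ltr_pXn2r (n := 2)) ?nnegrE ?normc_ge0// real_normK ?num_real// sqr_normcE.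
  by rewrite ltrDr exprn_gt0.
have i0 := Im_joukowski_le0 Dw (ltW y0).
have d0 : 0 < T ^+ 2 + T ^+ 2 - 2 * T * complex.Im (joukowski w).
  have -> : T ^+ 2 + T ^+ 2 - 2 * T * complex.Im (joukowski w) =
    2 * T * (T - complex.Im (joukowski w)) by ring.
  by rewrite !mulr_gt0//; lra.
rewrite ltr_pdivlMr// mulrC ltr_pdivrMr ?mulr_gt0//.
have : T * (- complex.Im (joukowski w)) < T * T by rewrite ltr_pM2l.
by rewrite !expr2; lra.
Qed.

(** A level above [1 / (4 T)] keeps [joukowski z] bounded and away from the closed negative
    imaginary axis. Its real part times [|z|^2] is [Re z (1 - |z|^2)], which then controls the
    distance to the boundary of the half disc. Points near the real segment are allowed. *)
Lemma jweight_inside T (c1 : R) : 0 < T -> (4 * T)^-1 < c1 ->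
  exists2 d : R, 0 < d & forall z, half_disc z -> 0 <= complex.Im z ->
    c1 <= normc (jweight T z) -> forall u, normc (u - z) < d -> half_disc u.
Proof.
move=> T0 cT; have c0 : 0 < c1 by apply: lt_trans cT; rewrite invr_gt0 mulr_gt0.
have cT4 : 1 < 4 * T * c1 by rewrite -ltr_pdivrMl ?mulr_gt0// mulr1.
(* With [m], [s], [t] the modulus, real and imaginary parts of [joukowski z], inserting
   [2 m T <= m^2 + T^2] in the hypothesis gives [m + t >= l m]. Then [s >= m + t] and [m >= c1 T^2]
   give [s >= eta]; [ell] bounds [|z|] below through [1 / |z| <= m + |z|]. *)
pose l := (4 * T * c1 - 1) / (2 * T * c1).
have l0 : 0 < l by rewrite divr_gt0 ?subr_gt0// !mulr_gt0.
pose eta := l * (c1 * T ^+ 2); have eta0 : 0 < eta by rewrite mulr_gt0// mulr_gt0// exprn_gt0.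
pose ell := (1 + c1^-1)^-1; have ell0 : 0 < ell by rewrite invr_gt0 addr_gt0// invr_gt0.
pose e := eta * ell ^+ 2; have e0 : 0 < e by rewrite mulr_gt0// exprn_gt0.
exists (e / 2); first by rewrite divr_gt0.
move=> z Dz y0; rewrite normc_jweight ler_pdivlMr ?exprn_gt0 ?normc_gt0 ?joukowski_shift_neq0//.
rewrite sqr_joukowski_shift => h u uz; apply: (half_disc_ball Dz e0) uz.
rewrite -Re_joukowski//.
set m := normc (joukowski z) in h *; set t := complex.Im (joukowski z) in h.
have t0 : t <= 0 by exact: Im_joukowski_le0.
have s0 := Re_joukowski_gt0 Dz; set s := complex.Re (joukowski z) in s0 *.
have m2 : m ^+ 2 = s ^+ 2 + t ^+ 2 by exact: sqr_normcE.
have sm : s <= m by apply: le_trans (ler_norm _) (normRe_le _).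
have m0 : 0 < m by exact: lt_le_trans sm.
have tm : 0 <= m + t.
  by have := normIm_le (joukowski z); rewrite -/m -/t ler_norml => /andP[? _]; lra.
have tT : 0 <= - (T * t) by rewrite -mulrN mulr_ge0 ?(ltW T0)// oppr_ge0.
have h1 : m <= c1^-1.
  rewrite -[c1^-1]mul1r ler_pdivlMr// -(ler_pM2r m0) mul1r.
  apply: le_trans h; have : 0 <= c1 * (T ^+ 2 - 2 * T * t).
    by rewrite mulr_ge0 ?(ltW c0)// addr_ge0 ?sqr_ge0//; lra.
  by rewrite expr2; lra.
have h2 : c1 * T ^+ 2 <= m.
  apply: le_trans h; rewrite ler_wpM2l ?(ltW c0)//.
  by have := sqr_ge0 m; lra.
have h3 : l * m <= m + t.
  have d0 : 0 < 2 * T * c1 by rewrite !mulr_gt0.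
  rewrite /l mulrAC ler_pdivrMr//.
  have : c1 * (2 * (m * T) - 2 * T * t) <= c1 * (m ^+ 2 + T ^+ 2 - 2 * T * t).
    by rewrite ler_wpM2l ?(ltW c0)//; have := sqr_ge0 (m - T); rewrite sqrrB; lra.
  by move: h; lra.
have h4 : eta <= s.
  apply: (@le_trans _ _ (l * m)); first by rewrite /eta ler_wpM2l// ltW.
  apply: le_trans h3 _; rewrite -(ler_pM2r m0).
  have : (m + t) * m <= (m + t) * (m - t) by rewrite ler_wpM2l//; lra.
  have -> : (m + t) * (m - t) = s ^+ 2 by move: m2; rewrite !expr2 => m2; lra.
  have : s * s <= s * m by rewrite ler_wpM2l// ltW.
  by rewrite expr2; lra.
have h5 : ell <= normc z.
  have n0 : 0 < normc z by rewrite normc_gt0 half_disc_neq0.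
  have [n1 _] := Dz.
  rewrite /ell -[leRHS]invrK lef_pV2 ?posrE ?invr_gt0 ?addr_gt0 ?invr_gt0//.
  have := le_normcD (joukowski z) z; rewrite /joukowski subrK normcV -/(joukowski z) -/m.
  by move: n1; rewrite /=; lra.
rewrite /e ler_pM// ?exprn_ge0 ?(ltW eta0) ?(ltW ell0)//.
by rewrite ler_pXn2r ?nnegrE ?normc_ge0 ?(ltW ell0).
Qed.

End HalfDiscWeight.

Section UniqueContinuation.
Variable R : realType.
Notation mu2 := ((@lebesgue_measure R) \x (@lebesgue_measure R))%E.
Implicit Types (h : R[i] -> R[i]) (z w c u : R[i]).

Section UpperPoint.
Variable w : R[i].
Hypothesis Dw : half_disc w.
Hypothesis yw : 0 < complex.Im w.

Let T := normc (joukowski w).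
Let B := jweight T.
Let beta := normc (B w).
Let T0 : 0 < T. Proof. by have [] := jweight_gt Dw yw. Qed.
Let b0 : R := (4 * T)^-1.
Let b00 : 0 < b0. Proof. by rewrite invr_gt0 mulr_gt0. Qed.
Let b0beta : b0 < beta. Proof. by have [] := jweight_gt Dw yw. Qed.
(** [c1] and [c2] cut the interval from [b0] to [beta] in thirds. The cutoff [W] rises from 0 to 1
    between these levels of [|B|], strictly below the level of [w]. *)
Let c1 := (2 * b0 + beta) / 3.
Let c2 := (b0 + 2 * beta) / 3.
Let bc1 : b0 < c1. Proof. by rewrite /c1; move: b0beta; generalize b0 beta => x y ?; lra. Qed.
Let c12 : c1 < c2. Proof. by rewrite /c1 /c2; move: b0beta; generalize b0 beta => x y ?; lra. Qed.
Let c2b : c2 < beta. Proof. by rewrite /c2; move: b0beta; generalize b0 beta => x y ?; lra. Qed.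
Let c10 : 0 < c1. Proof. exact: lt_trans bc1. Qed.
Let c20 : 0 < c2. Proof. exact: lt_trans c12. Qed.
Let k1 := c1 ^+ 2.
Let k2 := c2 ^+ 2.
Let k10 : 0 < k1. Proof. exact: exprn_gt0. Qed.
Let k12 : k1 < k2. Proof. by rewrite ltr_pXn2r ?nnegrE ?ltW. Qed.
Let sq_le (a b : R) : 0 <= a -> 0 <= b -> (a ^+ 2 <= b ^+ 2) = (a <= b).
Proof. by move=> ? ?; rewrite ler_pXn2r ?nnegrE. Qed.

Let W z := step k1 k2 (B z).
Let dB : R[i] -> R[i] := xget (fun=> 0) [set dB | hol half_disc dB /\
  forall z, half_disc z -> wirt half_disc B z (dB z) 0].
Let dBP : hol half_disc dB /\ forall z, half_disc z -> wirt half_disc B z (dB z) 0.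
Proof.
have [d h1 h2] := jweight_hol T.
rewrite /dB; set X := [set _ | _]; have h : exists d, X d by exists d.
exact: (xgetPex (fun=> 0) h).
Qed.
Let B_hol : hol half_disc B. Proof. by move=> z Dz; exists (dB z); exact: dBP.2. Qed.
Let Wb z := step_dbar k1 k2 (B z) * (dB z)^*%C.

Let W_wirt z : half_disc z -> exists a, wirt half_disc W z a (Wb z).
Proof.
move=> Dz; have [a h] := step_wirt k10 k12 (B z).
have := wirt_comp (D' := setT) (fun _ _ => Logic.I) (dBP.2 z Dz) h.
by rewrite mulr0 add0r; eexists; eassumption.
Qed.

Let Wb_ccont : ccont half_disc Wb.
Proof.
apply: ccontM; last by apply: ccontJ; exact: hol_ccont dBP.1.
exact: (ccont_comp (D' := setT) (hol_ccont B_hol) (step_dbar_ccont (D := setT) k10 k12)).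
Qed.

Let W_hi z : c2 <= normc (B z) -> W z = 1 /\ Wb z = 0.
Proof.
move=> h; have h' : k2 <= normc (B z) ^+ 2 by rewrite sq_le ?normc_ge0 ?(ltW c20).
by split; [exact: step_hi|rewrite /Wb step_dbar_hi// mul0r].
Qed.

Let W_lo z : normc (B z) <= c1 -> W z = 0 /\ Wb z = 0.
Proof.
move=> h; have h' : normc (B z) ^+ 2 <= k1 by rewrite sq_le ?normc_ge0 ?(ltW c10).
by split; [exact: step_lo|rewrite /Wb step_dbar_lo// mul0r].
Qed.

(** Contains the upper half of the half disc and has its bottom edge on the real axis, where [h]
    will vanish. *)
Let Q := csquare (-1) 0 2 : set R[i].

(* Extensions by zero of functions that vanish where [jweight T] is small behave on the closed
   upper square as if their support were compact in the half disc. *)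
Let near_out (G : R[i] -> R[i]) c : (forall z, normc (B z) <= c1 -> G z = 0) ->
  ~ half_disc c -> exists2 d : R, 0 < d & forall z, Q z -> normc (z - c) < d -> ext0 half_disc G z = 0.
Proof.
move=> hG nDc; have [d d0 dP] := jweight_inside T0 bc1; exists d => // z [_ /andP[y0 _]] zc.
have [Dz|nDz] := pselect (half_disc z); last by rewrite ext0_out.
rewrite ext0_in//; apply: hG; have [//|/ltW h] := leP.
by exfalso; apply: nDc; apply: (dP z Dz y0 h); rewrite normcB.
Qed.

Let ext0_ccont (G : R[i] -> R[i]) : (forall z, normc (B z) <= c1 -> G z = 0) ->
  ccont half_disc G -> ccont Q (ext0 half_disc G).
Proof.
move=> hG Gc c Qc e e0; have [Dc|nDc] := pselect (half_disc c).
  have [d d0 dP] := Gc c Dc e e0; have [r r0 rP] := copen_half_disc Dc.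
  exists (Num.min d r); first by rewrite lt_min d0.
  by move=> z _; rewrite lt_min => /andP[zd /rP Dz]; rewrite !ext0_in//; exact: dP.
have [d d0 dP] := near_out hG nDc; exists d => // z Qz zc.
by rewrite (dP _ Qz zc) (ext0_out _ nDc) subrr normc0.
Qed.

(** On this disc [W = 1], so the cutoff does not disturb the mean value at [w]. *)
Let ballr : exists2 r : R, 0 < r < 1 & forall z, normc (z - w) < 2 * r ->
  [/\ half_disc z, 0 < complex.Im z & c2 < normc (B z)].
Proof.
have [d1 d10 d1P] := copen_half_disc Dw.
have bc0 : 0 < beta - c2 by rewrite subr_gt0.
have [d2 d20 d2P] := hol_ccont B_hol Dw bc0.
pose m := Num.min (Num.min d1 d2) (Num.min (complex.Im w) 1).
have m0 : 0 < m by rewrite !lt_min d10 d20 yw ltr01.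
exists (m / 2).
  have : m <= 1 by rewrite !ge_min lexx !orbT.
  by move: m0; generalize m => x ? ?; apply/andP; split; lra.
move=> z zw; have {}zw : normc (z - w) < m by move: zw; lra.
move: zw; rewrite !lt_min => /andP[/andP[z1 z2] /andP[z3 z4]].
have Dz := d1P z z1; split=> //.
  have := le_lt_trans (normIm_le _) z3; rewrite raddfB/= ltr_norml => /andP[]; lra.
have := d2P z Dz z2; have := le_normcD (B w - B z) (B z).
by rewrite subrK (normcB (B w) (B z)) -/beta; lra.
Qed.

Let area4 : fine (mu2 (planar (square (-1) 0 (2 : R)))) = 4.
Proof. by rewrite measure_square//=; ring. Qed.

Let Re_vanish h : hol half_disc h -> (forall z, half_disc z -> complex.Im z = 0 -> h z = 0) ->
  complex.Re (h w) = 0.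
Proof.
move=> hh h0; have [r /andP[r0 r1] rP] := ballr.
have rr : 0 < r < 2 * r by apply/andP; split; lra.
have r20 : 0 < 2 * r by lra.
have rr2 : 0 < r ^+ 2 by exact: exprn_gt0.
have ballO z : normc (z - w) < 2 * r -> half_disc z by case/rP.
have Bw0 : B w != 0 by rewrite -normc_gt0 -/beta (lt_trans c20).
pose N z := cutN (r ^+ 2) (z - w); pose m z := cutm (r ^+ 2) (z - w).
have mc : ccont half_disc m by exact: ccont_cutm_shift.
have N_wirt c : exists a, wirt half_disc N c a (m c).
  have [a k] := wirt_cutN_comp rr2 (wirt_shift half_disc w c).
  by exists a; move: k; rewrite conjc1 mulr1.
have Nc : ccont half_disc N by apply: wirt_ccont => c _; have [a ?] := N_wirt c; exists a, (m c).
(* The part of the error term that does not depend on [n]. Its extension by zero is continuous on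
   the closed square, hence bounded by some [K]. *)
pose E z := h z * (Wb z * N z).
have Elo z : normc (B z) <= c1 -> E z = 0 by move=> /W_lo[_ Wb0]; rewrite /E Wb0 mul0r mulr0.
have Ec : ccont half_disc E by apply: ccontM; [exact: hol_ccont|exact: (ccontM Wb_ccont)].
have [K KP] := ccont_bounded_square (ltr0n _ 2) (ext0_ccont Elo Ec).
pose H (n : nat) z := (B z / B w) ^+ n.
have Hhol n : hol half_disc (H n) by apply: holX; apply: holM => //; exact: hol_cst.
pose theta := c2 / beta.
have beta0 : 0 < beta by exact: lt_trans c2b.
have theta0 : 0 <= theta by rewrite divr_ge0// ltW.
have theta1 : theta < 1 by rewrite ltr_pdivrMr// mul1r.
(* The conj-derivative of [h H^n W N] splits into [b1], from the smoothed kernel, whose integral is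
   [pi Re (h w)], and [b2], from the cutoff. The latter lives where [|B| <= c2], so it is at most
   [theta^n K] on a square of area 4. *)
have main n : `|pi * complex.Re (h w)| <= theta ^+ n * K * 4.
  pose hn z := h z * H n z.
  have hnhol : hol half_disc hn by exact: holM.
  pose F z := hn z * (W z * N z).
  pose b2 z := hn z * (Wb z * N z).
  pose b1 z := hn z * (W z * m z).
  have b1E z : b1 z = hn z * m z.
    rewrite /b1; have [->|m0] := eqVneq (m z) 0; first by rewrite !mulr0.
    have zr := cutm_support r0 m0.
    have [_ _ /ltW /W_hi[-> _]] := rP z ltac:(move: zr; lra).
    by rewrite mul1r.
  have Flo z : normc (B z) <= c1 -> F z = 0 by move=> /W_lo[W0 _]; rewrite /F W0 mul0r mulr0.
  have b2lo z : normc (B z) <= c1 -> b2 z = 0 by move=> /W_lo[_ W0]; rewrite /b2 W0 mul0r mulr0.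
  have b1lo z : normc (B z) <= c1 -> b1 z = 0 by move=> /W_lo[W0 _]; rewrite /b1 W0 mul0r mulr0.
  have b2c : ccont half_disc b2 by apply: ccontM; [exact: hol_ccont|exact: ccontM].
  have b1c : ccont half_disc b1.
    apply: (@eq_ccont _ _ (fun z => hn z * m z)); first by move=> z _; rewrite b1E.
    by apply: ccontM => //; exact: hol_ccont.
  have S0 : 0 < (2 : R) by [].
  have C1 := ext0_ccont b1lo b1c; have C2 := ext0_ccont b2lo b2c.
  have green : sint (fun z => ext0 half_disc b1 z + ext0 half_disc b2 z) (-1) 0 2 = 0.
    apply: (@green_square0 _ (ext0 half_disc F)) => //; first exact: ccontD.
      move=> c Qc; have [Dc|nDc] := pselect (half_disc c).
        have [a ha] := hnhol c Dc; have [a1 h1] := W_wirt Dc; have [a2 h2] := N_wirt c.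
        have := wirtM ha (wirtM h1 h2); rewrite mul0r add0r.
        set a' := (X in wirt _ _ _ X _); set b := (X in wirt _ _ _ _ X) => hF.
        exists a'; rewrite !ext0_in//.
        have -> : b1 c + b2 c = b by rewrite /b /b1 /b2; ring.
        have hF' := wirt_ext0 (@copen_half_disc R) Dc hF; exact: wirtS hF'.
      exists 0; rewrite !(ext0_out _ nDc) addr0.
      have [d d0 dP] := near_out Flo nDc.
      apply: (near_wirt (F := fun=> 0) d0) => //; last exact: wirt_cst.
      by move=> z Qz zc; rewrite dP.
    (* The left, right and top edges miss the half disc; on the bottom edge [h] vanishes. *)
    move=> z [/andP[z1 z2] /andP[z3 z4]] zb.
    have [Dz|nDz] := pselect (half_disc z); last by rewrite ext0_out.
    have [n1 x0] := Dz.
    have x1 : complex.Re z < 1 by apply: le_lt_trans n1; exact: le_trans (ler_norm _) (normRe_le _).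
    have y1 : complex.Im z < 1 by apply: le_lt_trans n1; exact: le_trans (ler_norm _) (normIm_le _).
    rewrite ext0_in// /F /hn.
    have [y0|y0] := eqVneq (complex.Im z) 0; first by rewrite h0// !mul0r.
    by exfalso; move: zb => /or4P[] /eqP; [lra|lra|move: y0 => /eqP|lra].
  have I1 := sint_integrable S0 C1 (square_measurable (-1 : R) 0 2) (@subset_refl _ _).
  have I2 := sint_integrable S0 C2 (square_measurable (-1 : R) 0 2) (@subset_refl _ _).
  have split12 : sint (ext0 half_disc b1) (-1) 0 2 + sint (ext0 half_disc b2) (-1) 0 2 = 0.
    have mQ : measurable (planar (square (-1 : R) 0 2)) by exact: square_measurable.
    have D := @RintegralD _ _ _ mu2 _ _ _ mQ I1 I2.
    rewrite -[RHS]green /sint; apply: (etrans (esym D)).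
    by apply: eq_Rintegral => p _; rewrite raddfD.
  have s1 : sint (ext0 half_disc b1) (-1) 0 2 = pi * complex.Re (h w).
    have := mean_value (@copen_half_disc R) r20 ballO rr hnhol.
    have -> : hn w = h w by rewrite /hn /H divff// expr1n mulr1.
    move=> <-; rewrite Rintegral_mkcond patch_ext0.
    have -> : ext0 half_disc (fun z => hn z * cutm (r ^+ 2) (z - w)) = ext0 half_disc b1.
      apply/funext => z; have [Dz|nDz] := pselect (half_disc z); last by rewrite !ext0_out.
      by rewrite !ext0_in// b1E.
    rewrite /sint [LHS]Rintegral_mkcond; congr Rintegral; apply/esym.
    apply: cre_square_support => z; have [Dz|nDz] := pselect (half_disc z); last by rewrite ext0_out ?eqxx.
    rewrite ext0_in// b1E mulf_eq0 negb_or => /andP[_ /(cutm_support r0) zr].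
    have [[n1 x0] y0 _] := rP z ltac:(move: zr; lra).
    have x1 : complex.Re z < 1 by apply: le_lt_trans n1; exact: le_trans (ler_norm _) (normRe_le _).
    have y1 : complex.Im z < 1 by apply: le_lt_trans n1; exact: le_trans (ler_norm _) (normIm_le _).
    by split; apply/andP; split; lra.
  have -> : pi * complex.Re (h w) = - sint (ext0 half_disc b2) (-1) 0 2 by move: split12; rewrite s1; lra.
  rewrite normrN -[sint _ _ _ _]subr0 -[X in _ - X](mul0r (4 : R)) -area4.
  apply: Rintegral_near_cst => //.
  - exact: square_measurable.
  - exact: measure_square_fin.
  move=> p /square_subc Qp; rewrite subr0; apply: le_trans (normRe_le _) _.
  set z := Complex p.1 p.2 in Qp *.
  have := KP z Qp; have [Dz|nDz] := pselect (half_disc z); last first.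
    rewrite !ext0_out// normc0 => K0; exact: mulr_ge0 (exprn_ge0 _ theta0) K0.
  rewrite !ext0_in// => Kz.
  have -> : b2 z = H n z * E z by rewrite /b2 /hn /E; ring.
  rewrite normcM.
  have [E0|E0] := eqVneq (E z) 0.
    rewrite E0 normc0 mulr0; apply: mulr_ge0; first exact: exprn_ge0.
    exact: le_trans (normc_ge0 _) Kz.
  apply: ler_pM; rewrite ?normc_ge0//.
  have Bz : normc (B z) <= c2.
    have [//|/ltW /W_hi[_ Wb0]] := leP; move: E0; by rewrite /E Wb0 mul0r mulr0 eqxx.
  have -> : normc (H n z) = (normc (B z) / beta) ^+ n.
    rewrite /H; elim: n {hn hnhol F b2 b1 b1E Flo b2lo b1lo b2c b1c C1 C2 green I1 I2 split12 s1} => [|n IH].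
      by rewrite !expr0 normc1.
    by rewrite !exprS normcM IH normcM normcV.
  apply: lerXn2r; rewrite ?nnegrE//; first by rewrite divr_ge0 ?normc_ge0 ?(ltW beta0).
  by rewrite /theta ler_pM2r ?invr_gt0.
have lim : (fun n => theta ^+ n * K * 4) @ \oo --> (0 : R).
  rewrite -[X in _ --> X](mul0r (4 : R)); apply: cvgM; last exact: cvg_cst.
  rewrite -[X in _ --> X](mul0r K); apply: cvgM; last exact: cvg_cst.
  by apply: cvg_expr; rewrite ger0_norm.
have near_main : \forall n \near \oo, `|pi * complex.Re (h w)| <= theta ^+ n * K * 4 by exact: nearW.
have := cvgr_to_ge lim near_main; rewrite normr_le0 mulf_eq0 gt_eqF ?pi_gt0//=.
by move=> /(_ _)/eqP; apply.
Qed.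

Lemma upper_vanish h : hol half_disc h ->
  (forall z, half_disc z -> complex.Im z = 0 -> h z = 0) -> h w = 0.
Proof.
move=> hh h0; have r := Re_vanish hh h0.
(* The real part of [i h] gives the imaginary part of [h]. *)
have hi : hol half_disc (fun z => 'i%C * h z) by apply: holM => //; exact: hol_cst.
have := Re_vanish hi (fun z Dz yz => etrans (congr1 _ (h0 z Dz yz)) (mulr0 _)).
move: r; case: (h w) => a b /= -> ; rewrite mul0r mul1r sub0r => /eqP; rewrite oppr_eq0 => /eqP ->.
by [].
Qed.

End UpperPoint.

End UniqueContinuation.

(** * Quaternions and slice derivatives *)

Section QuaternionModulus.
Variable R : realType.
Implicit Types (p q : quat R) (I J : quat R) (z : R[i]).

Lemma sqr_qnormE q : `|q| ^+ 2 = qre q ^+ 2 + qi q ^+ 2 + qj q ^+ 2 + qk q ^+ 2.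
Proof. by rewrite [LHS]sqr_sqrtr// sumsq_ge0. Qed.

Lemma qnormM p q : `|p * q| = `|p| * `|q|.
Proof.
apply/eqP; rewrite -(eqrXn2 (n := 2))// ?mulr_ge0//; apply/eqP.
rewrite exprMn !sqr_qnormE /=; ring.
Qed.

Lemma qnorm_conj q : `|qconj q| = `|q|.
Proof. by apply/eqP; rewrite -(eqrXn2 (n := 2))//; apply/eqP; rewrite !sqr_qnormE /=; ring. Qed.

Lemma qnorm1 : `|1 : quat R| = 1.
Proof. by apply/eqP; rewrite -(eqrXn2 (n := 2))//; apply/eqP; rewrite !sqr_qnormE /=; ring. Qed.

Lemma qcoord_le q : [/\ `|qre q| <= `|q|, `|qi q| <= `|q|, `|qj q| <= `|q| & `|qk q| <= `|q|].
Proof.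
have e x y : 0 <= y -> x ^+ 2 + y = `|q| ^+ 2 -> `|x| <= `|q|.
  move=> y0 xy; rewrite -(ler_sqr (normr_ge0 x) (normr_ge0 q)) real_normK ?num_real//; lra.
have := sqr_ge0 (qre q); have := sqr_ge0 (qi q); have := sqr_ge0 (qj q); have := sqr_ge0 (qk q).
move=> k0 j0 i0 r0; split.
- by apply: (e _ (qi q ^+ 2 + qj q ^+ 2 + qk q ^+ 2)); [lra | rewrite sqr_qnormE; lra].
- by apply: (e _ (qre q ^+ 2 + qj q ^+ 2 + qk q ^+ 2)); [lra | rewrite sqr_qnormE; lra].
- by apply: (e _ (qi q ^+ 2 + qre q ^+ 2 + qk q ^+ 2)); [lra | rewrite sqr_qnormE; lra].
- by apply: (e _ (qi q ^+ 2 + qj q ^+ 2 + qre q ^+ 2)); [lra | rewrite sqr_qnormE; lra].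
Qed.

Lemma slice_ptD I z w : slice_pt I (z + w) = slice_pt I z + slice_pt I w.
Proof. by case: z w => a b [c d]; rewrite /slice_pt /=; congr Quat => /=; ring. Qed.

Lemma slice_ptB I z w : slice_pt I (z - w) = slice_pt I z - slice_pt I w.
Proof. by case: z w => a b [c d]; rewrite /slice_pt /=; congr Quat => /=; ring. Qed.

Lemma slice_pt_real I (x : R) : slice_pt I (x%:C)%C = x%:A.
Proof. by rewrite /slice_pt /= scale0r mulr0 addr0. Qed.

Lemma imag_unit_coord I : imag_unit I ->
  qre I = 0 /\ qi I * qi I + qj I * qj I + qk I * qk I = 1.
Proof.
move=> Iu; have [I0 I1] := imag_unitP Iu; split=> //.
by have := congr1 (fun x => x ^+ 2) I1; rewrite sqr_qnormE I0 expr1n => <-; ring.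
Qed.

Lemma imag_unit_neq0 I : imag_unit I -> `|I| = 1.
Proof. by case/imag_unitP. Qed.

Lemma imag_unit_mul I : imag_unit I -> I * I = -1.
Proof. by rewrite /imag_unit /= expr2. Qed.

Lemma slice_ptM I z w : imag_unit I -> slice_pt I (z * w) = slice_pt I z * slice_pt I w.
Proof.
move=> /imag_unit_mul I2; case: z w => a b [c d]; rewrite /slice_pt /=.
rewrite mulrDl !mulrDr.
have -> : I * b%:A * (I * d%:A) = - (b * d)%:A.
  by rewrite -!scalerAr -!scalerAl !mulr1 I2 scalerA scalerN [b * d]mulrC.
by rewrite -!scalerAr -!scalerAl ?mulr1 ?mul1r !scalerA; congr Quat => /=; ring.
Qed.

Lemma norm_slice_pt I z : imag_unit I -> `|slice_pt I z| = normc z.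
Proof.
move=> /imag_unit_coord[I0 I1]; apply/eqP; rewrite -(eqrXn2 (n := 2))// ?normc_ge0//; apply/eqP.
rewrite sqr_normcE sqr_qnormE; case: z => a b /=; rewrite I0.
transitivity (a ^+ 2 + b ^+ 2 * (qi I * qi I + qj I * qj I + qk I * qk I)); first by ring.
by rewrite I1 mulr1.
Qed.

Lemma qre_slice_pt I z : imag_unit I -> qre (slice_pt I z) = complex.Re z.
Proof. by move=> /imag_unit_coord[I0 _] /=; rewrite I0; ring. Qed.

Lemma slice_coordD J p q : slice_coord J (p + q) = slice_coord J p + slice_coord J q.
Proof. by apply/eqP; rewrite eq_complex /=; apply/andP; split; apply/eqP; ring. Qed.

Lemma slice_coordB J p q : slice_coord J (p - q) = slice_coord J p - slice_coord J q.
Proof. by apply/eqP; rewrite eq_complex /=; apply/andP; split; apply/eqP; ring. Qed.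

Lemma slice_coordM J z q : imag_unit J -> slice_coord J (slice_pt J z * q) = z * slice_coord J q.
Proof.
move=> /imag_unit_coord[J0 J1]; case: z => a b; apply/eqP; rewrite eq_complex; apply/andP.
split; apply/eqP => /=; rewrite J0; first by ring.
transitivity (- a * (qre (J * q)) + b * qre q * (qi J * qi J + qj J * qj J + qk J * qk J)); first by rewrite /= J0; ring.
by rewrite J1 /= J0; ring.
Qed.

Lemma normc_slice_coord J q : imag_unit J -> normc (slice_coord J q) <= 2 * `|q|.
Proof.
move=> Ju; apply: (le_trans (normc_le_ReIm _)) => /=.
have [h1 _ _ _] := qcoord_le q; have [h2 _ _ _] := qcoord_le (J * q).
by move: h2; rewrite qnormM (imag_unit_neq0 Ju) mul1r normrN /= => h2; lra.
Qed.

Definition qbasis (n : 'I_4) : quat R :=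
  nth 0 [:: 1; Quat 0 1 0 0; Quat 0 0 1 0; Quat 0 0 0 1] n.

Lemma qbasis_norm n : `|qbasis n| = 1.
Proof.
apply/eqP; rewrite -(eqrXn2 (n := 2))// expr1n sqr_qnormE /qbasis; apply/eqP.
by case: n => -[|[|[|[|]]]]//= _; ring.
Qed.

Lemma sum_qre_qbasis q : \sum_(n < 4) qre (q * qbasis n) *: qconj (qbasis n) = q.
Proof.
by case: q => a b c d; rewrite !big_ord_recr big_ord0 /qbasis; congr Quat => /=; ring.
Qed.

(** Splits a quaternion into complex components in the plane of [I] without choosing a unit
    orthogonal to [I]. The four components are redundant: they sum to [q - I (I q) = 2 q], whence
    the factor one half. Right multiplication by the basis commutes with the left complex
    structure. *)
Lemma slice_coord_sum I q : imag_unit I ->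
  q = 2^-1 *: \sum_(n < 4) slice_pt I (slice_coord I (q * qbasis n)) * qconj (qbasis n).
Proof.
move=> Iu.
have -> : \sum_(n < 4) slice_pt I (slice_coord I (q * qbasis n)) * qconj (qbasis n) = q - I * (I * q).
  rewrite -[X in _ = X - _]sum_qre_qbasis -[X in _ = _ - I * X]sum_qre_qbasis mulr_sumr -sumrB.
  apply: eq_bigr => n _; rewrite -mulrA; move: (q * qbasis n) => p.
  have -> : slice_pt I (slice_coord I p) = (qre p)%:A - qre (I * p) *: I.
    by rewrite /slice_pt /slice_coord -scalerAr mulr1; move: (qre (I * p)) => y; rewrite -scaleNr.
  by rewrite mulrBl -!scalerAl mul1r -scalerAr.
rewrite mulrA imag_unit_mul// mulN1r opprK; move: q => [a b c d]; congr Quat => /=; lra.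
Qed.

Lemma slice_qball J : imag_unit J -> slice J qball = @disc R.
Proof. by move=> Ju; apply/seteqP; split=> z; rewrite /slice /qball /disc /= norm_slice_pt. Qed.

Lemma slice_qhalf_space J : imag_unit J -> slice J qhalf_space = @half_plane R.
Proof.
by move=> Ju; apply/seteqP; split=> z; rewrite /slice /qhalf_space /half_plane /preimage /mkset qre_slice_pt.
Qed.

Lemma slice_qhalf_ball J : imag_unit J -> slice J qhalf_ball = @half_disc R.
Proof.
move=> Ju; rewrite /slice /qhalf_ball preimage_setI.
have := slice_qball Ju; have := slice_qhalf_space Ju; rewrite /slice => -> ->.
by apply/seteqP; split.
Qed.

Lemma half_disc_conj (z : R[i]) : half_disc z -> half_disc z^*%C.
Proof. by case=> z1 z0; split; [rewrite normcJ' | case: z {z1} z0]. Qed.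

(** A real point lies on every slice; an arbitrary unit is taken there. *)
Definition slice_unit (q : quat R) : quat R :=
  if qim q == 0 then Quat 0 1 0 0 else `|qim q|^-1 *: qim q.

Definition slice_coord_of (q : quat R) : R[i] := Complex (qre q) `|qim q|.

Lemma slice_unitP q : imag_unit (slice_unit q).
Proof.
rewrite /imag_unit /slice_unit /= expr2; case: eqP => [_|/eqP q0]; first by congr Quat => /=; ring.
rewrite -scalerAl -scalerAr scalerA.
have -> : qim q * qim q = - (`|qim q| ^+ 2)%:A.
  by rewrite sqr_qnormE; congr Quat => /=; ring.
rewrite scalerN scalerA -invfM -expr2 mulVf ?scale1r//.
by rewrite expf_neq0// normr_eq0.
Qed.

Lemma slice_unitK q : slice_pt (slice_unit q) (slice_coord_of q) = q.
Proof.
rewrite /slice_pt /slice_unit /=; case: eqP => [q0|/eqP q0].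
  rewrite q0 normr0 scale0r mulr0 addr0.
  by case: q q0 => a b c d [-> -> ->]; congr Quat => /=; ring.
rewrite -scalerAr mulr1 scalerA mulfV ?normr_eq0// scale1r.
by case: q {q0} => a b c d; congr Quat => /=; ring.
Qed.

Lemma slice_coord_of_half_disc q : qhalf_ball q -> half_disc (slice_coord_of q).
Proof.
move=> hq; rewrite -(slice_qhalf_ball (slice_unitP q)) /slice /preimage /mkset slice_unitK //.
Qed.

End QuaternionModulus.

Section KernelIdentity.
Variable R : realType.

(** [ext] is additive in the function extended and evaluates it at a point and its conjugate, both
    in the half disc. *)
Lemma slice_kernelD (q r J : quat R) : qhalf_ball q -> qhalf_ball r ->
  imag_unit J -> slice_plane J r ->
  slice_kernel qhalf_ball J q r = slice_kernel qball J q r + slice_kernel qhalf_space J q r.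
Proof.
move=> hq hr Ju [w _ rw]; rewrite /slice_kernel -rw slice_coordK//.
rewrite slice_qhalf_ball// slice_qball// slice_qhalf_space//.
have hw : half_disc w by rewrite -(slice_qhalf_ball Ju) /slice /preimage /mkset rw.
have hz := slice_coord_of_half_disc hq; have hz' := half_disc_conj hz.
rewrite /ext -/(slice_coord_of q) !half_disc_bergman_kernel// !slice_ptD.
set a := slice_pt J _; set b := slice_pt J _; set c := slice_pt J _; set d := slice_pt J _.
set E := 2^-1 *: (_ * J).
rewrite [RHS]addrACA -scalerDr -mulrDr; congr (_ *: _ + _ * _); first by rewrite addrACA.
by rewrite opprD addrACA.
Qed.

End KernelIdentity.

(** * Quaternion-valued holomorphy on one slice *)

Section SliceDerivative.
Variable R : realType.
Implicit Types (D : set R[i]) (g : R[i] -> quat R) (I J a v : quat R) (c z : R[i]).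

(** The increment stands to the left of the derivative [v]: functions are holomorphic for left
    multiplication by [I], and right multiplication by quaternions preserves them. *)
Definition sder I D g c v := forall e : R, 0 < e ->
  exists2 d : R, 0 < d & forall z, D z -> normc (z - c) < d ->
    `|g z - g c - slice_pt I (z - c) * v| <= e * normc (z - c).

Definition shol I D g := forall c, D c -> exists v, sder I D g c v.

Lemma eq_shol I D g g' : (forall z, D z -> g z = g' z) -> shol I D g -> shol I D g'.
Proof.
move=> gg hg c Dc; have [v hv] := hg c Dc; exists v => e e0; have [d d0 hd] := hv e e0.
by exists d => // z Dz zc; rewrite -!gg//; exact: hd.
Qed.

Lemma sderD I D g g' c v v' : sder I D g c v -> sder I D g' c v' ->
  sder I D (fun z => g z + g' z) c (v + v').
Proof.
move=> hg hg' e e0; have e2 : 0 < e / 2 by rewrite divr_gt0.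
have [d d0 hd] := hg _ e2; have [d' d'0 hd'] := hg' _ e2.
exists (Num.min d d'); first by rewrite lt_min d0.
move=> z Dz; rewrite lt_min => /andP[/(hd z Dz) b1 /(hd' z Dz) b2].
rewrite mulrDr; have -> : g z + g' z - (g c + g' c) - (slice_pt I (z - c) * v + slice_pt I (z - c) * v')
  = (g z - g c - slice_pt I (z - c) * v) + (g' z - g' c - slice_pt I (z - c) * v').
  by rewrite !opprD [RHS]addrACA; congr (_ + _); rewrite addrACA.
by apply: (le_trans (ler_normD _ _)); lra.
Qed.

Lemma sderMr I D g c v a : sder I D g c v -> sder I D (fun z => g z * a) c (v * a).
Proof.
move=> hg e e0; have a1 : 0 < `|a| + 1 by rewrite ltr_wpDl.
have [d d0 hd] := hg _ (divr_gt0 e0 a1).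
exists d => // z Dz zc; rewrite mulrA -!mulrBl qnormM.
have := hd z Dz zc; move: (`|_ - _|) => u hu.
apply: (@le_trans _ _ (e / (`|a| + 1) * normc (z - c) * `|a|)); first by apply: ler_wpM2r.
rewrite mulrAC; apply: ler_wpM2r; first exact: normc_ge0.
by rewrite mulrAC ler_pdivrMr// ler_pM2l//; lra.
Qed.

Lemma sder_slice_pt I D h c b : imag_unit I -> wirt D h c b 0 ->
  sder I D (slice_pt I \o h) c (slice_pt I b).
Proof.
move=> Iu hw e e0; have [d d0 hd] := hw e e0; exists d => // z Dz zc.
have := hd z Dz zc; rewrite mul0r addr0 -(norm_slice_pt _ Iu).
by rewrite /comp !slice_ptB mulrC slice_ptM// slice_ptB.
Qed.

Lemma sholD I D g g' : shol I D g -> shol I D g' -> shol I D (fun z => g z + g' z).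
Proof.
by move=> hg hg' c Dc; have [v hv] := hg c Dc; have [v' hv'] := hg' c Dc; eexists; exact: sderD hv hv'.
Qed.

Lemma sholMr I D g a : shol I D g -> shol I D (fun z => g z * a).
Proof.
by move=> hg c Dc; have [v hv] := hg c Dc; eexists; exact: sderMr hv.
Qed.

Lemma shol0 I D : shol I D (fun=> 0).
Proof.
move=> c _; exists 0 => e e0; exists 1 => // z _ _.
by rewrite mulr0 !subr0 normr0 mulr_ge0 ?normc_ge0 ?ltW.
Qed.

Lemma shol_sum I D m (G : 'I_m -> R[i] -> quat R) : (forall n, shol I D (G n)) ->
  shol I D (fun z => \sum_(n < m) G n z).
Proof.
elim: m G => [|m IH] G hG.
  by apply: (@eq_shol _ _ (fun=> 0)); [move=> z _; rewrite big_ord0 | exact: shol0].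
apply: (@eq_shol _ _ (fun z => \sum_(n < m) G (widen_ord (leqnSn m) n) z + G ord_max z)).
  by move=> z _; rewrite big_ord_recr.
by apply: sholD; [exact: IH | exact: hG].
Qed.

Lemma hol_shol I D (h : 'I_4 -> R[i] -> R[i]) : imag_unit I -> (forall n, hol D (h n)) ->
  shol I D (fun z => 2^-1 *: \sum_(n < 4) slice_pt I (h n z) * qconj (qbasis R n)).
Proof.
move=> Iu hh; apply: (@eq_shol _ _ (fun z => (\sum_(n < 4) slice_pt I (h n z) * qconj (qbasis R n)) * (2^-1)%:A)).
  by move=> z _; rewrite -scalerAr mulr1.
apply/sholMr/shol_sum => n; apply: sholMr => c Dc; have [b hb] := hh n c Dc.
by eexists; exact: sder_slice_pt hb.
Qed.

Lemma shol_hol I D g a : imag_unit I -> shol I D g -> hol D (fun z => slice_coord I (g z * a)).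
Proof.
move=> Iu hg c Dc; have [v hv] := hg c Dc; exists (slice_coord I (v * a)) => e e0.
have e2 : 0 < e / 2 by rewrite divr_gt0.
have [d d0 hd] := sderMr a hv e2; exists d => // z Dz zc.
rewrite mul0r addr0 mulrC -slice_coordM// -!slice_coordB.
by apply: (le_trans (normc_slice_coord _ Iu)); have := hd z Dz zc; lra.
Qed.

(** The representation formula on the slice of [J], grouped by the two values of [g] that it
    uses. *)
Definition slice_mix I J g z : quat R :=
  2^-1 *: (1 - J * I) * g z + 2^-1 *: (1 + J * I) * g z^*%C.

Lemma ext_slice_mix I J g z : imag_unit J -> ext I g (slice_pt J z) = slice_mix I J g z.
Proof.
move=> Ju; case: z => x y; rewrite ext_slice// /slice_mix -!scalerAl -!scalerDr.
by congr (_ *: _); rewrite mulrBr mulrBl mulrDl !mul1r [RHS]addrACA; congr (_ + _); rewrite addrC.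
Qed.

Lemma slice_mix_norm I J : imag_unit I -> imag_unit J ->
  `|2^-1 *: (1 - J * I)| <= 1 /\ `|2^-1 *: (1 + J * I)| <= 1.
Proof.
move=> Iu Ju; have JI : `|J * I| = 1 by rewrite qnormM !imag_unit_neq0// mulr1.
rewrite !normrZ ger0_norm ?invr_ge0//.
have := @ler_normB _ (quat R) 1 (J * I); have := @ler_normD _ (quat R) 1 (J * I); rewrite qnorm1 JI; split; lra.
Qed.

(** With [P = (1 - J I) / 2] and [Q = (1 + J I) / 2] one has [P I = J P] and [- Q I = J Q]. So [P]
    transports derivatives from the slice of [I] to that of [J], and [Q] does so after
    conjugation. *)
Lemma slice_mix_intertwine I J z : imag_unit I -> imag_unit J ->
  2^-1 *: (1 - J * I) * slice_pt I z = slice_pt J z * (2^-1 *: (1 - J * I)) /\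
  2^-1 *: (1 + J * I) * slice_pt I z^*%C = slice_pt J z * (2^-1 *: (1 + J * I)).
Proof.
move=> Iu Ju; rewrite -!scalerAl -!scalerAr.
case: z => x y; rewrite /slice_pt /= -!scalerAr !mulr1.
split; congr (_ *: _).
  rewrite [LHS]mulrDr [RHS]mulrDl -!scalerAl -!scalerAr !mul1r !mulr1; congr (_ + _ *: _).
  by rewrite mulrBl mul1r -mulrA imag_unit_mul// mulrN1 opprK mulrBr mulr1 mulrA imag_unit_mul// mulN1r opprK addrC.
rewrite [LHS]mulrDr [RHS]mulrDl -!scalerAl -!scalerAr !mul1r !mulr1; congr (_ + _).
rewrite scaleNr -scalerN; congr (_ *: _).
by rewrite mulrDl mul1r -mulrA imag_unit_mul// mulrN1 mulrDr mulr1 mulrA imag_unit_mul// mulN1r opprB addrC.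
Qed.

Lemma slice_mix_le I J g c z v v' (B B' : R) : imag_unit I -> imag_unit J ->
  `|g z - g c - slice_pt I (z - c) * v| <= B ->
  `|g z^*%C - g c^*%C - slice_pt I (z - c)^*%C * v'| <= B' ->
  `|slice_mix I J g z - slice_mix I J g c -
    slice_pt J (z - c) * (2^-1 *: (1 - J * I) * v + 2^-1 *: (1 + J * I) * v')| <= B + B'.
Proof.
move=> Iu Ju b1 b2.
have [i1 i2] := slice_mix_intertwine (z - c) Iu Ju; have [n1 n2] := slice_mix_norm Iu Ju.
rewrite /slice_mix; move: i1 i2 n1 n2; set P := 2^-1 *: _; set Q := 2^-1 *: _ => i1 i2 n1 n2.
have -> : P * g z + Q * g z^*%C - (P * g c + Q * g c^*%C) - slice_pt J (z - c) * (P * v + Q * v') =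
  P * (g z - g c - slice_pt I (z - c) * v) + Q * (g z^*%C - g c^*%C - slice_pt I (z - c)^*%C * v').
  rewrite mulrDr !mulrA -i1 -i2 !(mulrBr, opprD, mulrA).
  by rewrite [RHS]addrACA; congr (_ + _); rewrite addrACA.
apply: (le_trans (ler_normD _ _)); rewrite !qnormM; apply: lerD.
  by apply: le_trans b1; rewrite ler_piMl.
by apply: le_trans b2; rewrite ler_piMl.
Qed.

Lemma sder_mix I J D g c v v' : imag_unit I -> imag_unit J -> (forall z, D z -> D z^*%C) ->
  sder I D g c v -> sder I D g c^*%C v' ->
  sder J D (slice_mix I J g) c (2^-1 *: (1 - J * I) * v + 2^-1 *: (1 + J * I) * v').
Proof.
move=> Iu Ju DJ hv hv' e e0; have e2 : 0 < e / 2 by rewrite divr_gt0.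
have [d d0 hd] := hv _ e2; have [d' d'0 hd'] := hv' _ e2.
exists (Num.min d d'); first by rewrite lt_min d0.
move=> z Dz; rewrite lt_min => /andP[/(hd z Dz) b1 b2].
have := hd' _ (DJ z Dz); rewrite -conjcB normcJ' => /(_ b2) {}b2.
by apply: (le_trans (slice_mix_le Iu Ju b1 b2)); rewrite -mulrDl -splitr.
Qed.

Lemma shol_mix I J D g : imag_unit I -> imag_unit J -> (forall z, D z -> D z^*%C) ->
  shol I D g -> shol J D (slice_mix I J g).
Proof.
move=> Iu Ju DJ hg c Dc; have [v hv] := hg c Dc; have [v' hv'] := hg _ (DJ c Dc).
by eexists; exact: sder_mix hv hv'.
Qed.

Lemma slice_coord_inj0 I p : imag_unit I -> (forall a, slice_coord I (p * a) = 0) -> p = 0.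
Proof.
move=> Iu p0; rewrite (slice_coord_sum p Iu) big1 ?scaler0// => n _; rewrite p0.
by rewrite (slice_pt_real I 0) scale0r mul0r.
Qed.

(** Each complex component of [(g - g') a] vanishes on the real segment. Points with positive
    imaginary part suffice, since [slice_coord_of] never has a negative one. *)
Lemma shol_unique J g g' : imag_unit J -> shol J half_disc g -> shol J half_disc g' ->
  (forall z, half_disc z -> complex.Im z = 0 -> g z = g' z) ->
  forall z, half_disc z -> 0 < complex.Im z -> g z = g' z.
Proof.
move=> Ju hg hg' gg z Dz z0; apply/subr0_eq/(slice_coord_inj0 Ju) => a.
apply: (@upper_vanish _ z Dz z0 (fun z => slice_coord J ((g z - g' z) * a))).
  apply: shol_hol => //; apply: (@eq_shol _ _ (fun z => g z + g' z * (-1))).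
    by move=> x _; rewrite mulrN1.
  by apply: sholD => //; exact: sholMr.
move=> x Dx x0; rewrite gg// subrr mul0r; apply/eqP; rewrite eq_complex /=.
by apply/andP; split; apply/eqP; ring.
Qed.

End SliceDerivative.

Section EpsilonDifferential.
Variables (R : realType) (V W : normedModType R).
Implicit Types (f : V -> W) (L : V -> W) (x h : V).

Lemma near0_norm (P : set V) : (\forall h \near (0 : V), P h) <->
  exists2 d : R, 0 < d & forall h, `|h| < d -> P h.
Proof.
split=> [/nbhs_normP[d d0 hd]|[d d0 hd]].
  by exists d => // h hh; apply: hd; rewrite /= sub0r normrN.
by apply/nbhs_normP; exists d => // h; rewrite /= sub0r normrN; exact: hd.
Qed.

Lemma diff_eps f x : differentiable f x -> forall e : R, 0 < e ->
  exists2 d : R, 0 < d & forall h, `|h| < d -> `|f (x + h) - f x - 'd f x h| <= e * `|h|.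
Proof.
move=> /diff_locallyP[_ /eqaddoP fo] e e0.
have /near0_norm[d d0 hd] := fo e e0; exists d => // h /hd.
by rewrite /= -[(_ - _) h]/(f (h + x) - (f x + 'd f x h)) opprD addrA [h + x]addrC.
Qed.

(** [differentiable] refers to the canonical differential; the bound makes [L] continuous, and the
    expansion then identifies it with that differential. *)
Lemma eps_diff f x L K : linear L -> (forall v, `|L v| <= K * `|v|) ->
  (forall e : R, 0 < e -> exists2 d : R, 0 < d &
     forall h, `|h| < d -> `|f (x + h) - f x - L h| <= e * `|h|) ->
  differentiable f x.
Proof.
move=> Llin LK fL; pose LM := GRing.isLinear.Build _ _ _ _ _ Llin.
pose LL : {linear V -> W} := HB.pack L LM.
have Lc : continuous LL.
  move=> v; apply/cvgrPdist_le => e e0; rewrite near_map.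
  have K1 : 0 < `|K| + 1 by rewrite ltr_wpDl.
  apply/nbhs_normP; exists (e / (`|K| + 1)); first by rewrite /= divr_gt0.
  move=> u /= uv; rewrite -[L v - L u]/(LL v - LL u) -linearB; apply: (le_trans (LK _)).
  rewrite ltr_pdivlMr// in uv; apply: (le_trans _ (ltW uv)); rewrite mulrC ler_wpM2l//.
  by apply: (le_trans (ler_norm _)); rewrite lerDl.
have Lo : f \o shift x = cst (f x) + LL +o_ 0 id.
  apply/eqaddoP => e e0; apply/near0_norm; have [d d0 hd] := fL e e0; exists d => // h /hd.
  by rewrite /= -[(_ - _) h]/(f (h + x) - (f x + L h)) opprD addrA [h + x]addrC.
by apply/diff_locallyP; rewrite (diff_unique Lc Lo).
Qed.

Lemma linear_bound_diff L K x : linear L -> (forall v, `|L v| <= K * `|v|) -> differentiable L x.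
Proof.
move=> Llin LK; apply: (eps_diff Llin LK) => e e0; exists 1 => // h _.
have -> : L (x + h) = L x + L h by have := Llin 1 x h; rewrite !scale1r.
by rewrite [L x + L h]addrC addrK subrr normr0 mulr_ge0 ?(ltW e0).
Qed.

Lemma diff_bound f x : differentiable f x -> exists K, 0 < K /\ forall v, `|'d f x v| <= K * `|v|.
Proof.
by move=> /diff_continuous/linear_lipschitz[K K0 hK]; exists K.
Qed.

End EpsilonDifferential.

Section Derive1.
Variables (R : realType) (W : normedModType R).

Lemma derive1_eps (u : R -> W) x l : (forall e : R, 0 < e -> exists2 d : R, 0 < d &
   forall h, `|h| < d -> `|u (x + h) - u x - h *: l| <= e * `|h|) -> derive1 u x = l.
Proof.
move=> hu; apply: cvg_lim; first exact: norm_hausdorff.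
apply/cvgrPdist_le => e e0; have [d d0 hd] := hu e e0.
rewrite near_withinE; apply/(@nbhs_normP _ R^o); exists d => // h.
rewrite /= sub0r normrN => hh h0.
have h1 : 0 < `|h| by rewrite normr_gt0.
rewrite -(ler_pM2l h1) -normrZ scalerBr scalerA mulfV// scale1r distrC mulrC [h + x]addrC.
exact: hd.
Qed.

End Derive1.

Section QuaternionDifferential.
Variables (R : realType) (V : normedModType R).
Implicit Types (f g : V -> quat R) (x : V).

Lemma qmulBB (a b c p q r : quat R) :
  a * b - p * q - (c * q + p * r) = (a - p - c) * q + p * (b - q - r) + (a - p) * (b - q).
Proof.
case: a b c p q r => a1 a2 a3 a4 [b1 b2 b3 b4] [c1 c2 c3 c4] [p1 p2 p3 p4] [q1 q2 q3 q4] [r1 r2 r3 r4].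
by congr Quat => /=; ring.
Qed.

Lemma qmul_linear (L M : {linear V -> quat R}) (p q : quat R) :
  linear (fun v => L v * q + p * M v).
Proof. by move=> a u v; rewrite !linearP mulrDl mulrDr -scalerAl -scalerAr addrACA -scalerDr. Qed.

Lemma differentiable_qmul f g x : differentiable f x -> differentiable g x ->
  differentiable (fun y => f y * g y) x.
Proof.
move=> df dg; have [Kf [Kf0 hKf]] := diff_bound df; have [Kg [Kg0 hKg]] := diff_bound dg.
apply: (@eps_diff _ _ _ _ _ (fun v => 'd f x v * g x + f x * 'd g x v) (Kf * `|g x| + `|f x| * Kg)).
- exact: (qmul_linear ('d f x) ('d g x)).
- move=> v; apply: (le_trans (ler_normD _ _)); rewrite !qnormM mulrDl; apply: lerD.
    by rewrite mulrAC; exact: (ler_wpM2r (normr_ge0 _) (hKf v)).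
  by rewrite -mulrA; exact: (ler_wpM2l (normr_ge0 _) (hKg v)).
move=> e e0; pose M := `|f x| + `|g x| + Kg + 1.
have M0 : 0 < M by rewrite /M ltr_wpDl// !addr_ge0// ltW.
pose e1 := Num.min 1 (e / (4 * M)).
have e10 : 0 < e1 by rewrite lt_min ltr01 divr_gt0// mulr_gt0.
have [d d0 hd] := diff_eps df e10; have [d' d'0 hd'] := diff_eps dg e10.
pose d'' := e / (4 * (Kf + 1) * (Kg + 1)).
have d''0 : 0 < d'' by rewrite divr_gt0// !mulr_gt0// ltr_wpDl// ltW.
exists (Num.min d (Num.min d' d'')); first by rewrite !lt_min d0 d'0.
move=> h; rewrite !lt_min => /and3P[/hd b1 /hd' b2 hh].
rewrite (qmulBB (f (x + h)) (g (x + h)) ('d f x h) (f x) (g x) ('d g x h)).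
have lf : `|f (x + h) - f x| <= (Kf + 1) * `|h|.
  rewrite -[f (x + h) - f x](subrK ('d f x h)); apply: (le_trans (ler_normD _ _)).
  apply: (le_trans (lerD b1 (hKf h))); rewrite -mulrDl ler_wpM2r//.
  by rewrite addrC lerD2l ge_min lexx.
have lg : `|g (x + h) - g x| <= (Kg + 1) * `|h|.
  rewrite -[g (x + h) - g x](subrK ('d g x h)); apply: (le_trans (ler_normD _ _)).
  apply: (le_trans (lerD b2 (hKg h))); rewrite -mulrDl ler_wpM2r//.
  by rewrite addrC lerD2l ge_min lexx.
have t3 : `|(f (x + h) - f x) * (g (x + h) - g x)| <= e / 4 * `|h|.
  rewrite qnormM; apply: (@le_trans _ _ ((Kf + 1) * `|h| * ((Kg + 1) * `|h|))); first exact: (ler_pM (normr_ge0 _) (normr_ge0 _) lf lg).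
  rewrite mulrA; apply: ler_wpM2r => //.
  move: hh; rewrite /d'' ltr_pdivlMr; last by rewrite !mulr_gt0// ltr_wpDl// ltW.
  by move=> hh; rewrite ler_pdivlMr//; apply/ltW; move: hh; congr (_ < _); ring.
have eM : e1 * M <= e / 4.
  apply: (@le_trans _ _ (e / (4 * M) * M)); first by apply: ler_wpM2r; [exact: ltW | rewrite ge_min lexx orbT].
  by rewrite invfM mulrA divfK// gt_eqF.
have fM : `|f x| <= M by rewrite /M -!addrA lerDl !addr_ge0// ltW.
have gM : `|g x| <= M by rewrite /M [`|f x| + _]addrC -!addrA lerDl !addr_ge0// ltW.
have t1 : `|(f (x + h) - f x - 'd f x h) * g x| <= e / 4 * `|h|.
  rewrite qnormM; apply: (@le_trans _ _ (e1 * `|h| * M)).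
    exact: (ler_pM (normr_ge0 _) (normr_ge0 _) b1 gM).
  by rewrite mulrAC; apply: ler_wpM2r.
have t2 : `|f x * (g (x + h) - g x - 'd g x h)| <= e / 4 * `|h|.
  rewrite qnormM; apply: (@le_trans _ _ (M * (e1 * `|h|))).
    exact: (ler_pM (normr_ge0 _) (normr_ge0 _) fM b2).
  by rewrite mulrA; apply: ler_wpM2r => //; rewrite mulrC.
apply: (le_trans (ler_normD _ _)).
apply: (le_trans (lerD (ler_normD _ _) t3)); apply: (le_trans (lerD (lerD t1 t2) (lexx _))).
rewrite -!mulrDl ler_wpM2r//; move: e0; clear; lra.
Qed.

Lemma differentiable_real (k : V -> R) x : differentiable k x -> differentiable (fun y => (k y)%:A : quat R) x.
Proof. exact: differentiableZl. Qed.

End QuaternionDifferential.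

(** * Differentiability of the extension and the representation formula *)

Section ExtensionDifferentiable.
Variable R : realType.
Implicit Types (D : set R[i]) (g : R[i] -> quat R) (I : quat R) (c : R[i]) (q p : quat R).

Lemma sder_diff I D g c v : imag_unit I -> copen D -> D c -> sder I D g c v ->
  differentiable (fun p => g (slice_coord I p)) (slice_pt I c).
Proof.
move=> Iu oD Dc hv.
apply: (@eps_diff _ _ _ _ _ (fun h => slice_pt I (slice_coord I h) * v) (2 * `|v|)).
- move=> a x y; rewrite scalerAl -mulrDl; congr (_ * _).
  by case: I {hv Iu} => i0 i1 i2 i3; case: x y => [x0 x1 x2 x3] [y0 y1 y2 y3]; congr Quat => /=; ring.
- move=> h; rewrite qnormM norm_slice_pt// mulrAC; apply: ler_wpM2r => //.
  exact: normc_slice_coord.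
move=> e e0; have e2 : 0 < e / 2 by rewrite divr_gt0.
have [d d0 hd] := hv _ e2; have [d' d'0 hd'] := oD _ Dc.
exists (Num.min (d / 2) (d' / 2)); first by rewrite lt_min !divr_gt0.
move=> h; rewrite lt_min => /andP[h1 h2].
have nh := normc_slice_coord h Iu.
rewrite slice_coordD slice_coordK//.
have ch : c + slice_coord I h - c = slice_coord I h by rewrite [c + _]addrC addrK.
have := hd (c + slice_coord I h); rewrite ch => /(_ _ _)/le_trans; apply.
- by apply: hd'; rewrite ch; move: nh h2; clear; lra.
- by move: nh h1; clear; lra.
by rewrite -mulrA; apply: ler_wpM2l; [exact: ltW | rewrite ler_pdivrMl// ].
Qed.

Lemma coord_diff q : [/\ differentiable (@qre R) q, differentiable (@qi R) q,
  differentiable (@qj R) q & differentiable (@qk R) q].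
Proof.
by split; apply: (@linear_bound_diff _ _ _ _ 1) => // v; rewrite mul1r; have [] := qcoord_le v.
Qed.

Lemma qim_diff q : differentiable (@qim R) q.
Proof.
apply: (@linear_bound_diff _ _ _ _ 1) => [a x y|v].
  by congr Quat => /=; ring.
rewrite mul1r -(@ler_pXn2r _ 2)// ?nnegrE// !sqr_qnormE /= expr0n /= add0r.
by rewrite -!addrA lerDr sqr_ge0.
Qed.

Lemma norm_qim_diff q : qim q != 0 -> differentiable (fun p => `|qim p| : R) q.
Proof.
move=> q0; pose s p := qi p * qi p + qj p * qj p + qk p * qk p.
have sE p : `|qim p| ^+ 2 = s p by rewrite sqr_qnormE /s /=; ring.
have -> : (fun p => `|qim p| : R) = Num.sqrt \o s.
  by apply/funext => p; rewrite /comp -sE sqrtr_sqr ger0_norm.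
have [_ di dj dk] := coord_diff q; apply: differentiable_comp.
  by apply: differentiableD; first apply: differentiableD; exact: differentiableM.
apply/derivable1_diffP; suff : 0 < s q by move=> /is_derive1_sqrt[].
by rewrite -sE exprn_gt0// normr_gt0.
Qed.

Lemma ext_diff_nonreal I D g q : imag_unit I -> copen D -> (forall z, D z -> D z^*%C) ->
  shol I D g -> qim q != 0 -> D (slice_coord_of q) -> differentiable (ext I g) q.
Proof.
move=> Iu oD DJ hg q0 Dq; pose z p := slice_coord_of p.
pose A p := g (slice_coord I (slice_pt I (z p))).
pose B p := g (slice_coord I (slice_pt I (z p)^*%C)).
have -> : ext I g = fun p => (2^-1)%:A * (A p + B p) +
    (2^-1)%:A * (((`|qim p|^-1)%:A * qim p) * I * (B p - A p)).
  apply/funext => p; rewrite /ext /A /B !slice_coordK// /z /slice_coord_of.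
  by rewrite -!scalerAl !mul1r.
have dN := norm_qim_diff q0.
have [dre _ _ _] := coord_diff q.
have dq (a : quat R) : differentiable (fun=> a) q by exact: differentiable_cst.
have dA : differentiable A q.
  have [v hv] := hg _ Dq.
  apply: (@differentiable_comp _ _ _ _ (fun p => slice_pt I (z p)) (fun p => g (slice_coord I p))).
    apply: differentiableD; first exact: differentiable_real.
    by apply: differentiable_qmul => //; exact: differentiable_real.
  exact: (sder_diff Iu oD _ hv).
have dB : differentiable B q.
  have [v hv] := hg _ (DJ _ Dq).
  apply: (@differentiable_comp _ _ _ _ (fun p => slice_pt I (z p)^*%C) (fun p => g (slice_coord I p))).
    apply: differentiableD; first exact: differentiable_real.
    by apply: differentiable_qmul => //; apply: differentiable_real; exact: differentiableN.
  by apply: (sder_diff Iu oD _ hv); exact: DJ.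
apply: differentiableD.
  by apply: differentiable_qmul => //; exact: differentiableD.
apply: differentiable_qmul => //; apply: differentiable_qmul; last exact: differentiableB.
apply: differentiable_qmul => //; apply: differentiable_qmul; last exact: qim_diff.
by apply: differentiable_real; apply: differentiableV => //; rewrite normr_eq0.
Qed.

(** The unit of [Im q] has no limit at a real point, so [ext] is not differentiated as a
    composition. Each [q + h] lies on its own slice [J]; since the coordinate of [q] is its own
    conjugate, both derivatives there are [v] and the mixing factors sum to 1. The remainder bound
    is uniform in [J], so the differential is [h * v]. *)
Lemma ext_diff_real I D g q : imag_unit I -> copen D -> (forall z, D z -> D z^*%C) ->
  shol I D g -> qim q = 0 -> D (slice_coord_of q) -> differentiable (ext I g) q.
Proof.
move=> Iu oD DJ hg q0 Dq; set c := slice_coord_of q.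
have cc : c^*%C = c by rewrite /c /slice_coord_of q0 normr0 /= oppr0.
have cq J : slice_pt J c = q.
  by rewrite /c /slice_coord_of q0 normr0 (slice_pt_real J (qre q)); case: q q0 {Dq c cc} => a b c d [-> -> ->]; congr Quat => /=; ring.
have [v hv] := hg _ Dq.
apply: (@eps_diff R (quat R) (quat R) (ext I g) q (fun h : quat R => h * v : quat R) (`|v|)).
- by move=> a x y; rewrite mulrDl -scalerAl.
- by move=> h; rewrite qnormM mulrC.
move=> e e0; have e2 : 0 < e / 2 by rewrite divr_gt0.
have [d d0 hd] := hv _ e2; have [d' d'0 hd'] := oD _ Dq.
exists (Num.min d d'); first by rewrite lt_min d0.
move=> h; rewrite lt_min => /andP[h1 h2].
set J := slice_unit (q + h); have Ju : imag_unit J by exact: slice_unitP.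
set z := slice_coord_of (q + h); have zq : slice_pt J z = q + h by exact: slice_unitK.
have zc : slice_pt J (z - c) = h by rewrite slice_ptB zq cq [q + h]addrC addrK.
have nz : normc (z - c) = `|h| by rewrite -(norm_slice_pt _ Ju) zc.
have VE : 2^-1 *: (1 - J * I) * v + 2^-1 *: (1 + J * I) * v = v.
  rewrite -mulrDl -scalerDr addrACA addNr addr0.
  have -> : 2^-1 *: (1 + 1) = 1 :> quat R by congr Quat => /=; lra.
  by rewrite mul1r.
have extc : ext I g q = slice_mix I J g c by rewrite -(ext_slice_mix I g c Ju) cq.
have extz : ext I g (q + h) = slice_mix I J g z by rewrite -(ext_slice_mix I g z Ju) zq.
have Dz : D z by apply: hd'; rewrite nz.
have b1 := hd z Dz; have b2 := hd _ (DJ z Dz).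
rewrite extc extz -[X in X * v]zc -[X in _ * X]VE.
rewrite nz in b1; have {}b1 := b1 h1.
have zJ : normc (z^*%C - c) = `|h| by rewrite -[X in _ - X]cc -conjcB normcJ'.
rewrite zJ in b2; have {}b2 := b2 h1.
have {}b2 : `|g z^*%C - g c^*%C - slice_pt I (z - c)^*%C * v| <= e / 2 * `|h| by rewrite conjcB cc.
by apply: (le_trans (slice_mix_le Iu Ju b1 b2)); rewrite -mulrDl -splitr.
Qed.

Lemma shol_derive1 J D g x y : imag_unit J -> copen D -> D (Complex x y) -> shol J D g ->
  derive1 (fun t => g (Complex t y)) x + J * derive1 (fun t => g (Complex x t)) y = 0.
Proof.
move=> Ju oD Dc hg; have [v hv] := hg _ Dc; have [d' d'0 hd'] := oD _ Dc.
have -> : derive1 (fun t => g (Complex t y)) x = v.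
  apply: derive1_eps => e e0; have [d d0 hd] := hv e e0.
  exists (Num.min d d'); first by rewrite lt_min d0.
  move=> h; rewrite lt_min => /andP[h1 h2].
  have e1 : Complex (x + h) y - Complex x y = (h%:C)%C.
    by apply/eqP; rewrite eq_complex /=; apply/andP; split; apply/eqP; ring.
  have := hd (Complex (x + h) y); rewrite e1 normc_real slice_pt_real -scalerAl mul1r; apply => //.
  by apply: hd'; rewrite e1 normc_real.
have -> : derive1 (fun t => g (Complex x t)) y = J * v.
  apply: derive1_eps => e e0; have [d d0 hd] := hv e e0.
  exists (Num.min d d'); first by rewrite lt_min d0.
  move=> h; rewrite lt_min => /andP[h1 h2].
  have e1 : Complex x (y + h) - Complex x y = Complex 0 h.
    by apply/eqP; rewrite eq_complex /=; apply/andP; split; apply/eqP; ring.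
  have nh : normc (Complex 0 h) = `|h| by rewrite /normc expr0n add0r sqrtr_sqr.
  have := hd (Complex x (y + h)); rewrite e1 nh.
  have -> : slice_pt J (Complex 0 h) = h *: J by rewrite /slice_pt /= scale0r add0r -scalerAr mulr1.
  rewrite -scalerAl; apply => //.
  by apply: hd'; rewrite e1 nh.
by rewrite mulrA imag_unit_mul// mulN1r subrr.
Qed.

Lemma ext_slice_hyperholomorphic I g : imag_unit I -> shol I half_disc g ->
  slice_hyperholomorphic qhalf_ball (ext I g).
Proof.
move=> Iu hg; have oD := @copen_half_disc R; split=> [q /slice_coord_of_half_disc Dq|J x y Ju UJ].
  have [q0|/eqP q0] := eqVneq (qim q) 0.
    exact: (ext_diff_real Iu oD (@half_disc_conj R) hg).
  by apply: (ext_diff_nonreal Iu oD (@half_disc_conj R) hg) => //; apply/eqP.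
have Dxy : half_disc (Complex x y) by rewrite -(slice_qhalf_ball Ju).
have -> : (fun t => ext I g (slice_pt J (Complex t y))) = (fun t => slice_mix I J g (Complex t y)).
  by apply/funext => t; rewrite ext_slice_mix.
have -> : (fun t => ext I g (slice_pt J (Complex x t))) = (fun t => slice_mix I J g (Complex x t)).
  by apply/funext => t; rewrite ext_slice_mix.
exact: (shol_derive1 Ju oD Dxy (shol_mix Iu Ju (@half_disc_conj R) hg)).
Qed.

Lemma slice_hyperholomorphic_shol J (f : quat R -> quat R) : imag_unit J ->
  slice_hyperholomorphic qhalf_ball f -> shol J half_disc (fun z => f (slice_pt J z)).
Proof.
move=> Ju [df CR] [x y] Dc; set q := slice_pt J (Complex x y).
have Uq : qhalf_ball q by move: Dc; rewrite -(slice_qhalf_ball Ju).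
have d := df _ Uq; exists ('d f q 1).
have der (u : R -> quat R) t w : (forall h, u (t + h) = q + h *: w) -> `|w| = 1 ->
    derive1 (f \o u) t = 'd f q w.
  move=> hu w1; apply: derive1_eps => e e0; have [r r0 hr] := diff_eps d e0.
  exists r => // h hh; have := hr (h *: w); rewrite normrZ w1 mulr1 => /(_ hh).
  by rewrite /comp hu -[X in u X]addr0 hu scale0r addr0 linearZ.
have := CR J x y Ju Uq; rewrite -/q.
rewrite (der (fun t => slice_pt J (Complex t y)) x 1); last 2 first.
- by move=> h; rewrite /q /slice_pt /= scalerDl addrAC.
- exact: qnorm1.
rewrite (der (fun t => slice_pt J (Complex x t)) y J); last 2 first.
- by move=> h; rewrite /q /slice_pt /= scalerDl mulrDr addrA -!scalerAr !mulr1.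
- exact: imag_unit_neq0.
(* The Cauchy-Riemann equation multiplied by [J]: the real differential, restricted to the slice, is
   left multiplication followed by a fixed quaternion. *)
move=> CRq; have dJ : 'd f q J = J * 'd f q 1.
  have := congr1 ( *%R J) CRq; rewrite mulr0 mulrDr mulrA imag_unit_mul// mulN1r.
  by move/subr0_eq.
move=> e e0; have [r r0 hr] := diff_eps d e0; exists r => // z _ zr.
have := hr (slice_pt J (z - Complex x y)); rewrite norm_slice_pt// => /(_ zr).
have -> : 'd f q (slice_pt J (z - Complex x y)) = slice_pt J (z - Complex x y) * 'd f q 1.
  move: (z - Complex x y) => w; rewrite /slice_pt linearD -scalerAr mulr1 !linearZ.
  by rewrite mulrDl -!scalerAl mul1r dJ.
by have -> : q + slice_pt J (z - Complex x y) = slice_pt J z by rewrite slice_ptB addrC subrK.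
Qed.

(** On the slice through [q], both [f] and the extension of its restriction to the slice of [I] are
    holomorphic, and they agree on the real segment that the two slices share. *)
Lemma slice_hyperholomorphic_ext I (f : quat R -> quat R) q : imag_unit I ->
  slice_hyperholomorphic qhalf_ball f -> qhalf_ball q ->
  f q = ext I (fun z => f (slice_pt I z)) q.
Proof.
move=> Iu hf Uq; have Ju := slice_unitP q; have Dz := slice_coord_of_half_disc Uq.
move: Ju Dz (slice_unitK q); set J := slice_unit q; set z := slice_coord_of q => Ju Dz zq.
rewrite -zq ext_slice_mix//.
have re (x : R[i]) : half_disc x -> complex.Im x = 0 -> f (slice_pt J x) = slice_mix I J (fun z => f (slice_pt I z)) x.
  case: x => x y _ /= ->; rewrite /slice_mix /= oppr0 -mulrDl -scalerDr addrACA addNr addr0.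
  have -> : 2^-1 *: (1 + 1) = 1 :> quat R by congr Quat => /=; lra.
  by rewrite mul1r !(slice_pt_real _ x).
have [z0|z0] := leP (complex.Im z) 0.
  apply: re => //; apply/eqP; rewrite eq_le z0 /=; exact: normr_ge0.
apply: (@shol_unique _ J (fun z => f (slice_pt J z)) (slice_mix I J (fun z => f (slice_pt I z))) Ju) => //.
  exact: slice_hyperholomorphic_shol.
by apply: shol_mix => //; [exact: half_disc_conj | exact: slice_hyperholomorphic_shol].
Qed.

End ExtensionDifferentiable.

Section SliceHyperholomorphicClosure.
Variable R : realType.
Implicit Types (f g : quat R -> quat R) (I J a q : quat R).

Lemma slice_hyperholomorphicP f : slice_hyperholomorphic qhalf_ball f <->
  (forall q, qhalf_ball q -> differentiable f q) /\
  (forall J, imag_unit J -> shol J half_disc (fun z => f (slice_pt J z))).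
Proof.
split=> [hf|[df hf]].
  by split=> [|J Ju]; [case: hf | exact: slice_hyperholomorphic_shol].
split=> // J x y Ju UJ; have oD := @copen_half_disc R.
have Dxy : half_disc (Complex x y) by rewrite -(slice_qhalf_ball Ju).
exact: (shol_derive1 Ju oD Dxy (hf J Ju)).
Qed.

Lemma slice_hyperholomorphicD f g : slice_hyperholomorphic qhalf_ball f ->
  slice_hyperholomorphic qhalf_ball g -> slice_hyperholomorphic qhalf_ball (f \+ g).
Proof.
move=> /slice_hyperholomorphicP[df hf] /slice_hyperholomorphicP[dg hg].
apply/slice_hyperholomorphicP; split=> [q Uq|J Ju].
  by apply: differentiableD; [exact: df | exact: dg].
by apply: sholD; [exact: hf | exact: hg].
Qed.

Lemma slice_hyperholomorphicMr f a : slice_hyperholomorphic qhalf_ball f ->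
  slice_hyperholomorphic qhalf_ball (fun q => f q * a).
Proof.
move=> /slice_hyperholomorphicP[df hf]; apply/slice_hyperholomorphicP; split=> [q Uq|J Ju].
  by apply: differentiable_qmul; [exact: df | exact: differentiable_cst].
by apply: sholMr; exact: hf.
Qed.

Lemma slice_hyperholomorphicB f g : slice_hyperholomorphic qhalf_ball f ->
  slice_hyperholomorphic qhalf_ball g -> slice_hyperholomorphic qhalf_ball (f \- g).
Proof.
move=> hf hg; have := slice_hyperholomorphicD hf (slice_hyperholomorphicMr (-1) hg).
by congr slice_hyperholomorphic; apply/funext => q /=; rewrite mulrN1.
Qed.

Lemma slice_hyperholomorphic0 : slice_hyperholomorphic qhalf_ball (fun=> 0 : quat R).
Proof.
apply/slice_hyperholomorphicP; split=> [q _|J _]; first exact: differentiable_cst.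
exact: shol0.
Qed.

(** Total functions stand for functions on the half ball, which is open, so values outside it do not
    affect differentiability at its points. *)
Lemma eq_slice_hyperholomorphic f g : (forall q, qhalf_ball q -> f q = g q) ->
  slice_hyperholomorphic qhalf_ball f -> slice_hyperholomorphic qhalf_ball g.
Proof.
move=> fg /slice_hyperholomorphicP[df hf]; apply/slice_hyperholomorphicP; split=> [q Uq|J Ju]; last first.
  apply: eq_shol (hf J Ju) => z Dz; apply: fg.
  by move: Dz; rewrite -(slice_qhalf_ball Ju).
have [K [_ hK]] := diff_bound (df q Uq).
apply: (@eps_diff _ _ _ _ _ ('d f q) K) => //; first by move=> a u v; rewrite linearP.
move=> e e0; have [d d0 hd] := diff_eps (df q Uq) e0.
have [q1 q0] := Uq; exists (Num.min d (Num.min (1 - `|q|) (qre q))).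
  by rewrite !lt_min d0 subr_gt0 q1.
move=> h; rewrite !lt_min => /and3P[h1 h2 h3]; rewrite -!fg//; first exact: hd.
split; rewrite /qball /qhalf_space /=.
  by apply: (le_lt_trans (ler_normD _ _)); move: h2; clear; lra.
have [hr _ _ _] := qcoord_le h; have := ler_norm (- qre h); rewrite normrN.
by move: hr h3; clear; lra.
Qed.

End SliceHyperholomorphicClosure.

(** * The slice Bergman space *)

Section QuaternionL2.
Context d (T : measurableType d) (R : realType) (mu : {measure set T -> \bar R}).
Variable D : set T.
Hypothesis mD : measurable D.
Implicit Types (F G H : T -> quat R) (a : quat R).

Definition qmeasurable F := [/\ measurable_fun D (fun x => qre (F x)),
  measurable_fun D (fun x => qi (F x)), measurable_fun D (fun x => qj (F x)) &
  measurable_fun D (fun x => qk (F x))].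

Definition qsqint F := (\int[mu]_(x in D) (`|F x| ^+ 2)%:E)%E.

Definition qL2 F := qmeasurable F /\ (qsqint F < +oo)%E.

Definition qinner F G : quat R :=
  Quat (\int[mu]_(x in D) qre (qconj (F x) * G x)) (\int[mu]_(x in D) qi (qconj (F x) * G x))
       (\int[mu]_(x in D) qj (qconj (F x) * G x)) (\int[mu]_(x in D) qk (qconj (F x) * G x)).

Lemma qmeasurable_cst a : qmeasurable (fun=> a).
Proof. by split; exact: measurable_cst. Qed.

Lemma qmeasurableD F G : qmeasurable F -> qmeasurable G -> qmeasurable (fun x => F x + G x).
Proof. by move=> [f1 f2 f3 f4] [g1 g2 g3 g4]; split=> /=; exact: measurable_funD. Qed.

Lemma qmeasurableM F G : qmeasurable F -> qmeasurable G -> qmeasurable (fun x => F x * G x).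
Proof.
move=> [f1 f2 f3 f4] [g1 g2 g3 g4]; split=> /=.
- by apply: measurable_funB; [apply: measurable_funB; [apply: measurable_funB|]|]; exact: measurable_funM.
- by apply: measurable_funB; [apply: measurable_funD; [apply: measurable_funD|]|]; exact: measurable_funM.
- by apply: measurable_funD; [apply: measurable_funD; [apply: measurable_funB|]|]; exact: measurable_funM.
- by apply: measurable_funD; [apply: measurable_funB; [apply: measurable_funD|]|]; exact: measurable_funM.
Qed.

Lemma qmeasurableJ F : qmeasurable F -> qmeasurable (fun x => qconj (F x)).
Proof. by move=> [f1 f2 f3 f4]; split=> //=; exact: measurableT_comp. Qed.

Lemma qmeasurableB F G : qmeasurable F -> qmeasurable G -> qmeasurable (fun x => F x - G x).
Proof.
move=> mF /(fun h => qmeasurableM h (qmeasurable_cst (-1))) mG.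
rewrite (_ : (fun x => F x - G x) = fun x => F x + G x * (-1)); first exact: qmeasurableD.
by apply/funext => x; rewrite mulrN1.
Qed.

Lemma measurable_sqnorm F : qmeasurable F -> measurable_fun D (fun x => `|F x| ^+ 2 : R).
Proof.
move=> [f1 f2 f3 f4]; rewrite (_ : (fun x => _) = fun x => qre (F x) ^+ 2 + qi (F x) ^+ 2 + qj (F x) ^+ 2 + qk (F x) ^+ 2).
  by apply: measurable_funD; [apply: measurable_funD; [apply: measurable_funD|]|]; exact: measurable_funX.
by apply/funext => x; exact: sqr_qnormE.
Qed.

Lemma qL2_integrable F : qL2 F -> mu.-integrable D (EFin \o (fun x => `|F x| ^+ 2 : R)).
Proof.
move=> [mF foo]; apply/integrableP; split.
  by apply/measurable_EFinP; exact: measurable_sqnorm.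
apply: le_lt_trans foo; rewrite le_eqVlt; apply/orP; left; apply/eqP.
by apply: eq_integral => x _ /=; rewrite ger0_norm ?sqr_ge0.
Qed.

Lemma qL2_le F G (k : R) : 0 <= k -> qmeasurable F -> qL2 G -> (forall x, D x -> `|F x| <= k * `|G x|) -> qL2 F.
Proof.
move=> k0 mF GL FG; split=> //.
have /integrableP[mm] := integrableZl mD (k ^+ 2) (qL2_integrable GL).
apply: le_lt_trans; apply: ge0_le_integral => //=.
- by apply/measurable_EFinP; exact: measurable_sqnorm.
- by apply/measurable_EFinP; apply: measurableT_comp => //; apply: measurable_funM => //; apply: measurable_sqnorm; case: GL.
move=> x Dx; rewrite lee_fin ger0_norm ?mulr_ge0 ?sqr_ge0// -exprMn.
by rewrite lerXn2r ?nnegrE ?mulr_ge0//; exact: FG.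
Qed.

Lemma qL2D F G : qL2 F -> qL2 G -> qL2 (fun x => F x + G x).
Proof.
move=> FL GL; split; first by apply: qmeasurableD; [case: FL | case: GL].
have /integrableP[mm] := integrableZl mD 2 (integrableD mD (qL2_integrable FL) (qL2_integrable GL)).
have mFG : qmeasurable (fun x => F x + G x) by apply: qmeasurableD; [case: FL | case: GL].
apply: le_lt_trans; apply: ge0_le_integral => //=.
- by apply/measurable_EFinP; exact: measurable_sqnorm.
- apply/measurable_EFinP; apply: measurableT_comp => //; apply: measurable_funM => //.
  by apply: measurable_funD; apply: measurable_sqnorm; [case: FL | case: GL].
move=> x Dx; rewrite lee_fin ger0_norm ?mulr_ge0 ?addr_ge0 ?sqr_ge0//.
apply: (@le_trans _ _ ((`|F x| + `|G x|) ^+ 2)).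
  by rewrite lerXn2r ?nnegrE ?addr_ge0//; exact: ler_normD.
have := sqr_ge0 (`|F x| - `|G x| : R); rewrite sqrrB sqrrD; lra.
Qed.

Lemma qL2Mr F a : qL2 F -> qL2 (fun x => F x * a).
Proof.
move=> FL; apply: (@qL2_le _ F `|a|) => //.
  by apply: qmeasurableM; [case: FL | exact: qmeasurable_cst].
by move=> x _; rewrite qnormM mulrC.
Qed.

Lemma qL2B F G : qL2 F -> qL2 G -> qL2 (fun x => F x - G x).
Proof.
move=> FL /(qL2Mr (-1)) GL; rewrite (_ : (fun x => F x - G x) = fun x => F x + G x * (-1)); first exact: qL2D.
by apply/funext => x; rewrite mulrN1.
Qed.

Lemma qinner_integrable F G : qL2 F -> qL2 G ->
  [/\ mu.-integrable D (EFin \o (fun x => qre (qconj (F x) * G x))),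
      mu.-integrable D (EFin \o (fun x => qi (qconj (F x) * G x))),
      mu.-integrable D (EFin \o (fun x => qj (qconj (F x) * G x))) &
      mu.-integrable D (EFin \o (fun x => qk (qconj (F x) * G x)))].
Proof.
move=> FL GL; have [m1 m2 m3 m4] : qmeasurable (fun x => qconj (F x) * G x).
  by apply: qmeasurableM; [apply: qmeasurableJ; case: FL | case: GL].
have ig := integrableD mD (qL2_integrable FL) (qL2_integrable GL).
have key (u : T -> R) : measurable_fun D u -> (forall x, `|u x| <= `|qconj (F x) * G x|) ->
    mu.-integrable D (EFin \o u).
  move=> mu_ le_u; apply: (le_integrable mD _ _ ig); first exact/measurable_EFinP.
  move=> x Dx /=; rewrite lee_fin [leRHS]ger0_norm ?addr_ge0 ?sqr_ge0//.
  apply: (le_trans (le_u x)); rewrite qnormM qnorm_conj.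
  have := sqr_ge0 (`|F x| - `|G x| : R); rewrite sqrrB.
  have := mulr_ge0 (normr_ge0 (F x)) (normr_ge0 (G x)); lra.
by split; apply: key => // x; have [] := qcoord_le (qconj (F x) * G x).
Qed.

(** Each coordinate of a right multiple is a real combination of all four coordinates, so linearity
    is needed for four terms at once. *)
Lemma Rintegral_lin4 (u1 u2 u3 u4 : T -> R) (k1 k2 k3 k4 : R) :
  mu.-integrable D (EFin \o u1) -> mu.-integrable D (EFin \o u2) ->
  mu.-integrable D (EFin \o u3) -> mu.-integrable D (EFin \o u4) ->
  \int[mu]_(x in D) (k1 * u1 x + k2 * u2 x + k3 * u3 x + k4 * u4 x) =
  k1 * \int[mu]_(x in D) u1 x + k2 * \int[mu]_(x in D) u2 x +
  k3 * \int[mu]_(x in D) u3 x + k4 * \int[mu]_(x in D) u4 x.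
Proof.
move=> i1 i2 i3 i4.
have z k u : mu.-integrable D (EFin \o u) -> mu.-integrable D (EFin \o (fun x => k * u x)).
  by move=> iu; exact: (@integrableZl _ _ _ mu _ mD k _ iu).
have s u v : mu.-integrable D (EFin \o u) -> mu.-integrable D (EFin \o v) ->
    mu.-integrable D (EFin \o (fun x => u x + v x)).
  by move=> iu iv; exact: (@integrableD _ _ _ mu _ mD _ _ iu iv).
have j1 := z k1 _ i1; have j2 := z k2 _ i2; have j3 := z k3 _ i3; have j4 := z k4 _ i4.
have j12 := s _ _ j1 j2; have j123 := s _ _ j12 j3.
by rewrite (RintegralD mD j123 j4) (RintegralD mD j12 j3) (RintegralD mD j1 j2) !RintegralZl.
Qed.

Lemma qinnerMr F G a : qL2 F -> qL2 G -> qinner F (fun x => G x * a) = qinner F G * a.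
Proof.
move=> FL GL; have [i1 i2 i3 i4] := qinner_integrable FL GL.
case: a => a0 a1 a2 a3; congr Quat => /=.
- transitivity (a0 * (qinner F G).(qre) + (- a1) * (qinner F G).(qi) + (- a2) * (qinner F G).(qj) + (- a3) * (qinner F G).(qk)).
    by rewrite /qinner /= -Rintegral_lin4//; apply: eq_Rintegral => x _ /=; ring.
  by rewrite /qinner /=; ring.
- transitivity (a1 * (qinner F G).(qre) + a0 * (qinner F G).(qi) + a3 * (qinner F G).(qj) + (- a2) * (qinner F G).(qk)).
    by rewrite /qinner /= -Rintegral_lin4//; apply: eq_Rintegral => x _ /=; ring.
  by rewrite /qinner /=; ring.
- transitivity (a2 * (qinner F G).(qre) + (- a3) * (qinner F G).(qi) + a0 * (qinner F G).(qj) + a1 * (qinner F G).(qk)).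
    by rewrite /qinner /= -Rintegral_lin4//; apply: eq_Rintegral => x _ /=; ring.
  by rewrite /qinner /=; ring.
- transitivity (a3 * (qinner F G).(qre) + a2 * (qinner F G).(qi) + (- a1) * (qinner F G).(qj) + a0 * (qinner F G).(qk)).
    by rewrite /qinner /= -Rintegral_lin4//; apply: eq_Rintegral => x _ /=; ring.
  by rewrite /qinner /=; ring.
Qed.

Lemma qinnerD F G H : qL2 F -> qL2 G -> qL2 H ->
  qinner F (fun x => G x + H x) = qinner F G + qinner F H.
Proof.
move=> FL GL HL; have [i1 i2 i3 i4] := qinner_integrable FL GL.
have [j1 j2 j3 j4] := qinner_integrable FL HL.
by congr Quat; rewrite -RintegralD//; apply: eq_Rintegral => x _; rewrite mulrDr.
Qed.

Lemma qinnerC F G : qL2 F -> qL2 G -> qinner G F = qconj (qinner F G).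
Proof.
move=> FL GL; have [i1 i2 i3 i4] := qinner_integrable FL GL.
have N (u v : T -> R) : mu.-integrable D (EFin \o u) -> (forall x, v x = - u x) ->
    \int[mu]_(x in D) v x = - \int[mu]_(x in D) u x.
  by move=> iu vu; rewrite -mulN1r -RintegralZl//; apply: eq_Rintegral => x _; rewrite vu mulN1r.
rewrite /qinner /qconj /=; congr Quat.
- by apply: eq_Rintegral => x _; ring.
- by apply: N => // x /=; ring.
- by apply: N => // x /=; ring.
- by apply: N => // x /=; ring.
Qed.

Lemma qre_qinner F : qre (qinner F F) = \int[mu]_(x in D) (`|F x| ^+ 2).
Proof.
by rewrite /qinner [LHS]/=; apply: eq_Rintegral => x _; rewrite sqr_qnormE; ring.
Qed.

Lemma qsqintE F : qL2 F -> qsqint F = (\int[mu]_(x in D) (`|F x| ^+ 2))%:E.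
Proof.
move=> FL; rewrite /qsqint /Rintegral fineK//; apply: integrable_fin_num => //.
exact: qL2_integrable.
Qed.

End QuaternionL2.

Section SliceBergmanSpace.
Variable R : realType.
Notation mu2 := ((@lebesgue_measure R) \x (@lebesgue_measure R))%E.
Implicit Types (f g : quat R -> quat R) (I J a q : quat R) (D : set R[i]) (F : R[i] -> quat R).

(** Each coordinate is, up to sign, the real part of [F] times a basis element, which is the real
    part of a holomorphic component. *)
Lemma shol_qmeasurable I D F : imag_unit I -> copen D -> shol I D F ->
  qmeasurable (planar D) (fun p => F (Complex p.1 p.2)).
Proof.
move=> Iu oD hF; have mD := copen_measurable oD.
have key a : measurable_fun (planar D) (fun p => qre (F (Complex p.1 p.2) * a)).
  exact: (ccont_measurable_Re mD (hol_ccont (shol_hol a Iu hF))).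
split.
- by have := key 1; under eq_fun do rewrite mulr1.
- rewrite (_ : (fun p => _) = fun p => - qre (F (Complex p.1 p.2) * Quat 0 1 0 0)); first exact: measurableT_comp.
  by apply/funext => p /=; ring.
- rewrite (_ : (fun p => _) = fun p => - qre (F (Complex p.1 p.2) * Quat 0 0 1 0)); first exact: measurableT_comp.
  by apply/funext => p /=; ring.
- rewrite (_ : (fun p => _) = fun p => - qre (F (Complex p.1 p.2) * Quat 0 0 0 1)); first exact: measurableT_comp.
  by apply/funext => p /=; ring.
Qed.

Lemma slice_coord_sqint I D F a : imag_unit I -> copen D -> shol I D F -> `|a| = 1 ->
  (sqint D (fun z => slice_coord I (F z * a)%R) <=
   4%:E * qsqint mu2 (planar D) (fun p => F (Complex p.1 p.2)))%E.
Proof.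
move=> Iu oD hF a1; have mD := copen_measurable oD.
have mF := shol_qmeasurable Iu oD hF.
rewrite /qsqint -ge0_integralZl//=; last by apply/measurable_EFinP; exact: measurable_sqnorm.
apply: ge0_le_integral => //.
- by move=> p _; rewrite lee_fin sqr_ge0.
- by apply/measurable_EFinP; exact: (measurable_sqnormc oD (hol_ccont (shol_hol a Iu hF))).
- by apply/measurable_EFinP; apply: measurable_funM => //; exact: measurable_sqnorm.
move=> p Dp; rewrite lee_fin; have := normc_slice_coord (F (Complex p.1 p.2) * a) Iu.
rewrite qnormM a1 mulr1 => h.
have -> : 4 * `|F (Complex p.1 p.2)| ^+ 2 = (2 * `|F (Complex p.1 p.2)|) ^+ 2 by rewrite exprMn; congr (_ * _); rewrite -natrX.
by rewrite lerXn2r ?nnegrE ?mulr_ge0 ?normc_ge0.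
Qed.

Lemma shol_bound I D w : imag_unit I -> copen D -> D w -> exists2 C : R, 0 < C &
  forall F (d : R), shol I D F -> 0 < d ->
    (qsqint mu2 (planar D) (fun p => F (Complex p.1 p.2)) <= (d ^+ 2)%:E)%E -> `|F w| <= C * d.
Proof.
move=> Iu oD Dw; have [r r0 hr] := oD w Dw; have [C C0 hC] := bergman_bound r0.
exists (4 * C); first by rewrite mulr_gt0.
move=> F d hF d0 Fd; rewrite (slice_coord_sum (F w) Iu).
(* The modulus of [slice_coord] is at most twice that of the quaternion, so each component has L2
   norm at most [2 d]. *)
have d2 : 0 < 2 * d by rewrite mulr_gt0.
have b n : `|slice_pt I (slice_coord I (F w * qbasis R n)) * qconj (qbasis R n)| <= C * (2 * d).
  rewrite qnormM qnorm_conj qbasis_norm mulr1 norm_slice_pt//.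
  have [] := hC D w (fun z => slice_coord I (F z * qbasis R n)) (2 * d) oD hr (shol_hol _ Iu hF) d2 => //.
  apply: (le_trans (slice_coord_sqint Iu oD hF (qbasis_norm R n))).
  rewrite exprMn EFinM (_ : (2 ^+ 2)%:E = 4%:E); last by rewrite -natrX.
  by rewrite lee_pmul2l// lte_fin.
rewrite normrZ ger0_norm ?invr_ge0//; apply: (@le_trans _ _ (2^-1 * \sum_(n < 4) C * (2 * d))).
  by rewrite ler_wpM2l ?invr_ge0//; apply: (le_trans (ler_norm_sum _ _ _)); apply: ler_sum => n _; exact: b.
by rewrite sumr_const card_ord -mulr_natl; move: C0 d0; clear; nra.
Qed.

End SliceBergmanSpace.

Section SliceBergmanRKHS.
Variables (R : realType) (I : quat R).
Hypothesis Iu : imag_unit I.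
Notation mu2 := ((@lebesgue_measure R) \x (@lebesgue_measure R))%E.
Notation D := (planar (@half_disc R)).
Implicit Types (f g : quat R -> quat R) (a q : quat R).

Let oD : copen (@half_disc R) := @copen_half_disc R.
(* The displays inferred for [R * R] from [mu2] and from [planar] are only
   convertible; here the one of [mu2] is selected. *)
Let measurable_mu d (T : measurableType d) (mu : {measure set T -> \bar R}) (X : set T)
  (mX : measurable X) := mX.
Let mD := @measurable_mu _ _ mu2 D (copen_measurable oD).

Definition on_slice f (p : R * R) : quat R := f (slice_pt I (Complex p.1 p.2)).

Notation ip := (slice_ip I qhalf_ball).
Notation A := (slice_bergman I qhalf_ball).

Lemma slice_bergmanP f : A f <->
  slice_hyperholomorphic qhalf_ball f /\ qL2 mu2 D (on_slice f).
Proof.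
rewrite /slice_bergman /= slice_qhalf_ball//.
have := @pi_scale_lty R (qsqint mu2 D (on_slice f)) => /(_ _)[].
  by apply: integral_ge0 => p _; rewrite lee_fin sqr_ge0.
move=> h1 h2; split=> [[hf /h1 fL]|[hf [_ /h2 fL]]]; split=> //; split=> //.
exact: (shol_qmeasurable Iu oD (slice_hyperholomorphic_shol Iu hf)).
Qed.

Lemma slice_ipE f g : ip f g = pi^-1 *: qinner mu2 D (on_slice f) (on_slice g).
Proof. by rewrite /slice_ip slice_qhalf_ball. Qed.

Lemma qre_slice_ip f : qre (ip f f) = pi^-1 * \int[mu2]_(p in D) (`|on_slice f p| ^+ 2).
Proof. by rewrite slice_ipE /= -qre_qinner. Qed.

Lemma qre_slice_ip_ge0 f : 0 <= qre (ip f f).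
Proof.
rewrite qre_slice_ip mulr_ge0 ?invr_ge0 ?pi_ge0//.
by apply: Rintegral_ge0 => p _; exact: sqr_ge0.
Qed.

Lemma ip_norm_le f (e : R) : qL2 mu2 D (on_slice f) -> 0 <= e ->
  (ip_norm ip f <= e) = (qsqint mu2 D (on_slice f) <= (pi * e ^+ 2)%:E)%E.
Proof.
move=> fL e0; rewrite (qsqintE mD fL) lee_fin -ler_pdivrMl ?pi_gt0// -qre_slice_ip /ip_norm.
rewrite -[in LHS](ger0_norm e0) -sqrtr_sqr ler_sqrt ?sqr_ge0//.
Qed.

Lemma slice_bergmanB f g : A f -> A g -> A (f \- g).
Proof.
move=> /slice_bergmanP[hf fL] /slice_bergmanP[hg gL]; apply/slice_bergmanP; split.
  exact: slice_hyperholomorphicB.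
exact: (qL2B mD fL gL).
Qed.

Lemma ext_norm_le (F : R[i] -> quat R) q (B : R) :
  `|F (slice_coord_of q)| <= B -> `|F (slice_coord_of q)^*%C| <= B -> `|ext I F q| <= 2 * B.
Proof.
move=> b1 b2; rewrite -[q in ext _ _ q]slice_unitK ext_slice_mix; last exact: slice_unitP.
have [n1 n2] := slice_mix_norm Iu (slice_unitP q).
rewrite /slice_mix; apply: (le_trans (ler_normD _ _)); rewrite !qnormM.
have B0 : 0 <= B by exact: le_trans b1.
rewrite mulr2n mulrDl !mul1r; apply: lerD.
  by apply: (le_trans _ b1); rewrite ler_piMl.
by apply: (le_trans _ b2); rewrite ler_piMl.
Qed.

(** The norm sees only the slice of [I], so [f q] is first written by the representation formula
    through two conjugate points of that slice, where the complex estimates apply. The factor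
    [sqrt pi] undoes the normalisation of the inner product. *)
Lemma slice_bergman_eval q : qhalf_ball q -> exists2 C : R, 0 < C &
  forall f (d : R), A f -> 0 < d -> ip_norm ip f <= d -> `|f q| <= C * d.
Proof.
move=> Uq; have Dz := slice_coord_of_half_disc Uq; have Dz' := half_disc_conj Dz.
have [C C0 hC] := shol_bound Iu oD Dz; have [C' C'0 hC'] := shol_bound Iu oD Dz'.
have pi0 : 0 < Num.sqrt (pi : R) by rewrite sqrtr_gt0 pi_gt0.
exists (2 * (Num.max C C' * Num.sqrt pi)).
  by rewrite !mulr_gt0// lt_max C0.
move=> f d Af d0; have [hf fL] := (slice_bergmanP f).1 Af.
rewrite (ip_norm_le fL (ltW d0)) => fd.
have hF := slice_hyperholomorphic_shol Iu hf.
rewrite (slice_hyperholomorphic_ext Iu hf Uq) -mulrA.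
have d1 : 0 < Num.sqrt pi * d by rewrite mulr_gt0.
have fd' : (qsqint mu2 D (on_slice f) <= ((Num.sqrt pi * d) ^+ 2)%:E)%E.
  by rewrite exprMn sqr_sqrtr ?pi_ge0.
apply: ext_norm_le.
  apply: (le_trans (hC _ _ hF d1 fd')); rewrite -mulrA ler_wpM2r ?(ltW d1)// le_max lexx //.
by apply: (le_trans (hC' _ _ hF d1 fd')); rewrite -mulrA ler_wpM2r ?(ltW d1)// le_max lexx orbT.
Qed.

Lemma slice_bergman_ip_eq0 f : A f -> ip f f = 0 <-> forall q, qhalf_ball q -> f q = 0.
Proof.
move=> Af; split=> [f0 q Uq|f0].
  have [C C0 hC] := slice_bergman_eval Uq.
  have n0 : ip_norm ip f = 0 by rewrite /ip_norm f0 /= sqrtr0.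
  apply/eqP; rewrite -normr_le0; apply/ler_addgt0Pr => e e0; rewrite add0r.
  have := hC f (e / C) Af (divr_gt0 e0 C0); rewrite n0 (ltW (divr_gt0 e0 C0)) => /(_ isT).
  by rewrite mulrC divfK// gt_eqF.
have z (c : quat R -> R) : c 0 = 0 ->
    \int[mu2]_(p in D) c (qconj (on_slice f p) * on_slice f p) = 0.
  move=> c0; transitivity (\int[mu2]_(p in D) (0 : R)).
    apply: eq_Rintegral => p; rewrite inE => Dp; rewrite /on_slice f0 ?mulr0//.
    by move: Dp; rewrite /planar /= -(slice_qhalf_ball Iu).
  by rewrite (Rintegral_cst mu2 mD) mul0r.
by rewrite slice_ipE /qinner !z//; congr Quat => /=; rewrite mulr0.
Qed.

(** The complex components converge to holomorphic limits on the slice of [I]; [ext] then produces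
    the limit on the whole half ball. *)
Lemma slice_bergman_complete (u : nat -> quat R -> quat R) : (forall n, A (u n)) ->
  (forall e : R, 0 < e -> exists N, forall m n, (N <= m)%N -> (N <= n)%N ->
    ip_norm ip (u m \- u n) < e) ->
  exists2 f, A f & ip_norm ip (u n \- f) @[n --> \oo] --> (0 : R).
Proof.
move=> uA uc.
have hu n : slice_hyperholomorphic qhalf_ball (u n) := ((slice_bergmanP (u n)).1 (uA n)).1.
have uL n : qL2 mu2 D (on_slice (u n)) := ((slice_bergmanP (u n)).1 (uA n)).2.
have cau (e : R) : 0 < e -> exists N, forall m n, (N <= m)%N -> (N <= n)%N ->
    (qsqint mu2 D (on_slice (u m \- u n)%R) <= (pi * e ^+ 2)%:E)%E.
  move=> e0; have [N hN] := uc e e0; exists N => m n Nm Nn.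
  have L := qL2B mD (uL m) (uL n); rewrite -(ip_norm_le L (ltW e0)); exact/ltW/hN.
pose F n z := u n (slice_pt I z).
have hF n : shol I half_disc (F n) by exact: slice_hyperholomorphic_shol.
have /choice[h hh] : forall k : 'I_4, exists h, hol half_disc h /\
    forall z, half_disc z -> ccvg (fun n => slice_coord I (F n z * qbasis R k)) (h z).
  move=> k; have [||h h1 h2] := @hol_limit R half_disc (fun n z => slice_coord I (F n z * qbasis R k)) oD.
  - by move=> n; exact: shol_hol.
  (* Passing to a component costs a factor 4, and [4 pi (e / 4)^2 = (pi / 4) e^2 <= e^2] because
     [pi < 4]. *)
  - move=> e e0; have [N hN] := cau (e / 4) (divr_gt0 e0 (ltr0n R 4)).
    exists N => m n Nm Nn.
    have -> : (fun z => slice_coord I (F m z * qbasis R k) - slice_coord I (F n z * qbasis R k)) =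
        (fun z => slice_coord I ((u m \- u n) (slice_pt I z) * qbasis R k)).
      by apply/funext => z; rewrite -slice_coordB -mulrBl.
    have hB := slice_hyperholomorphic_shol Iu (slice_hyperholomorphicB (hu m) (hu n)).
    apply: (le_trans (slice_coord_sqint Iu oD hB (qbasis_norm R k))).
    apply: (le_trans (lee_wpmul2l _ (hN m n Nm Nn))) => //.
    rewrite -EFinM lee_fin (_ : 4 * _ = pi / 2 / 2 * e ^+ 2); last by field.
    by rewrite ler_piMl ?sqr_ge0// ler_pdivrMr// mul1r ltW// pihalf_lt2.
  by exists h.
pose G z := 2^-1 *: \sum_(k < 4) slice_pt I (h k z) * qconj (qbasis R k).
have hG : shol I half_disc G by apply: hol_shol => // k; case: (hh k).
pose f := ext I G; have hf : slice_hyperholomorphic qhalf_ball f by exact: ext_slice_hyperholomorphic.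
(* For [J = I] the mixing factors are 1 and 0. *)
have fG z : f (slice_pt I z) = G z.
  rewrite /f ext_slice_mix// /slice_mix imag_unit_mul// opprK subrr scaler0 mul0r addr0.
  have -> : 2^-1 *: (1 + 1) = 1 :> quat R by congr Quat => /=; lra.
  by rewrite mul1r.
have cvgG z (e : R) : half_disc z -> 0 < e -> exists N, forall n, (N <= n)%N -> `|F n z - G z| <= e.
  move=> Dz e0; have e2 : 0 < e / 2 by rewrite divr_gt0.
  have /choice[N hN] : forall k : 'I_4, exists N, forall n, (N <= n)%N ->
    normc (slice_coord I (F n z * qbasis R k) - h k z) <= e / 2 by move=> k; exact: (hh k).2.
  exists (\max_k N k) => n Nn; rewrite (slice_coord_sum (F n z) Iu) /G -scalerBr -sumrB.
  rewrite normrZ ger0_norm ?invr_ge0//; apply: (@le_trans _ _ (2^-1 * \sum_(k < 4) e / 2)).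
    rewrite ler_wpM2l ?invr_ge0//; apply: (le_trans (ler_norm_sum _ _ _)); apply: ler_sum => k _.
    rewrite -mulrBl qnormM qnorm_conj qbasis_norm mulr1 -slice_ptB norm_slice_pt//.
    by apply: hN; apply: leq_trans Nn; exact: leq_bigmax.
  by rewrite (_ : 2^-1 * _ = e)// !big_ord_recr big_ord0 /=; field.
(* For fixed [n], Fatou's lemma in [m] turns the Cauchy bound on [u n - u m] into the same bound on
   [u n - f]. *)
have fat (e : R) : 0 < e -> exists N, forall n, (N <= n)%N ->
    (qsqint mu2 D (on_slice (u n \- f)%R) <= (pi * e ^+ 2)%:E)%E.
  move=> e0; have [N hN] := cau e e0; exists N => n Nn.
  apply: (@fatou_bound _ _ R mu2 D (fun m p => `|on_slice (u n) p - on_slice (u m) p| ^+ 2) _ _ N mD).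
  - by move=> m; apply: measurable_sqnorm; apply: qmeasurableB; case: (uL n); case: (uL m).
  - by move=> m p _; exact: sqr_ge0.
  - move=> p Dp; have c : `|on_slice (u n) p - on_slice (u m) p| @[m --> \oo] --> (`|on_slice (u n \- f) p| : R).
      apply/cvgrPdist_le => e' e'0; have [M hM] := cvgG _ e' Dp e'0.
      exists M => // m /= Mm; apply: (le_trans (ler_dist_dist _ _)).
      rewrite /on_slice /= fG.
      rewrite [X in `|X|](_ : _ = F m (Complex p.1 p.2) - G (Complex p.1 p.2)); first exact: hM.
      by rewrite opprB addrC addrA subrK.
    by rewrite expr2; under eq_fun do rewrite expr2; exact: cvgM.
  - by move=> m Nm; exact: hN.
(* [f] is the difference of [u N] and [u N - f], both square integrable. *)
have fL : qL2 mu2 D (on_slice f).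
  have [N hN] := fat 1 ltr01; have := hN N (leqnn N).
  have mf : qmeasurable D (on_slice (u N \- f)).
    exact: (shol_qmeasurable Iu oD (slice_hyperholomorphic_shol Iu (slice_hyperholomorphicB (hu N) hf))).
  move=> le1; have dL : qL2 mu2 D (on_slice (u N \- f)).
    by split=> //; apply: le_lt_trans le1 _; exact: ltry.
  rewrite (_ : on_slice f = fun p => on_slice (u N) p - on_slice (u N \- f) p).
    exact: (qL2B mD (uL N) dL).
  by apply/funext => p; rewrite /on_slice /= subKr.
have Af : A f by apply/slice_bergmanP.
exists f => //; apply/cvgrPdist_le => e e0; have [N hN] := fat e e0.
exists N => // n /= Nn; rewrite sub0r normrN ger0_norm; last exact: sqrtr_ge0.
have [_ dL] := (slice_bergmanP _).1 (slice_bergmanB (uA n) Af).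
by rewrite (ip_norm_le dL (ltW e0)); exact: hN.
Qed.

Theorem slice_bergman_RKHS : right_quaternionic_RKHS qhalf_ball A ip.
Proof.
have L f : A f -> qL2 mu2 D (on_slice f) by case/slice_bergmanP.
split.
- move=> f g /slice_bergmanP[hf [mf fL]] fg; apply/slice_bergmanP.
  have hg := eq_slice_hyperholomorphic fg hf; split=> //; split.
    exact: (shol_qmeasurable Iu oD (slice_hyperholomorphic_shol Iu hg)).
  rewrite (_ : qsqint _ _ _ = qsqint mu2 D (on_slice f))//.
  apply: eq_integral => p; rewrite inE => Dp; rewrite /on_slice fg//.
  by move: Dp; rewrite /planar /= -(slice_qhalf_ball Iu).
- apply/slice_bergmanP; split; first exact: slice_hyperholomorphic0.
  split; first exact: qmeasurable_cst.
  rewrite /qsqint; under eq_integral do rewrite /on_slice normr0 expr0n /=.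
  by rewrite integral0.
- move=> f g /slice_bergmanP[hf fL] /slice_bergmanP[hg gL]; apply/slice_bergmanP; split.
    exact: slice_hyperholomorphicD.
  exact: (qL2D mD fL gL).
- move=> f a /slice_bergmanP[hf fL]; apply/slice_bergmanP; split.
    exact: slice_hyperholomorphicMr.
  exact: (qL2Mr mD a fL).
- move=> f g /L fL /L gL; rewrite !slice_ipE (qinnerC mD fL gL).
  by congr Quat => /=; ring.
- move=> f g h /L fL /L gL /L hL; rewrite !slice_ipE -scalerDr; congr (_ *: _).
  exact: (qinnerD mD fL gL hL).
- move=> f g a /L fL /L gL; rewrite !slice_ipE -scalerAl; congr (_ *: _).
  exact: (qinnerMr mD a fL gL).
- by move=> f _; exact: qre_slice_ip_ge0.
- exact: slice_bergman_ip_eq0.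
- exact: slice_bergman_complete.
move=> q Uq f Af e e0; have [C C0 hC] := slice_bergman_eval Uq.
(* The half leaves room for strictness, since the evaluation bound is not strict. *)
have d0 : 0 < e / 2 / C by rewrite !divr_gt0.
exists (e / 2 / C) => // g Ag /ltW gf.
apply: (le_lt_trans (hC _ _ (slice_bergmanB Ag Af) d0 gf)).
by rewrite mulrC divfK ?gt_eqF// ltr_pdivrMr// ltr_pMr// ltr1n.
Qed.

End SliceBergmanRKHS.

Theorem theorem5p2 (R : realType) :
  (forall I : quat R, imag_unit I ->
    right_quaternionic_RKHS qhalf_ball (slice_bergman I qhalf_ball)
      (slice_ip I qhalf_ball)) /\
  (forall q r : quat R, qhalf_ball q -> qhalf_ball r ->
    forall J : quat R, imag_unit J -> slice_plane J r ->
    slice_kernel qhalf_ball J q r =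
    slice_kernel qball J q r + slice_kernel qhalf_space J q r).
Proof.
by split; [exact: slice_bergman_RKHS | move=> q r hq hr J; exact: slice_kernelD].
Qed.
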